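(* Let $N\ge2$ be an integer and $\beta\in\{1,2,4\}$, with $\mathbb F=\mathbb R,\mathbb C,\mathbb H$ for $\beta=1,2,4$ respectively. Set $$E_{N,\beta}(R)=\begin{cases}R^{N(N-2)},&\beta=1,\\ R^{2N(N-2)}\log R,&\beta=2,\\ R^{4N(N-1)-2N},&\beta=4.\end{cases}$$ As $R\to\infty$, $$\widehat I_N^{(\beta)}(R)=\widehat C_N^{(\beta)}R^{\beta N(N-1)}+O\big(E_{N,\beta}(R)\big),$$ where $$\widehat C_N^{(\beta)}=\frac{2}{2^N\,\Gamma\big(\beta N(N-1)/2+1\big)}\,\frac1{\Gamma(\beta N/2)}\prod_{j=1}^N\frac{\Gamma(\beta j/2)^2}{\Gamma(\beta/2)},$$ and $$\mathrm{vol}\,D_R^{\|\cdot\|_F}\big(\mathrm{SL}_N(\mathbb F)\big)=\frac{\pi^{\beta(N^2-1)/2}\,\Gamma(\beta/2)}{\Gamma(\beta N/2)\,\Gamma\big(\beta N(N-1)/2+1\big)}\,R^{\beta N(N-1)}+O\big(E_{N,\beta}(R)\big).$$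
   Context: $D_R^{\|\cdot\|_F}(\mathrm{SL}_N(\mathbb F))=\{M\in\mathrm{SL}_N(\mathbb F):\sum_{j=1}^N\sigma_j^2\le R^2\}$, where $\sigma_1\ge\cdots\ge\sigma_N\ge0$ are the singular values of $M$ (quaternion matrices being represented as complex $2N\times2N$ matrices, with each singular value, which occurs twice, counted once). $$\widehat I_N^{(\beta)}(R)=\frac1{N!}\int_{\sigma_l>0,\ \sum_{j=1}^N\sigma_j^2\le R^2}\delta\Big(1-\prod_{l=1}^N\sigma_l\Big)\prod_{1\le j<k\le N}|\sigma_j^2-\sigma_k^2|^{\beta}\,d\sigma_1\cdots d\sigma_N ,$$ where the delta function means: set $\sigma_N=1/(\sigma_1\cdots\sigma_{N-1})$ and integrate against $(\sigma_1\cdots\sigma_{N-1})^{-1}d\sigma_1\cdots d\sigma_{N-1}$ over the corresponding region. The volume is with respect to the invariant (Haar) measure $\delta(1-\det G)(dG)$ on $\mathrm{SL}_N(\mathbb F)$, with normalisation fixed, via the singular value decomposition, by $$\mathrm{vol}\big(D_R^{\|\cdot\|_F}(\mathrm{SL}_N(\mathbb F))\big)=\Big(\frac{2\pi^{\beta/2}}{\Gamma(\beta/2)}\Big)^{-(N+1)}\big(\mathrm{vol}\,\mathrm U_N(\mathbb F)\big)^2\,\widehat I_N^{(\beta)}(R),\qquad \mathrm{vol}\,\mathrm U_N(\mathbb F)=2^N\prod_{k=1}^N\frac{\pi^{\beta k/2}}{\Gamma(\beta k/2)}.$$ *)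

(* Defs.v *)
From HB Require Import structures.
From mathcomp Require Import all_boot all_order all_algebra.
From mathcomp Require Import complex.
From mathcomp Require Import all_classical all_reals all_analysis.

Set Implicit Arguments.
Unset Strict Implicit.
Unset Printing Implicit Defensive.

Import Order.TTheory GRing.Theory Num.Theory.
Import numFieldNormedType.Exports.

Local Open Scope classical_set_scope.
Local Open Scope ring_scope.
Local Open Scope sesquilinear_scope.

Inductive division_algebra := Reals | Complexes | Quaternions.

Definition beta (F : division_algebra) : nat :=
  match F with Reals => 1 | Complexes => 2 | Quaternions => 4 end.

(* The ascription to [numClosedFieldType] makes the library find the norm
   topology on R[i] and the entrywise topology on complex matrices. *)
Definition cplx (R : realType) : numClosedFieldType := R[i].

Definition Gamma (R : realType) (a : R) : R :=
  \int[lebesgue_measure]_(x in `]0, +oo[) (x `^ (a - 1) * expR (- x)).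

Fixpoint lebesgue_tuple (R : realType) (n : nat) : set (n.-tuple R) -> \bar R :=
  match n with
  | 0 => dirac [tuple]
  | m.+1 => pushforward (@lebesgue_measure R \x @lebesgue_tuple R m)%E
              (fun p : measurableTypeR R * m.-tuple R => cons_tuple p.1 p.2)
  end.
Arguments lebesgue_tuple {R} n.

Section lebesgue_tuple_measure.
Variable R : realType.

Let consf m (p : measurableTypeR R * m.-tuple R) : m.+1.-tuple R :=
  cons_tuple p.1 p.2.

Let unconsf m (t : m.+1.-tuple R) : measurableTypeR R * m.-tuple R :=
  (thead t, [tuple of behead t]).

Let measurable_consf m : measurable_fun [set: _] (@consf m).
Proof. exact: (measurable_cons measurable_fst measurable_snd). Qed.

Let measurable_unconsf m : measurable_fun [set: _] (@unconsf m).
Proof.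
apply: measurable_fun_pair; last exact: measurable_behead.
exact: measurable_tnth.
Qed.

Let consfK m : cancel (@consf m) (@unconsf m).
Proof. by case=> x t; congr pair => //; apply/val_inj. Qed.

Let lebesgue_tuple_ex n :
  exists mu : {sigma_finite_measure set (n.-tuple R) -> \bar R},
    @lebesgue_tuple R n = mu :> (set (n.-tuple R) -> \bar R).
Proof.
elim: n => [|n [mu muE]]; first by exists (dirac [tuple]).
pose prod := (@lebesgue_measure R \x mu)%E.
have prod_fin : sigma_finite setT prod.
  have /sigma_finiteP[F [TF ndF Foo]] := sigma_finiteT (@lebesgue_measure R).
  have /sigma_finiteP[G [TG ndG Goo]] := sigma_finiteT mu.
  exists (fun k => F k `*` G k).
    rewrite -setXTT TF TG predeqE => -[x y]; split.
      move=> [/= [i _ Fix] [j _ Gjy]]; exists (maxn i j) => //; split.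
        by move: x Fix; exact/subsetPset/ndF/leq_maxl.
      by move: y Gjy; exact/subsetPset/ndG/leq_maxr.
    by move=> [i _ [/= ? ?]]; split; exists i.
  move=> k; have [? ?] := Foo k; have [? ?] := Goo k.
  split; first exact: measurableX.
  by rewrite /prod product_measure1E// lte_mul_pinfty// ge0_fin_numE.
pose nu := measure_function_pushforward__canonical__measure_function_Measure
  prod (@measurable_consf n).
have nu_fin : sigma_finite setT nu.
  have [F FT Foo] := prod_fin.
  exists (fun i => @unconsf n @^-1` F i).
    by rewrite -preimage_bigcup -FT preimage_setT.
  move=> i; have [mF Fi] := Foo i; split.
    by rewrite -[X in measurable X]setTI; exact: measurable_unconsf.
  rewrite /nu/= /pushforward -comp_preimage.
  by rewrite (_ : _ \o _ = id) ?preimage_id//; apply/funext => p /=; exact: consfK.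
pose sf := Measure_isSigmaFinite.Build _ _ _ nu nu_fin.
pose xi : {sigma_finite_measure set (n.+1.-tuple R) -> \bar R} :=
  HB.pack (Measure.sort nu) sf.
by exists xi; rewrite /= muE.
Qed.

Let lebesgue_tuple0 n : @lebesgue_tuple R n set0 = 0%E.
Proof. by have [mu ->] := lebesgue_tuple_ex n; rewrite measure0. Qed.

Let lebesgue_tuple_ge0 n A : (0 <= @lebesgue_tuple R n A)%E.
Proof. by have [mu ->] := lebesgue_tuple_ex n; exact: measure_ge0. Qed.

Let lebesgue_tuple_sigma_additive n : semi_sigma_additive (@lebesgue_tuple R n).
Proof.
by have [mu ->] := lebesgue_tuple_ex n; exact: measure_semi_sigma_additive.
Qed.

HB.instance Definition _ n := isMeasure.Build _ _ _ (@lebesgue_tuple R n)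
  (@lebesgue_tuple0 n) (@lebesgue_tuple_ge0 n)
  (@lebesgue_tuple_sigma_additive n).

Let lebesgue_tuple_sigma_finite n : sigma_finite setT (@lebesgue_tuple R n).
Proof. by have [mu ->] := lebesgue_tuple_ex n; exact: sigma_finiteT. Qed.

HB.instance Definition _ n := Measure_isSigmaFinite.Build _ _ _
  (@lebesgue_tuple R n) (@lebesgue_tuple_sigma_finite n).

End lebesgue_tuple_measure.

(* The complete list (sigma_1, ..., sigma_N) determined by its first N - 1
   entries and the constraint sigma_1 ... sigma_N = 1: index N - 1 is out of
   range in s, so [nth] returns its default. *)
Definition complete_sigma (R : realType) (N : nat) (s : N.-1.-tuple R)
    (j : 'I_N) : R :=
  nth (\prod_(x <- s) x)^-1 s j.

Definition sigma_region (R : realType) (N : nat) (r : R) :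
    set (N.-1.-tuple R) :=
  [set s | (forall l, 0 < tnth s l) /\
           \sum_(j < N) complete_sigma s j ^+ 2 <= r ^+ 2].

Definition I_hat (R : realType) (F : division_algebra) (N : nat) (r : R) : R :=
  N`!%:R^-1 *
  \int[lebesgue_tuple N.-1]_(s in @sigma_region R N r)
    ((\prod_(x <- s) x)^-1 *
     \prod_(j < N) \prod_(k < N | (j < k)%N)
       `|complete_sigma s j ^+ 2 - complete_sigma s k ^+ 2| ^+ beta F).

Definition C_hat (R : realType) (F : division_algebra) (N : nat) : R :=
  2 / (2 ^+ N * Gamma ((beta F * N * (N - 1))%:R / 2 + 1)) *
  (Gamma ((beta F * N)%:R / 2))^-1 *
  \prod_(1 <= j < N.+1) (Gamma ((beta F * j)%:R / 2) ^+ 2 /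
                         Gamma ((beta F)%:R / 2)).

(* The truncated natural subtractions in the exponents are exact for N >= 2. *)
Definition error_term (R : realType) (F : division_algebra) (N : nat) (r : R) :
    R :=
  match F with
  | Reals => r ^+ (N * (N - 2))
  | Complexes => r ^+ (2 * N * (N - 2)) * ln r
  | Quaternions => r ^+ (4 * N * (N - 1) - 2 * N)
  end.

Definition rep_dim (F : division_algebra) (N : nat) : nat :=
  match F with Quaternions => N + N | _ => N end.

(* N x N matrices over F, represented as complex matrices: the quaternion matrix
   A + B j, with A and B complex, is sent to the 2N x 2N matrix with blocks
   A, B, - conj B, conj A. *)
Definition F_matrix (R : realType) (F : division_algebra) (N : nat) :
    set 'M[cplx R]_(rep_dim F N) :=
  match F return set 'M[cplx R]_(rep_dim F N) with
  | Reals => [set M | exists A : 'M[R]_N, M = map_mx (fun x => x%:C%C) A]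
  | Complexes => setT
  | Quaternions => [set M | exists A B : 'M[cplx R]_N,
      M = block_mx A B (- map_mx Num.conj B) (map_mx Num.conj A)]
  end.

(* Over the quaternions \det is the determinant of the 2N x 2N complex
   representation, which is the square of the Dieudonne determinant; as the
   latter is nonnegative, both normalisations give the same group. *)
Definition SL (R : realType) (F : division_algebra) (N : nat) :
    set 'M[cplx R]_(rep_dim F N) :=
  [set M | F_matrix M /\ \det M = 1].

(* How often each singular value occurs in the complex representation. *)
Definition rep_mult (F : division_algebra) : nat :=
  match F with Quaternions => 2 | _ => 1 end.

(* s lists the square roots of the eigenvalues of M^* M in nonincreasing order,
   each one repeated according to its algebraic multiplicity divided by
   [rep_mult F]. *)
Definition singular_values (R : realType) (F : division_algebra) (N : nat)
    (M : 'M[cplx R]_(rep_dim F N)) (s : 'I_N -> R) : Prop :=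
  [/\ forall j, 0 <= s j,
      forall i j : 'I_N, (i <= j)%N -> s j <= s i &
      char_poly (M ^t* *m M) =
        \prod_(j < N) ('X - ((s j ^+ 2)%:C%C : cplx R)%:P) ^+ rep_mult F].

Definition D_ball (R : realType) (F : division_algebra) (N : nat) (r : R) :
    set 'M[cplx R]_(rep_dim F N) :=
  [set M | @SL R F N M /\
     exists2 s : 'I_N -> R, singular_values M s & \sum_(j < N) s j ^+ 2 <= r ^+ 2].

Definition borel_mx (R : realType) (n : nat) :=
  g_sigma_algebraType (@open 'M[cplx R]_n).

(* A Haar measure on a closed matrix group G, seen as a Borel measure on the
   ambient space of matrices that is carried by G. *)
Record is_haar (R : realType) (n : nat) (G : set 'M[cplx R]_n)
    (mu : {measure set (borel_mx R n) -> \bar R}) : Prop := IsHaar {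
  haar_carried : mu (~` G) = 0%E;
  haar_nonzero : mu G <> 0%E;
  haar_compact : forall K : set 'M[cplx R]_n,
    compact K -> K `<=` G -> (mu K < +oo)%E;
  haar_invariant : forall (g : 'M[cplx R]_n) (A : set 'M[cplx R]_n),
    G g -> measurable (A : set (borel_mx R n)) ->
    mu [set g *m x | x in A] = mu A }.

Definition vol_U (R : realType) (F : division_algebra) (N : nat) : R :=
  2 ^+ N * \prod_(1 <= k < N.+1) (pi `^ ((beta F * k)%:R / 2) /
                                  Gamma ((beta F * k)%:R / 2)).

(* The normalisation of the Haar measure on SL_N(F) given by the singular value
   decomposition. *)
Definition svd_normalised (R : realType) (F : division_algebra) (N : nat)
    (mu : {measure set (borel_mx R (rep_dim F N)) -> \bar R}) : Prop :=
  forall r : R, 0 < r ->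
    mu (@D_ball R F N r) =
    ((2 * pi `^ ((beta F)%:R / 2) / Gamma ((beta F)%:R / 2)) ^- N.+1 *
     vol_U R F N ^+ 2 * I_hat F N r)%:E.

Definition vol_constant (R : realType) (F : division_algebra) (N : nat) : R :=
  pi `^ ((beta F * (N ^ 2 - 1))%:R / 2) * Gamma ((beta F)%:R / 2) /
  (Gamma ((beta F * N)%:R / 2) * Gamma ((beta F * N * (N - 1))%:R / 2 + 1)).

(* The filter r -> +oo, bundled as the Landau notations require. *)
Definition pinfty_filter_on (R : realType) : filter_on R :=
  FilterType (pinfty_nbhs R) _.

(* Main.v *)
(* By symmetry one may assume that the singular value eliminated by the determinant constraint is
   the smallest one.  It is the reciprocal of the product p of the other N - 1 values s_i, and
   replacing each factor |s_i^2 - p^(-2)|^beta by s_i^(2 beta) turns the integrand into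
   p^(2 beta - 1) prod_(i < j) |s_i^2 - s_j^2|^beta on the ball of radius R, whose integral is
   homogeneous of degree beta N (N - 1) in R.  Integrated against 2 R exp(- R^2) it becomes a
   Laguerre-Selberg integral, which Aomoto's integration by parts evaluates; this gives the constant.
   The replacement changes the integral (i) where x p <= 1 for the smallest s_i, denoted x,
   (ii) by a relative error of order (x p)^(-2), and (iii) in the thin shell where the s_i lie in
   the ball but the complete list does not.  Integrating over one variable, while the other ones
   are at most R, bounds the three errors.  In (ii) that integral is the one of x^(2 beta - 5) over
   x^2 w > 1, with w = p / x, which is dominated by small x if beta = 1, is logarithmic if
   beta = 2, and is dominated by large x if beta = 4: hence the three error terms. *)

From HB Require Import structures.
Require Import Defs.
From mathcomp Require Import all_boot all_order all_algebra all_fingroup.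
From mathcomp Require Import ring lra zify.
From mathcomp Require Import all_classical all_reals all_analysis measurable_realfun.

Set Implicit Arguments.
Unset Strict Implicit.
Unset Printing Implicit Defensive.

Import Order.TTheory GRing.Theory Num.Theory.
Import numFieldNormedType.Exports.

Local Open Scope classical_set_scope.
Local Open Scope ring_scope.

(** * Integration over tuples *)

(** The error is one-sided: [min_density b r ord0 <= main_density b r] pointwise, so only an upper
    bound for the difference is at stake, and almost everything stays within Tonelli's theorem for
    nonnegative functions. Which singular value is eliminated is immaterial because [dx / x] is
    invariant under [x -> c / x]: this exchanges the dependent entry with the first independent one,
    and transpositions do the rest. The signed computation is Aomoto's integration by parts. For
    [beta = 1] the Vandermonde factor is not differentiable on the diagonals; the integration is
    therefore carried out for [|p(x)| exp(- x^2)] with an arbitrary polynomial [p], by smoothing the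
    absolute value and passing to the limit. The variables remain the singular values and not their
    squares, so that one step raises the common exponent by 2. The exponent [2 beta - 1] of the main
    term is odd: it descends to 1, where the boundary term at 0 removes a variable and leaves the
    exponent [2 beta + 1], one step above [2 beta - 1]. This closes a recursion in the number of
    variables, which starts from the empty integral. *)

Section tuple_integral.
Context {R : realType}.
Local Notation leb := (@lebesgue_measure R).
Local Notation L := (@lebesgue_tuple R).

Lemma measurable_cons_pair n :
  measurable_fun [set: measurableTypeR R * n.-tuple R]
    (fun p => cons_tuple p.1 p.2 : n.+1.-tuple R).
Proof. exact: (measurable_cons measurable_fst measurable_snd). Qed.

Lemma measurable_cons_tuple n (x : R) :
  measurable_fun [set: n.-tuple R] (fun t => cons_tuple x t : n.+1.-tuple R).
Proof.
exact: (measurableT_comp (@measurable_cons_pair n) (measurable_pair1 x)).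
Qed.

Lemma ge0_integral_tupleS n (f : n.+1.-tuple R -> \bar R) :
  measurable_fun [set: n.+1.-tuple R] f -> (forall s, 0 <= f s)%E ->
  (\int[L n.+1]_s f s = \int[leb]_x \int[L n]_t f (cons_tuple x t))%E.
Proof.
move=> mf f0.
have mc := @measurable_cons_pair n.
pose nu := measure_function_pushforward__canonical__measure_function_Measure
  (leb \x L n)%E mc.
rewrite (@eq_measure_integral _ _ _ _ nu)//.
rewrite (ge0_integral_pushforward mc)//.
rewrite preimage_setT fubini_tonelli1//.
  by apply: measurableT_comp.
by move=> p; exact: f0.
Qed.

Lemma ge0_integral_tupleS_swap n (f : n.+1.-tuple R -> \bar R) :
  measurable_fun [set: n.+1.-tuple R] f -> (forall s, 0 <= f s)%E ->
  (\int[L n.+1]_s f s = \int[L n]_t \int[leb]_x f (cons_tuple x t))%E.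
Proof.
move=> mf f0; rewrite ge0_integral_tupleS//.
rewrite (@fubini_tonelli _ _ _ _ R leb (L n) (fun p => f (cons_tuple p.1 p.2)))//.
by apply: measurableT_comp => //; exact: measurable_cons_pair.
Qed.

(** [sg] is an arbitrary map of indices, so that the extension of a permutation by a fixed head,
    such as [sk] below, can be used without a proof that it is bijective. *)
Definition perm_tuple (T : Type) n (sg : 'I_n -> 'I_n) (s : n.-tuple T) : n.-tuple T :=
  [tuple tnth s (sg i) | i < n].

Lemma measurable_perm_tuple n (sg : 'I_n -> 'I_n) :
  measurable_fun [set: n.-tuple R] (perm_tuple sg : n.-tuple R -> n.-tuple R).
Proof.
apply/measurable_fun_tnthP => i.
rewrite (_ : _ \o _ = (@tnth n R)^~ (sg i)); last first.
  by apply/funext => s /=; rewrite tnth_mktuple.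
exact: measurable_tnth.
Qed.

Lemma perm_tuple_comp (T : Type) n (sg tau : 'I_n -> 'I_n) (s : n.-tuple T) :
  perm_tuple sg (perm_tuple tau s) = perm_tuple (tau \o sg) s.
Proof. by apply: eq_from_tnth => i; rewrite !tnth_mktuple. Qed.

Lemma tnth_cons0 (T : Type) n (x : T) (t : n.-tuple T) : tnth (cons_tuple x t) ord0 = x.
Proof. by []. Qed.

Lemma tnth_consS (T : Type) n (x : T) (t : n.-tuple T) (i : 'I_n) :
  tnth (cons_tuple x t) (lift ord0 i) = tnth t i.
Proof. by rewrite (tnth_nth x) /= (tnth_nth x). Qed.

(** Tonelli for the two outermost integrals. The invariance under all other exchanges is reduced to
    this one. *)
Lemma ge0_integral_tperm01 n (f : n.+2.-tuple R -> \bar R) :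
  measurable_fun [set: n.+2.-tuple R] f -> (forall s, 0 <= f s)%E ->
  (\int[L n.+2]_s f (perm_tuple (tperm ord0 (lift ord0 ord0)) s) = \int[L n.+2]_s f s)%E.
Proof.
move=> mf f0.
have mfp : measurable_fun [set: n.+2.-tuple R]
    (fun s => f (perm_tuple (tperm ord0 (lift ord0 ord0)) s)).
  by apply: measurableT_comp => //; exact: measurable_perm_tuple.
have m4 (g : n.+2.-tuple R -> \bar R) : measurable_fun [set: n.+2.-tuple R] g ->
    measurable_fun [set: (measurableTypeR R * measurableTypeR R) * n.-tuple R]
      (fun p => g (cons_tuple p.1.1 (cons_tuple p.1.2 p.2))).
  move=> mg; apply: measurableT_comp => //.
  apply: measurable_cons; first exact: measurableT_comp measurable_fst.
  apply: measurable_cons => //; exact: measurableT_comp measurable_fst.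
rewrite (ge0_integral_tupleS mfp); last by move=> s; exact: f0.
rewrite (ge0_integral_tupleS mf f0).
under eq_integral => x _.
  rewrite ge0_integral_tupleS//; last first.
    exact: (measurableT_comp mfp (@measurable_cons_tuple n.+1 x)).
  under eq_integral => y _.
    under eq_integral => t _.
      rewrite (_ : perm_tuple _ _ = cons_tuple y (cons_tuple x t)); last first.
        apply: eq_from_tnth => i; rewrite tnth_mktuple.
        case: (unliftP ord0 i) => [j|] ->; last by rewrite tpermL tnth_consS.
        case: (unliftP ord0 j) => [k|] ->; last by rewrite tpermR !tnth_consS.
        by rewrite tpermD// !tnth_consS.
      over.
    over.
  over.
under [RHS]eq_integral => x _.
  rewrite ge0_integral_tupleS//; last first.
    exact: (measurableT_comp mf (@measurable_cons_tuple n.+1 x)).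
  over.
rewrite [RHS](@fubini_tonelli _ _ _ _ R leb leb
  (fun p => \int[L n]_t f (cons_tuple p.1 (cons_tuple p.2 t)))%E)//.
- by apply: (@measurable_fun_fubini_tonelli_F _ _ _ _ R (L n) _ (m4 f mf)) => p; exact: f0.
- by move=> p; apply: integral_ge0.
Qed.

Local Notation swap j := (perm_tuple (tperm ord0 j)).

(** Induction on the number of variables, by conjugation: for [j >= 2], [(0 j) = (0 1)(1 j)(0 1)],
    and the middle factor fixes the head, so that the induction hypothesis on the tail covers it.
    Transpositions with 0 suffice because the later arguments only move one entry to the head. *)
Lemma ge0_integral_tperm n (j : 'I_n.+1) (f : n.+1.-tuple R -> \bar R) :
  measurable_fun [set: n.+1.-tuple R] f -> (forall s, 0 <= f s)%E ->
  (\int[L n.+1]_s f (swap j s) = \int[L n.+1]_s f s)%E.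
Proof.
elim: n j f => [|n IH] j f mf f0.
  apply: eq_integral => s _; congr f; apply: eq_from_tnth => i.
  by rewrite tnth_mktuple !ord1.
have mP (g : n.+2.-tuple R -> \bar R) k : measurable_fun [set: n.+2.-tuple R] g ->
    measurable_fun [set: n.+2.-tuple R] (g \o swap k).
  by move=> mg; exact: (measurableT_comp mg (@measurable_perm_tuple n.+2 _)).
case: (unliftP ord0 j) => [j'|] ->{j}; last first.
  apply: eq_integral => s _; congr f; apply: eq_from_tnth => i.
  by rewrite tnth_mktuple tperm1 perm1.
case: n j' IH f mf f0 mP => [|n] j' IH f mf f0 mP.
  by rewrite (ord1 j'); exact: ge0_integral_tperm01.
case: (unliftP ord0 j') => [j''|] ->{j'}; last exact: ge0_integral_tperm01.
pose e1 : 'I_n.+3 := lift ord0 ord0.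
pose g := f \o swap e1.
have mg : measurable_fun [set: n.+3.-tuple R] g by exact: mP.
have g0 s : (0 <= g s)%E by exact: f0.
pose k := lift (@ord0 n.+1) j''.
pose sk : 'I_n.+3 -> 'I_n.+3 := fun i =>
  if unlift ord0 i is Some i' then lift ord0 (tperm ord0 k i') else ord0.
have skE (x : R) t : perm_tuple sk (cons_tuple x t) = cons_tuple x (swap k t).
  apply: eq_from_tnth => i; rewrite tnth_mktuple /sk.
  case: unliftP => [i'|] -> //.
  by rewrite !tnth_consS tnth_mktuple.
have Hk : (\int[L n.+3]_s (g (perm_tuple sk s)) = \int[L n.+3]_s g s)%E.
  have mgk := measurableT_comp mg (@measurable_perm_tuple n.+3 sk).
  rewrite (ge0_integral_tupleS mgk); last by move=> s; exact: g0.
  rewrite (ge0_integral_tupleS mg g0).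
  apply: eq_integral => x _.
  have mgx := measurableT_comp mg (@measurable_cons_tuple n.+2 x).
  rewrite -(IH k _ mgx); last by move=> s; exact: g0.
  by apply: eq_integral => t _ /=; rewrite skE.
have -> : (\int[L n.+3]_s f (swap (lift ord0 k) s) =
  \int[L n.+3]_s g (perm_tuple sk (swap e1 s)))%E.
  apply: eq_integral => s _; rewrite /g /= !perm_tuple_comp; congr (f (perm_tuple _ _)).
  apply/funext => i /=.
  case: (unliftP ord0 i) => [i1|] ->.
    case: (unliftP ord0 i1) => [i2|] ->.
      have -> : tperm ord0 e1 (lift ord0 (lift ord0 i2)) = lift ord0 (lift ord0 i2).
        by rewrite tpermD.
      rewrite /sk liftK /k.
      have [->|ne] := eqVneq i2 j''; first by rewrite !tpermR.
      by rewrite !tpermD // ?(inj_eq lift_inj) // eq_sym.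
    rewrite (tpermR ord0 e1 : tperm ord0 e1 (lift ord0 ord0) = _) /sk unlift_none.
    by rewrite tpermL tpermD.
  by rewrite !tpermL /sk /e1 liftK tpermL tpermD.
rewrite (ge0_integral_tperm01 (f := fun s => g (perm_tuple sk s))).
- by rewrite Hk; exact: ge0_integral_tperm01.
- exact: (measurableT_comp mg (@measurable_perm_tuple n.+3 _)).
- by move=> s; exact: g0.
Qed.

End tuple_integral.

(** * Changes of variables on the real line *)

Section density_measure.
Local Open Scope ereal_scope.
Context d (T : measurableType d) (R : realType).
Variables (mu : {measure set T -> \bar R}) (g : T -> R).
Hypotheses (mg : measurable_fun [set: T] g) (g0 : forall x, (0 <= g x)%R).

(** The two proofs are arguments so that the measure structure declared below can be inferred from
    the term [density_measure mg g0] alone. *)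
Definition density_measure of measurable_fun [set: T] g & (forall x, (0 <= g x)%R) :=
  fun A : set T => \int[mu]_(x in A) (g x)%:E.

Local Notation nu := (density_measure mg g0).

Let nu_ge0 A : 0 <= nu A.
Proof. by apply: integral_ge0 => x _; rewrite lee_fin. Qed.

Let nu0 : nu set0 = 0.
Proof. exact: integral_set0. Qed.

Let nu_sigma_additive : semi_sigma_additive nu.
Proof.
move=> F mF tF mUF; rewrite /density_measure ge0_integral_bigcup//; last 2 first.
- by apply/measurable_EFinP; exact: measurable_funTS.
- by move=> x _; rewrite lee_fin.
apply: is_cvg_ereal_nneg_natsum_cond => n _ _; exact: nu_ge0.
Qed.

HB.instance Definition _ := isMeasure.Build _ _ _ nu nu0 nu_ge0 nu_sigma_additive.

End density_measure.

Section change_of_variables.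
Context {R : realType}.
Local Notation leb := (@lebesgue_measure R).

Lemma integral_layers (f : R) : 0 <= f ->
  (\int[leb]_y (((0 <= y) && (y < f))%R%:R)%:E = f%:E)%E.
Proof.
move=> f0.
have -> : (\int[leb]_y (((0 <= y) && (y < f))%R%:R)%:E =
   \int[leb]_y (\1_(`[0, f[%classic) y)%:E)%E.
  by apply: eq_integral => y _; rewrite indicE mem_setE/= in_itv.
rewrite integral_indic// setIT/= lebesgue_measure_itv/= lte_fin.
by move: f0; rewrite le_eqVlt => /predU1P[<-|->]; rewrite ?ltxx // sube0.
Qed.

Lemma measurable_boolR d (T : measurableType d) (b : T -> bool) :
  measurable_fun [set: T] b -> measurable_fun [set: T] (fun x => (b x)%:R : R).
Proof.
move=> mb.
rewrite (_ : (fun x => _) = (fun x => if b x then 1 else 0)).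
  exact: measurable_fun_ifT.
by apply/funext => x; case: (b x).
Qed.

(** The hypothesis says that the image under [phi] of the measure with density [g] agrees with
    Lebesgue measure on half-open intervals, hence on all Borel sets by uniqueness. Writing [f] as
    an integral of indicators of its superlevel sets ([integral_layers]) and applying Tonelli on
    both sides extends this from sets to functions. Only the masses of preimages of intervals have
    to be computed, which suits the piecewise [phi] used below. *)
Lemma ge0_change_of_variables (phi : R -> R) (g : R -> R) :
  measurable_fun [set: R] phi -> measurable_fun [set: R] g ->
  (forall x, 0 <= g x) ->
  (forall a b, a < b ->
     (\int[leb]_(x in phi @^-1` `]a, b]) (g x)%:E = (b - a)%:E)%E) ->
  forall f : R -> R, measurable_fun [set: R] f -> (forall x, 0 <= f x) ->
  (\int[leb]_x (g x * f (phi x))%:E = \int[leb]_x (f x)%:E)%E.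
Proof.
move=> mphi mg g0 H f mf f0.
have mphi' : measurable_fun [set: measurableTypeR R] (phi : _ -> measurableTypeR R) by [].
pose nu := measure_function_pushforward__canonical__measure_function_Measure
  (density_measure leb mg g0) mphi'.
have nuE A : measurable A -> leb A = (\int[leb]_(x in phi @^-1` A) (g x)%:E)%E.
  move=> mA; transitivity (nu A) => //.
  apply: lebesgue_measure_unique mA => _ [[a b] _ <-].
  rewrite /= lebesgue_measure_itv/= lte_fin.
  case: ltP => [ab|ba]; first by rewrite /nu /= /pushforward /density_measure H.
  by rewrite set_itv_ge ?bnd_simp -?leNgt// measure0.
pose F (x y : R) : R := ((0 <= y) && (y < f x))%:R.
have mF : measurable_fun [set: R * R] (fun p => F p.1 p.2).
  apply: measurable_boolR; apply: measurable_and.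
    exact: measurable_fun_ler.
  apply: measurable_fun_ltr => //; exact: measurableT_comp.
have mFp : measurable_fun [set: R * R] (fun p => F (phi p.1) p.2).
  apply: measurable_boolR; apply: measurable_and.
    exact: measurable_fun_ler.
  apply: measurable_fun_ltr => //.
  by apply: measurableT_comp => //; exact: measurableT_comp.
under eq_integral => x _ do rewrite EFinM -(integral_layers (f0 (phi x))).
transitivity (\int[leb]_x \int[leb]_y (g x * F (phi x) y)%:E)%E.
  apply: eq_integral => x _; under [RHS]eq_integral do rewrite EFinM.
  rewrite ge0_integralZl_EFin//.
    by move=> y _; rewrite lee_fin.
  apply/measurable_EFinP; apply: measurable_boolR; apply: measurable_and.
    exact: measurable_fun_ler.
  exact: measurable_fun_ltr.
rewrite (@fubini_tonelli _ _ _ _ R leb leb (fun p => (g p.1 * F (phi p.1) p.2)%:E))/=; last 2 first.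
- apply/measurable_EFinP; apply: measurable_funM => //.
  exact: measurableT_comp.
- by move=> p; rewrite lee_fin mulr_ge0.
under [RHS]eq_integral => x _ do rewrite -(integral_layers (f0 x)).
rewrite [RHS](@fubini_tonelli _ _ _ _ R leb leb (fun p => (F p.1 p.2)%:E))//=; last 2 first.
- exact/measurable_EFinP.
- by move=> p; rewrite lee_fin.
apply: eq_integral => y _.
have mA : measurable [set x | (0 <= y) && (y < f x)].
  rewrite -[X in measurable X]setTI.
  apply: (measurable_and (f := fun _ => 0 <= y) (g := fun x => y < f x)) => //.
  exact: measurable_fun_ltr.
transitivity (leb [set x | (0 <= y) && (y < f x)]); last first.
  rewrite -[X in leb X]setIT -integral_indic//.
  by apply: eq_integral => x _; rewrite indicE /F/=; congr (_%:R%:E); rewrite mem_setE.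
rewrite nuE// [RHS]integral_mkcond; apply: eq_integral => x _.
rewrite patchE /F.
rewrite (_ : (x \in _) = (0 <= y < f (phi x))); last by apply/idP/idP; rewrite inE.
by case: ifPn => _; rewrite ?mulr1 ?mulr0.
Qed.

Lemma ge0_integral_scale (c : R) : 0 < c ->
  forall f : R -> R, measurable_fun [set: R] f -> (forall x, 0 <= f x) ->
  (\int[leb]_x (c * f (c * x))%:E = \int[leb]_x (f x)%:E)%E.
Proof.
move=> c0 f mf f0.
apply: (@ge0_change_of_variables ( *%R c) (fun=> c)) => //.
- by move=> _; exact: ltW.
- move=> a b ab.
  have -> : *%R c @^-1` `]a, b] = [set` `]a / c, b / c]].
    apply/seteqP; split => x /=; rewrite !in_itv/=;
    by rewrite ltr_pdivrMr// ler_pdivlMr// (mulrC x).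
  rewrite integral_cst// /= lebesgue_measure_itv/= lte_fin ltr_pM2r ?invr_gt0// ab.
  by rewrite -EFinB -EFinM -mulrBl mulrC divfK ?gt_eqF.
Qed.

End change_of_variables.

Section inversion.
Context {R : realType}.
Local Notation leb := (@lebesgue_measure R).

Lemma is_derive_inv (x : R) : x != 0 ->
  is_derive x 1 (fun y : R => y^-1) (- (x ^- 2)).
Proof.
move=> x0; have dx : derivable (id : R -> R) x 1 by exact: derivable_id.
apply: DeriveDef; first exact: (@derivableV _ _ (id : R -> R) _ _ x0 dx).
by rewrite (@deriveV _ _ (id : R -> R))// derive_id scaleNr -scalerN /GRing.scale/= mulrN mulr1.
Qed.

Lemma integral_inv_sqr_y (a : R) : 0 < a ->
  (\int[leb]_(x in `[a, +oo[) (x ^- 2)%:E = a^-1%:E)%E.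
Proof.
move=> a0.
have dF (x : R) : 0 < x -> is_derive x 1 (fun y : R => - y^-1) (x ^- 2).
  move=> x0; have := is_derive_inv (lt0r_neq0 x0) => D.
  by apply: is_derive_eq; rewrite opprK.
rewrite (@ge0_continuous_FTC2y _ (fun x => x ^- 2) (fun x => - x^-1) a 0).
- by rewrite -EFinB sub0r opprK.
- by move=> x ax; rewrite invr_ge0 exprn_ge0// (le_trans (ltW a0)).
- apply: continuous_in_subspaceT => x; rewrite inE/= in_itv/= andbT => ax.
  apply: cvgV; first by rewrite expf_neq0// gt_eqF// (lt_le_trans a0).
  exact: exprn_continuous.
- rewrite -oppr0; apply: cvgN; apply/gtr0_cvgV0; last exact: cvg_id.
  exact: nbhs_pinfty_gt.
- by move=> x ax; have [] := dF x (lt_trans a0 ax).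
- by apply: cvg_at_right_filter; apply: cvgN; apply: inv_continuous; rewrite gt_eqF.
- move=> x; rewrite in_itv/= andbT => ax.
  by rewrite derive1E; have [_ ->] := dF x (lt_trans a0 ax).
Qed.

(** [dx / x] is the Haar measure of the multiplicative group of positive reals, so it is invariant
    under inversion and under multiplication by [c]. *)
Lemma ge0_integral_inversion (c : R) : 0 < c ->
  forall f : R -> R, measurable_fun [set: R] f -> (forall x, 0 <= f x) ->
  (\int[leb]_x ((0 < x)%R%:R * x^-1 * f (c / x))%:E =
   \int[leb]_x ((0 < x)%R%:R * x^-1 * f x)%:E)%E.
Proof.
move=> c0 f mf f0.
have mpos : measurable_fun [set: R] (fun x : R => 0 < x) by exact: measurable_fun_ltr.
have minv : measurable_fun [set: R] (fun x : R => if 0 < x then x^-1 else 0).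
  apply: measurable_fun_if => //.
  rewrite setTI; apply: open_continuous_measurable_fun.
    by rewrite (_ : _ @^-1` _ = `]0, +oo[%classic)//; apply/seteqP; split => x/=;
      rewrite in_itv/= andbT.
  by move=> x; rewrite inE/= => x0; apply: inv_continuous; rewrite gt_eqF.
(* The inversion is extended to [x <= 0] by the identity, with density 1, since the criterion tests
   all intervals of the line. *)
pose phi (x : R) := if 0 < x then c / x else x.
pose g (x : R) := if 0 < x then c * x ^- 2 else 1.
have mphi : measurable_fun [set: R] phi.
  rewrite (_ : phi = (fun x => if 0 < x then c * (if 0 < x then x^-1 else 0) else x)).
    apply: measurable_fun_ifT => //; exact: measurable_funM.
  by apply/funext => x; rewrite /phi; case: ifP.
have mg : measurable_fun [set: R] g.
  rewrite (_ : g = (fun x => if 0 < x then c * (if 0 < x then x^-1 else 0) ^+ 2 else 1)).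
    apply: measurable_fun_ifT => //; apply: measurable_funM => //.
    exact: measurable_funX.
  by apply/funext => x; rewrite /g; case: ifP; rewrite ?exprVn.
have g0 x : 0 <= g x.
  by rewrite /g; case: ifP => // x0; rewrite mulr_ge0 ?invr_ge0 ?sqr_ge0 ?ltW.
have gI (a : R) : 0 < a -> (\int[leb]_(x in `[(c / a)%R, +oo[) (g x)%:E = a%:E)%E.
  move=> a0; transitivity (\int[leb]_(x in `[(c / a)%R, +oo[) (c%:E * (x ^- 2)%:E))%E.
    apply: eq_integral => x; rewrite inE/= in_itv/= andbT => ax.
    by rewrite /g (lt_le_trans _ ax) ?divr_gt0// EFinM.
  rewrite ge0_integralZl_EFin//; last 3 first.
  - by move=> x _; rewrite lee_fin invr_ge0 sqr_ge0.
  - apply/measurable_EFinP; apply: subspace_continuous_measurable_fun => //.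
    apply: continuous_in_subspaceT => x; rewrite inE/= in_itv/= andbT => ax.
    apply: cvgV; first by rewrite expf_neq0// gt_eqF// (lt_le_trans _ ax) ?divr_gt0.
    exact: exprn_continuous.
  - exact: ltW.
  rewrite integral_inv_sqr_y ?divr_gt0//.
  by rewrite -EFinM invf_div mulrC divfK ?gt_eqF.
(* The preimage of []a, b]] is a difference of two half-lines, both covered by [gI]. *)
have gJ (a b : R) : 0 < a -> a < b -> (\int[leb]_(x in `[(c / b)%R, (c / a)%R[) (g x)%:E = (b - a)%:E)%E.
  move=> a0 ab; have b0 := lt_trans a0 ab; have := gI b b0.
  have cab : c / b < c / a by rewrite ltr_pM2l// ltf_pV2.
  rewrite (@itv_bndbnd_setU _ _ (BLeft (c / b)) (BLeft (c / a)) +oo%O) ?bnd_simp ?(ltW cab)//.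
  rewrite ge0_integral_setU//=; last 3 first.
  - by apply/measurable_EFinP; apply: measurable_funTS.
  - by move=> x _; rewrite lee_fin.
  - apply/disj_setPS => x [] /=; rewrite !in_itv/= andbT => /andP[_ xb] bx.
    by move: xb; rewrite ltNge bx.
  by rewrite gI// => h; rewrite EFinB -h addeK.
have gK (a b : R) : a <= b -> b <= 0 -> (\int[leb]_(x in `]a, b]) (g x)%:E = (b - a)%:E)%E.
  move=> ab b0.
  transitivity (\int[leb]_(x in `]a, b]) (1%:E))%E.
    apply: eq_integral => x; rewrite inE/= in_itv/= => /andP[_ xb].
    by rewrite /g ltNge (le_trans xb b0).
  rewrite integral_cst//= lebesgue_measure_itv/= lte_fin mul1e.
  by move: ab; rewrite le_eqVlt => /predU1P[->|->]; rewrite ?ltxx ?subrr.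
have key := @ge0_change_of_variables R phi g mphi mg g0 _
  (fun x => (0 < x)%R%:R * (if 0 < x then x^-1 else 0) * f x).
transitivity (\int[leb]_x (g x * ((0 < phi x)%R%:R *
    (if 0 < phi x then (phi x)^-1 else 0) * f (phi x)))%:E)%E.
  apply: eq_integral => x _; congr EFin; rewrite /g /phi.
  case: ifPn => [x0|]; last by move/negbTE ->; rewrite !mul0r mulr0.
  rewrite divr_gt0// !mul1r mulrA; congr (_ * _).
  by rewrite invf_div; field; rewrite !gt_eqF.
rewrite key; first 1 last.
- move=> a b ab.
  have [b0|b0] := leP b 0.
    rewrite -(gK a b (ltW ab) b0); congr integral.
    apply/seteqP; split => x; rewrite /= !in_itv/= /phi; case: ifPn => x0 //.
      by move=> /andP[_]; rewrite leNgt (le_lt_trans b0)// divr_gt0.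
    by move=> /andP[_ xb]; move: x0; rewrite ltNge (le_trans xb b0).
  have cb (x : R) : 0 < x -> (c / x <= b) = (c / b <= x).
    by move=> x0; rewrite !ler_pdivrMr// mulrC.
  have [a0|a0] := ltP 0 a.
    rewrite -(gJ a b a0 ab); congr integral.
    apply/seteqP; split => x; rewrite /= !in_itv/= /phi; case: ifPn => x0.
    - by rewrite cb// => /andP[h ->]; rewrite ltr_pdivlMr// mulrC -ltr_pdivlMr.
    - by move=> /andP[ax _]; rewrite (lt_trans a0 ax) in x0.
    - by rewrite cb// => /andP[-> h]; rewrite andbT ltr_pdivlMr// mulrC -ltr_pdivlMr.
    - by move=> /andP[h _]; rewrite (lt_le_trans _ h) ?divr_gt0 in x0.
  rewrite (_ : _ @^-1` _ = `]a, 0%R] `|` `[c / b, +oo[); last first.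
    apply/seteqP; split => x; rewrite /= !in_itv/= andbT /phi; case: ifPn => x0.
    - by rewrite cb// => /andP[_ ->]; right.
    - by move=> /andP[-> _]; left; rewrite leNgt.
    - move=> [/andP[_]|h]; first by rewrite leNgt x0.
      by rewrite cb// h (le_lt_trans a0)// divr_gt0.
    - move=> [/andP[-> x0']|h]; first by rewrite (le_trans x0')// ltW.
      by rewrite (lt_le_trans _ h) ?divr_gt0 in x0.
  rewrite ge0_integral_setU//=; last 3 first.
  - by apply/measurable_EFinP; apply: measurable_funTS.
  - by move=> x _; rewrite lee_fin.
  - apply/disj_setPS => x [] /=; rewrite !in_itv/= andbT => /andP[_ xb] bx.
    by move: bx; rewrite leNgt (le_lt_trans xb) ?divr_gt0.
  by rewrite gI// gK// -EFinD sub0r addrC.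
- apply: measurable_funM => //; apply: measurable_funM => //.
  exact: measurable_boolR.
- move=> x; apply: mulr_ge0 => //; apply: mulr_ge0 => //.
  by case: ifPn => // x0; rewrite invr_ge0 ltW.
by apply: eq_integral => x _; case: ifPn => // x0; rewrite !mul0r.
Qed.

End inversion.

(** * Scaling, products and slices of integrals over tuples *)

Section tuple_integral_tools.
Context {R : realType}.
Local Notation leb := (@lebesgue_measure R).
Local Notation L := (@lebesgue_tuple R).

(** [powR] is measurable and has an inverse as its value at exponent -1 on nonnegative bases, hence
    the square. At the zeros of [f] both expressions are 0. *)
Lemma measurable_funV d (T : measurableType d) (D : set T) (f : T -> R) :
  measurable_fun D f -> measurable_fun D (fun x => (f x)^-1).
Proof.
rewrite (_ : (fun x => _) = (fun x => f x * (f x ^+ 2) `^ (-1))); last first.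
  apply/funext => x; rewrite powR_inv1 ?sqr_ge0//.
  have [->|fx] := eqVneq (f x) 0; first by rewrite mul0r invr0.
  by rewrite expr2 invfM mulrA divff// mul1r.
move=> mf; apply: measurable_funM => //.
exact: (measurableT_comp (@measurable_powR R (-1)) (measurable_funX 2 mf)).
Qed.

Definition positive n (s : n.-tuple R) := all (fun x => 0 < x) s.

Lemma positiveP n (s : n.-tuple R) :
  reflect (forall i, 0 < tnth s i) (positive s).
Proof. exact: all_tnthP. Qed.

Lemma positive_perm n (sg : 'I_n -> 'I_n) (s : n.-tuple R) : injective sg ->
  positive (perm_tuple sg s) = positive s.
Proof.
move=> sgI; apply/positiveP/positiveP => H i; last by rewrite tnth_mktuple.
by have := H (invF sgI i); rewrite tnth_mktuple f_invF.
Qed.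

Lemma measurable_positive n : measurable_fun [set: n.-tuple R] (@positive n).
Proof.
elim: n => [|n IH].
  rewrite (_ : @positive 0 = cst true)//; last by apply/funext => s; rewrite tuple0.
rewrite (_ : @positive n.+1 = fun s => (0 < thead s) && positive [tuple of behead s]).
  apply: measurable_and; last exact: (measurableT_comp IH (@measurable_behead _ _ n)).
  by apply: measurable_fun_ltr => //; exact: measurable_tnth.
by apply/funext => s; case/tupleP: s => x s; rewrite /positive/= theadE.
Qed.

Lemma measurable_prod_tuple n : measurable_fun [set: n.-tuple R] (fun s => \prod_(x <- s) x).
Proof.
rewrite (_ : (fun s => _) = (fun s => \prod_(i < n) tnth s i)).
  by apply: measurable_prod => i _; exact: measurable_tnth.
by apply/funext => s; rewrite big_tuple.
Qed.

Lemma ge0_integral_tuple_scale n (c : R) : 0 < c ->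
  forall f : n.-tuple R -> R, measurable_fun [set: n.-tuple R] f -> (forall s, 0 <= f s) ->
  (\int[L n]_s (c ^+ n * f (map_tuple ( *%R c) s))%:E = \int[L n]_s (f s)%:E)%E.
Proof.
move=> c0; elim: n => [|n IH] f mf f0.
  by apply: eq_integral => s _; rewrite expr0 mul1r; congr (f _)%:E; apply: eq_from_tnth => -[].
have mmap m : measurable_fun [set: m.-tuple R] (fun s => map_tuple ( *%R c) s : m.-tuple R).
  apply/measurable_fun_tnthP => i.
  rewrite (_ : _ \o _ = fun s => c * tnth s i); last first.
    by apply/funext => s /=; rewrite tnth_map.
  by apply: measurable_funM => //; exact: measurable_tnth.
have cn0 k : 0 <= c ^+ k by rewrite exprn_ge0 ?ltW.
have mfc := measurableT_comp mf (mmap n.+1).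
have mfc1 : measurable_fun [set: n.+1.-tuple R] (fun s => (c ^+ n.+1 * f (map_tuple ( *%R c) s))%:E).
  by apply/measurable_EFinP; apply: measurable_funM.
rewrite (ge0_integral_tupleS_swap mfc1); last by move=> s; rewrite lee_fin mulr_ge0.
have mfx x := measurableT_comp mf (@measurable_cons_tuple R n x).
have mft (t : n.-tuple R) : measurable_fun [set: R] (fun x => f (cons_tuple x t)).
  exact: (measurableT_comp mf (measurableT_comp (@measurable_cons_pair R n) (pair2_measurable t))).
transitivity (\int[L n]_t \int[leb]_x
   (c ^+ n * f (cons_tuple x (map_tuple ( *%R c) t)))%:E)%E.
  apply: eq_integral => t _.
  rewrite -(ge0_integral_scale c0 (f := fun x => c ^+ n * f (cons_tuple x (map_tuple ( *%R c) t)))).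
  - apply: eq_integral => x _; rewrite exprS mulrA; congr (_ * f _)%:E.
    exact: val_inj.
  - by apply: measurable_funM => //; exact: mft.
  - by move=> x; rewrite mulr_ge0.
have mp : measurable_fun [set: measurableTypeR R * n.-tuple R]
   (fun p => (c ^+ n * f (cons_tuple p.1 (map_tuple ( *%R c) p.2)))%:E).
  apply/measurable_EFinP; apply: measurable_funM => //.
  apply: (measurableT_comp mf); apply: measurable_cons => //.
  exact: (measurableT_comp (mmap n)).
rewrite -(@fubini_tonelli _ _ _ _ R leb (L n) _ mp); last first.
  by move=> p; rewrite lee_fin mulr_ge0.
rewrite ge0_integral_tupleS//; last exact/measurable_EFinP.
by apply: eq_integral => x _; exact: (IH _ (mfx x) (fun s => f0 _)).
Qed.

Lemma ge0_integral_tuple_prod n (g : R -> R) (c : R) :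
  measurable_fun [set: R] g -> (forall x, 0 <= g x) ->
  (\int[leb]_x (g x)%:E = c%:E)%E ->
  (\int[L n]_s (\prod_(i < n) g (tnth s i))%:E = (c ^+ n)%:E)%E.
Proof.
move=> mg g0 gc.
have c0 : 0 <= c by rewrite -lee_fin -gc integral_ge0// => x _; rewrite lee_fin.
have P0 m (s : m.-tuple R) : 0 <= \prod_(i < m) g (tnth s i) by apply: prodr_ge0.
have mP m : measurable_fun [set: m.-tuple R] (fun s => \prod_(i < m) g (tnth s i)).
  by apply: measurable_prod => i _; apply: measurableT_comp => //; exact: measurable_tnth.
elim: n => [|n IH].
  under eq_integral do rewrite big_ord0.
  by rewrite integral_cst//= diracE mem_set// mul1e expr0.
have mPE m := (measurable_EFinP _ _).2 (mP m).
rewrite (ge0_integral_tupleS (mPE _)); last by move=> s; rewrite lee_fin.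
transitivity (\int[leb]_x ((g x)%:E * (c ^+ n)%:E))%E.
  apply: eq_integral => x _; rewrite -IH -ge0_integralZl_EFin//.
  - apply: eq_integral => t _; rewrite [LHS]/comp big_ord_recl -EFinM.
    by congr (g _ * _)%:E; apply: eq_bigr => i _; rewrite tnth_consS.
  - by move=> t _; rewrite lee_fin.
rewrite ge0_integralZr//; last 3 first.
- exact/measurable_EFinP.
- by move=> x _; rewrite lee_fin.
- by rewrite lee_fin exprn_ge0.
by rewrite gc -EFinM exprS.
Qed.

(** The common source of the three error bounds: with the head as inner variable, the inner integral
    is at most [B], and the other [n] variables range over a cube of volume [r ^+ n]. *)
Lemma integral_slice_le n (f : n.+1.-tuple R -> R) (B r : R) :
  measurable_fun [set: n.+1.-tuple R] f -> (forall s, 0 <= f s) -> 0 <= B -> 0 <= r ->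
  (forall s, f s != 0 -> forall i, 0 < tnth s i <= r) ->
  (forall t : n.-tuple R, (forall i, 0 < tnth t i <= r) ->
     (\int[leb]_x (f (cons_tuple x t))%:E <= B%:E)%E) ->
  (\int[L n.+1]_s (f s)%:E <= (B * r ^+ n)%:E)%E.
Proof.
move=> mf f0 B0 r0 fr fB.
rewrite ge0_integral_tupleS_swap; [|exact/measurable_EFinP|by move=> s; rewrite lee_fin].
pose b (x : R) : R := (0 < x <= r)%R%:R.
have mb : measurable_fun [set: R] b.
  apply: measurable_boolR; apply: measurable_and; first exact: measurable_fun_ltr.
  exact: measurable_fun_ler.
have b0 x : 0 <= b x by [].
have br : (\int[leb]_x (b x)%:E = r%:E)%E.
  have -> : (\int[leb]_x (b x)%:E = \int[leb]_x (\1_(`]0%R, r]%classic) x)%:E)%E.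
    by apply: eq_integral => x _; rewrite indicE mem_setE/= in_itv.
  rewrite integral_indic// setIT/= lebesgue_measure_itv/= lte_fin.
  by move: r0; rewrite le_eqVlt => /predU1P[<-|->]; rewrite ?ltxx // sube0.
have mB : measurable_fun [set: n.-tuple R] (fun t => \prod_(i < n) b (tnth t i)).
  by apply: measurable_prod => i _; apply: measurableT_comp => //; exact: measurable_tnth.
apply: (@le_trans _ _ (\int[L n]_t (B%:E * (\prod_(i < n) b (tnth t i))%:E))%E).
  apply: ge0_le_integral => //.
  - by move=> t _; apply: integral_ge0 => x _; rewrite lee_fin.
  - have mfp := measurableT_comp mf (@measurable_cons_pair R n).
    move/measurable_EFinP in mfp.
    have f0' p : (0 <= (EFin \o (f \o (fun p => cons_tuple p.1 p.2))) p)%E.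
      by rewrite [X in (_ <= X)%E]/comp lee_fin; exact: f0.
    exact (@measurable_fun_fubini_tonelli_G _ _ _ _ R leb _ mfp f0').
  - by apply/measurable_EFinP; exact: measurable_funM.
  - move=> t _; have [/forallP H|] := boolP [forall i, 0 < tnth t i <= r].
      by rewrite big1 ?mule1 ?fB// => i _; rewrite /b H.
    move=> /forallPn[i Hi]; rewrite integral0_eq.
      by rewrite -EFinM lee_fin mulr_ge0// prodr_ge0.
    move=> x _; apply/eqP; rewrite eqe; apply/negPn/negP => /fr /(_ (lift ord0 i)).
    by rewrite tnth_consS (negbTE Hi).
rewrite ge0_integralZl_EFin//; last 2 first.
- by move=> t _; rewrite lee_fin prodr_ge0.
- exact/measurable_EFinP.
by rewrite (ge0_integral_tuple_prod n mb b0 br) -EFinM.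
Qed.

(** On the hypersurface where all entries, the dependent one included, multiply to one, this
    exchanges the head with the dependent entry (see [full_invert_head]). *)
Definition invert_head n (s : n.+1.-tuple R) : n.+1.-tuple R :=
  cons_tuple (\prod_(x <- s) x)^-1 [tuple of behead s].

(** For a fixed tail [t] this is the inversion [x -> c / x], where [c] is the inverse of the product
    of [t]. *)
Lemma ge0_integral_invert_head n (F : n.+1.-tuple R -> R) :
  measurable_fun [set: n.+1.-tuple R] F -> (forall s, 0 <= F s) ->
  (\int[L n.+1]_s ((positive s)%:R * (thead s)^-1 * F (invert_head s))%:E =
   \int[L n.+1]_s ((positive s)%:R * (thead s)^-1 * F s)%:E)%E.
Proof.
move=> mF F0.
have minv : measurable_fun [set: n.+1.-tuple R] (fun s => (positive s)%:R * (thead s)^-1 : R).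
  apply: measurable_funM; first exact: (@measurable_boolR R _ _ _ (@measurable_positive n.+1)).
  apply: measurable_funV; exact: measurable_tnth.
have minvh : measurable_fun [set: n.+1.-tuple R] (@invert_head n).
  apply: measurable_cons; last exact: measurable_behead.
  apply: measurable_funV; exact: measurable_prod_tuple.
have pos0 s : 0 <= (positive s)%:R * (thead s)^-1 :> R.
  by case: positiveP => [H|]; rewrite ?mul0r// mul1r invr_ge0 ltW ?H.
have mg (G : n.+1.-tuple R -> R) : measurable_fun [set: n.+1.-tuple R] G ->
    measurable_fun [set: n.+1.-tuple R] (fun s => ((positive s)%:R * (thead s)^-1 * G s)%:E).
  by move=> mG; apply/measurable_EFinP; exact: measurable_funM.
rewrite (ge0_integral_tupleS_swap (mg _ (measurableT_comp mF minvh))); last first.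
  by move=> s; rewrite lee_fin; apply: mulr_ge0; [exact: pos0|exact: F0].
rewrite (ge0_integral_tupleS_swap (mg _ mF)); last first.
  by move=> s; rewrite lee_fin; apply: mulr_ge0; [exact: pos0|exact: F0].
apply: eq_integral => t _.
have [pt|pt] := boolP (positive t); last first.
  by apply: eq_integral => x _; rewrite /positive/= -[all _ _]/(positive t) (negbTE pt) andbF !mul0r.
have p0 : 0 < \prod_(x <- t) x.
  by rewrite big_tuple; apply: prodr_gt0 => i _; exact/positiveP.
have ip0 : 0 < (\prod_(x <- t) x)^-1 by rewrite invr_gt0.
have mft : measurable_fun [set: R] (fun x => F (cons_tuple x t)).
  exact: (measurableT_comp mF (measurableT_comp (@measurable_cons_pair R n) (pair2_measurable t))).
have := ge0_integral_inversion ip0 mft (fun x => F0 _).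
under eq_integral => x _.
  rewrite (_ : F _ = F (invert_head (cons_tuple x t))); last first.
    congr F; rewrite /invert_head; congr cons_tuple.
      by rewrite big_cons invfM mulrC.
    exact: val_inj.
  rewrite (_ : (0 < x)%R = positive (cons_tuple x t)); last first.
    by rewrite /positive/= -[all _ _]/(positive t) pt andbT.
  over.
move=> ->; apply: eq_integral => x _.
by rewrite /positive/= -[all _ _]/(positive t) pt andbT.
Qed.

End tuple_integral_tools.

(** * The Laguerre-Selberg integral *)

Section gaussian_polynomials.
Context {R : realType}.
Local Notation leb := (@lebesgue_measure R).

(** From [u <= exp u] at [u = (1 + x^2) / K], raised to the power [K]: this is where the constant
    [K^K e] comes from. *)
Lemma gauss_decay (K : nat) :
  exists2 C : R, 0 <= C & forall x : R, (1 + x ^+ 2) ^+ K * expR (- x ^+ 2) <= C.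
Proof.
case: K => [|k].
  by exists 1 => // x; rewrite expr0 mul1r -expR0 ler_expR oppr_le0 sqr_ge0.
set K := k.+1; have K0 : 0 < K%:R :> R by rewrite ltr0n.
exists (K%:R ^+ K * expR 1) => [|x]; first by rewrite mulr_ge0 ?expR_ge0 ?exprn_ge0.
have y0 : 0 <= 1 + x ^+ 2 by rewrite addr_ge0 ?sqr_ge0.
have h : (1 + x ^+ 2) ^+ K <= K%:R ^+ K * expR (1 + x ^+ 2).
  have -> : expR (1 + x ^+ 2) = expR ((1 + x ^+ 2) / K%:R) ^+ K.
    by rewrite -expRM_natr divfK ?gt_eqF.
  rewrite -exprMn; apply: lerXn2r; rewrite ?nnegrE ?mulr_ge0 ?expR_ge0//.
  rewrite -ler_pdivrMl// mulrC; apply: le_trans (expR_ge1Dx _).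
  by rewrite lerDr.
apply: (@le_trans _ _ (K%:R ^+ K * expR (1 + x ^+ 2) * expR (- x ^+ 2))).
  by rewrite ler_wpM2r ?expR_ge0.
by rewrite -mulrA -expRD addrK.
Qed.

(** The dominating function for polynomials. Powers of [1 + x ^+ 2] are at least 1 and hence
    increase with the exponent, which powers of [x] do not. *)
Definition half_gauss (M : nat) (x : R) : R :=
  (0 < x)%R%:R * (1 + x ^+ 2) ^+ M * expR (- x ^+ 2).

Lemma half_gauss_ge0 M x : 0 <= half_gauss M x.
Proof. by rewrite !mulr_ge0 ?expR_ge0 ?exprn_ge0 ?addr_ge0 ?sqr_ge0. Qed.

Lemma measurable_half_gauss M : measurable_fun [set: R] (half_gauss M).
Proof.
apply: measurable_funM; last by apply: measurableT_comp => //; exact: measurableT_comp.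
apply: measurable_funM; last by apply: measurable_funX; exact: measurable_funD.
by apply: measurable_boolR; exact: measurable_fun_ltr.
Qed.

(** [gauss_decay] with one power more leaves [C / (1 + x ^+ 2)], whose integral over the half-line
    is known. *)
Lemma integral_half_gauss M : exists c, (\int[leb]_x (half_gauss M x)%:E = c%:E)%E.
Proof.
suff : (\int[leb]_x (half_gauss M x)%:E < +oo)%E.
  have : (0 <= \int[leb]_x (half_gauss M x)%:E)%E.
    by apply: integral_ge0 => x _; rewrite lee_fin half_gauss_ge0.
  by case: integral => // c _ _; exists c.
have [C C0 CP] := gauss_decay M.+1.
have mV : measurable_fun [set: R] (fun x : R => (1 + x ^+ 2)^-1).
  by apply: measurable_funV; exact: measurable_funD.
apply: (@le_lt_trans _ _ (\int[leb]_(x in `[0%R, +oo[) (C%:E * ((1 + x ^+ 2)^-1)%:E))%E).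
  rewrite [X in (_ <= X)%E]integral_mkcond; apply: ge0_le_integral => //.
  - by move=> x _; rewrite lee_fin half_gauss_ge0.
  - apply/measurable_EFinP; exact: measurable_half_gauss.
  - apply/(measurable_restrictT _ _).1 => //.
    by apply/measurable_EFinP; apply: measurable_funM => //; exact: measurable_funTS.
  - move=> x _; rewrite patchE mem_setE/= in_itv/= andbT /half_gauss.
    case: ltP => x0; last by rewrite !mul0r; case: ifP => // _; rewrite lee_fin mulr_ge0// invr_ge0 addr_ge0 ?sqr_ge0.
    rewrite (ltW x0) -EFinM lee_fin mul1r.
    by rewrite ler_pdivlMr ?(ltr_pwDl _ (sqr_ge0 _))// mulrAC -exprSr.
rewrite ge0_integralZl_EFin//; last 2 first.
- by move=> x _; rewrite lee_fin invr_ge0 addr_ge0 ?sqr_ge0.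
- by apply/measurable_EFinP; exact: measurable_funTS.
by rewrite integral0y_oneDsqr -EFinM ltry.
Qed.

Lemma horner_bound (p : {poly R}) :
  exists2 C : R, 0 <= C & forall x, `|p.[x]| <= C * (1 + x ^+ 2) ^+ size p.
Proof.
exists (\sum_(i < size p) `|p`_i|) => [|x]; first exact: sumr_ge0.
have y1 : 1 <= 1 + x ^+ 2 by rewrite lerDl sqr_ge0.
rewrite horner_coef mulr_suml; apply: le_trans (ler_norm_sum _ _ _) _.
apply: ler_sum => i _; rewrite normrM ler_wpM2l//.
apply: (@le_trans _ _ ((1 + x ^+ 2) ^+ i)); last by rewrite ler_weXn2l// ltnW.
rewrite normrX; apply: lerXn2r; rewrite ?nnegrE//; first exact: le_trans y1.
have [x1|x1] := leP `|x| 1; first exact: le_trans y1.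
rewrite -real_normK ?num_real// ler_wpDl// expr2 ler_peMr// ltW//.
Qed.

Lemma integrable_poly_gauss (p : {poly R}) :
  leb.-integrable setT (fun x => ((0 < x)%R%:R * (p.[x] * expR (- x ^+ 2)))%:E).
Proof.
have [C C0 CP] := horner_bound p.
have [c cE] := integral_half_gauss (size p).
have mp : measurable_fun [set: R] (fun x => (0 < x)%R%:R * (p.[x] * expR (- x ^+ 2))).
  apply: measurable_funM; first by apply: measurable_boolR; exact: measurable_fun_ltr.
  apply: measurable_funM; last by apply: measurableT_comp => //; exact: measurableT_comp.
  by apply: continuous_measurable_fun; exact: continuous_horner.
apply: (@le_integrable _ _ _ leb setT _ _ (fun x => (C%:E * (half_gauss (size p) x)%:E)%E)) => //.
- exact/measurable_EFinP.
- move=> x _; have h0 := mulr_ge0 C0 (half_gauss_ge0 (size p) x).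
  rewrite -EFinM/= lee_fin (ger0_norm h0).
  rewrite !normrM (ger0_norm (expR_ge0 _)) normr_nat /half_gauss mulrA mulrA.
  by rewrite ler_wpM2r ?expR_ge0// [leRHS]mulrCA ler_wpM2l.
- apply: (integrableZl measurableT); apply/integrableP; split.
    by apply/measurable_EFinP; exact: measurable_half_gauss.
  under eq_integral => x _ do rewrite gee0_abs ?lee_fin ?half_gauss_ge0//.
  by rewrite cE ltry.
Qed.

Lemma poly_gauss_cvg0 (p : {poly R}) :
  (fun x : R => p.[x] * expR (- x ^+ 2)) x @[x --> +oo] --> (0 : R).
Proof.
have [C C0 CP] := horner_bound p.
have [D D0 DP] := gauss_decay (size p).+1.
apply/cvgr0Pnorm_le => e e0; near=> x.
have x0 : 0 < x by near: x; exact: nbhs_pinfty_gt.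
have y0 : 0 < 1 + x ^+ 2 by rewrite addr_gt0// exprn_gt0.
apply: (@le_trans _ _ (C * D / (1 + x ^+ 2))).
  rewrite normrM (ger0_norm (expR_ge0 _)) ler_pdivlMr//.
  apply: (@le_trans _ _ (C * (1 + x ^+ 2) ^+ size p * expR (- x ^+ 2) * (1 + x ^+ 2))).
    by rewrite ler_wpM2r ?(ltW y0)// ler_wpM2r ?expR_ge0.
  by rewrite -!mulrA ler_wpM2l// mulrCA -exprSr mulrC DP.
rewrite ler_pdivrMr// -ler_pdivrMl//.
apply: (@le_trans _ _ x); first by near: x; apply: nbhs_pinfty_ge; exact: num_real.
have [x1|x1] := leP x 1; first by rewrite (le_trans x1)// lerDl sqr_ge0.
by rewrite ler_wpDl// expr2 ler_peMr// ltW.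
Unshelve. all: by end_near. Qed.

Lemma continuous_FTC2_everywhere (F f : R -> R) (a b : R) : a < b ->
  (forall x : R, is_derive x 1 F (f x)) -> continuous f ->
  (\int[leb]_(x in `[a, b]) (f x)%:E = (F b - F a)%:E)%E.
Proof.
move=> ab dF cf.
have cF : continuous F.
  by move=> x; apply/differentiable_continuous/derivable1_diffP; have [] := dF x.
rewrite (@continuous_FTC2 _ f F)//; first exact: continuous_subspaceT.
- split; first by move=> x _; have [] := dF x.
  + by apply: cvg_at_right_filter; exact: cF.
  + by apply: cvg_at_left_filter; exact: cF.
- by move=> x _; rewrite derive1E; have [_] := dF x.
Qed.

(* The square root [sqrt (H ^+ 2 + e)] is a smooth substitute for [`|H|]. *)
Lemma is_derive_smooth_abs (H : R -> R) (dH e x : R) : 0 < e -> is_derive x 1 H dH ->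
  is_derive x 1 (fun y => Num.sqrt (H y ^+ 2 + e)) (H x * dH / Num.sqrt (H x ^+ 2 + e)).
Proof.
move=> e0 D; have p0 : 0 < H x ^+ 2 + e by rewrite ltr_wpDl ?sqr_ge0.
have D1 := is_derive1_sqrt p0.
have D2 : is_derive x 1 (fun y => H y ^+ 2 + e) (2 * H x * dH).
  by apply: is_derive_eq; rewrite /GRing.scale/=; ring.
have D3 := @is_derive1_comp _ Num.sqrt (fun y => H y ^+ 2 + e) x _ _ D1 D2.
apply: (@is_derive_eq _ _ _ _ _ _ _ _ D3).
rewrite invfM; field.
by rewrite gt_eqF ?sqrtr_gt0.
Qed.

Lemma sgr_div (y : R) : Num.sg y = y / `|y|.
Proof.
have [->|y0] := eqVneq y 0; first by rewrite sgr0 mul0r.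
by rewrite [X in X / _]numEsg mulfK// normr_eq0.
Qed.

(** The integrand is the derivative of [|H|], where [H x = p(x) exp(- x^2)] tends to 0 at infinity
    and equals [p(0)] at 0. As [|H|] may have corners at the zeros of [H], the fundamental theorem
    is applied to the smooth [S n], the square root of [H^2 + e n], on [[0, n + 1]]. Dominated
    convergence then treats [e n -> 0] and the growing interval at once. *)
Lemma integral_sg_poly_gauss (p : {poly R}) :
  let f x := (0 < x)%R%:R * (Num.sg p.[x] * ((p^`()).[x] - 2 * x * p.[x]) * expR (- x ^+ 2)) in
  leb.-integrable setT (EFin \o f) /\ (\int[leb]_x (f x)%:E = (- `|p.[0]|)%:E)%E.
Proof.
pose H x := p.[x] * expR (- x ^+ 2).
pose q := p^`() - 2%:P * 'X * p.
pose h x := q.[x] * expR (- x ^+ 2).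
have dg (x : R) : is_derive x 1 (fun y : R => expR (- y ^+ 2)) (- (2 * x) * expR (- x ^+ 2)).
  have D2 : is_derive x 1 (fun y : R => - y ^+ 2) (- (2 * x)).
    by apply: is_derive_eq; rewrite /GRing.scale/= !mulr1 -mulr2n mulr_natl.
  have D3 := @is_derive1_comp _ expR (fun y => - y ^+ 2) x _ _ (is_derive_expR _) D2.
  by apply: (@is_derive_eq _ _ _ _ _ _ _ _ D3); rewrite mulrC.
have dH (x : R) : is_derive x 1 H (h x).
  have D1 := is_derive_poly p x; have D2 := dg x.
  apply: (@is_derive_eq _ _ _ _ _ _ _ _ (is_deriveM D1 D2)).
  rewrite /GRing.scale/= /h /q !hornerE /=; ring.
have cg : continuous (fun x : R => expR (- x ^+ 2)) by exact: continuous_gauss_fun.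
have cH : continuous H by move=> x; apply: cvgM; [exact: continuous_horner|exact: cg].
have ch : continuous h by move=> x; apply: cvgM; [exact: continuous_horner|exact: cg].
pose e n : R := n.+1%:R^-1.
have e0 n : 0 < e n by rewrite invr_gt0 ltr0n.
pose S n x := Num.sqrt (H x ^+ 2 + e n).
have S0 n x : 0 < S n x by rewrite sqrtr_gt0 ltr_wpDl ?sqr_ge0.
pose f n x := H x * h x / S n x.
have dS n (x : R) : is_derive x 1 (S n) (f n x) by apply: is_derive_smooth_abs.
have cS n : continuous (S n).
  by move=> x; apply/differentiable_continuous/derivable1_diffP; have [] := dS n x.
have cf n : continuous (f n).
  move=> x; apply: cvgM; first by apply: cvgM; [exact: cH|exact: ch].
  by apply: cvgV; [rewrite gt_eqF|exact: cS].
have sgE x : Num.sg p.[x] = H x / `|H x|.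
  by rewrite -sgr_div /H sgrM (gtr0_sg (expR_gt0 _)) mulr1.
pose F n (x : R) : \bar R := ((EFin \o f n) \_ `]0, n.+1%:R]) x.
pose f0 (x : R) : \bar R := (((0 < x)%R%:R * (H x / `|H x| * h x))%:E).
pose g (x : R) : \bar R := `|((0 < x)%R%:R * h x)%:E|%E.
have mpos : measurable_fun [set: R] (fun x : R => (0 < x)%R%:R : R).
  by apply: measurable_boolR; exact: measurable_fun_ltr.
have [] := @dominated_convergence _ _ R leb setT measurableT F f0 g.
- move=> n; apply/(measurable_restrictT _ _).1 => //.
  by apply/measurable_EFinP; apply: measurable_funTS; exact: continuous_measurable_fun.
- apply/measurable_EFinP; apply: measurable_funM => //.
  have mH : measurable_fun [set: R] H by exact: continuous_measurable_fun.
  apply: measurable_funM; last exact: continuous_measurable_fun.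
  by apply: measurable_funM => //; apply: measurable_funV; exact: measurableT_comp.
- apply: aeW => x _.
  have [x0|x0] := ltP 0 x; last first.
    rewrite (_ : F ^~ x = cst (f0 x)); first exact: cvg_cst.
    apply/funext => n; rewrite /F /f0 patchE mem_setE/= in_itv/= !(ltNge 0 x) x0/=.
    by rewrite mul0r.
  have : (f n x)%:E @[n --> \oo] --> f0 x.
    apply: cvg_EFin; first by apply: nearW.
    rewrite /f0 x0 mul1r.
    (* Where [H x = 0], the quotient of [H x] by its absolute value is 0 by the convention on
       division, and so is every [f n x]. *)
    have [Hx|Hx] := eqVneq (H x) 0.
      by rewrite /f Hx !mul0r; under eq_fun do rewrite !mul0r; exact: cvg_cst.
    have -> : H x / `|H x| * h x = H x * h x / Num.sqrt (H x ^+ 2 + 0).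
      by rewrite addr0 sqrtr_sqr mulrAC.
    apply: cvgM; first exact: cvg_cst.
    apply: cvgV; first by rewrite addr0 sqrtr_sqr normr_eq0.
    apply: continuous_cvg; first exact: sqrt_continuous.
    by apply: cvgD; [exact: cvg_cst|exact: cvg_harmonic].
  apply: cvg_trans; apply: near_eq_cvg; near=> n.
  rewrite /F patchE mem_setE/= in_itv/= x0/= ifT//.
  apply: (@le_trans _ _ n%:R); last by rewrite ler_nat.
  near: n; exact: nbhs_infty_ger.
- apply: integrable_abse.
  exact: (integrable_poly_gauss q).
- apply: aeW => x n _; rewrite /F /g patchE mem_setE/= in_itv/=.
  case: (ltP 0 x) => x0 /=; last by rewrite mul0r.
  case: ifP => _; last by rewrite /point/= lee_fin normr0.
  (* [|H x| <= S n x], so that [|h x|] dominates every [f n x]. *)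
  rewrite lee_fin mul1r /f normrM normrM normfV (gtr0_norm (S0 n x)) mulrAC ler_piMl//.
  rewrite ler_pdivrMr// mul1r -sqrtr_sqr ler_wsqrtr// lerDl ltW//.
move=> if0 _ cvF.
have FE n : (\int[leb]_x F n x = (S n n.+1%:R - S n 0)%:E)%E.
  rewrite /F -integral_mkcond.
  rewrite (@integral_itv_obnd_cbnd _ 0 (BRight n.+1%:R) (EFin \o f n)).
    by rewrite (continuous_FTC2_everywhere (F := S n)).
  by apply/measurable_EFinP; apply: measurable_funTS; exact: continuous_measurable_fun.
have cv2 : (S n n.+1%:R - S n 0)%:E @[n --> \oo] --> (- `|p.[0]|)%:E.
  apply: cvg_EFin; first by apply: nearW.
  rewrite -[- _]add0r; apply: cvgB.
    rewrite -[X in _ --> X](@sqrtr0 R).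
    apply: continuous_cvg; first exact: sqrt_continuous.
    rewrite -[X in _ --> X](addr0 0); apply: cvgD; last exact: cvg_harmonic.
    have Hn : H n.+1%:R @[n --> \oo] --> (0 : R).
      apply: (@cvg_comp _ _ _ (fun n : nat => n.+1%:R : R) H _ +oo%R); last exact: poly_gauss_cvg0.
      exact: (cvg_comp _ _ (cvg_addnl 1) (@cvgr_idn R)).
    by have := cvgM Hn Hn; rewrite mulr0; exact.
  have -> : `|p.[0]| = Num.sqrt (H 0 ^+ 2 + 0).
    by rewrite addr0 sqrtr_sqr /H expr0n oppr0 expR0 mulr1.
  apply: continuous_cvg; first exact: sqrt_continuous.
  by apply: cvgD; [exact: cvg_cst|exact: cvg_harmonic].
have E : (\int[leb]_x f0 x = (- `|p.[0]|)%:E)%E.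
  rewrite -(funext FE) in cv2.
  exact: cvg_unique cvF cv2.
have fE x : (0 < x)%R%:R * (Num.sg p.[x] * (p^`().[x] - 2 * x * p.[x]) * expR (- x ^+ 2)) =
    (0 < x)%R%:R * (H x / `|H x| * h x).
  rewrite -sgE /h /q; congr (_ * _).
  rewrite -mulrA; congr (_ * (_ * _)); rewrite !hornerE /=; ring.
rewrite /= -E; split; last by apply: eq_integral => x _; rewrite fE.
by rewrite (funext fE); exact: if0.
Unshelve. all: by end_near. Qed.

End gaussian_polynomials.

(** * Integrability against the Gaussian weight on tuples *)

Section gaussian_tuples.
Context {R : realType}.
Local Notation leb := (@lebesgue_measure R).
Local Notation L := (@lebesgue_tuple R).

Lemma integral_tupleS_swap n (f : n.+1.-tuple R -> R) :
  (L n.+1).-integrable setT (EFin \o f) ->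
  (\int[L n.+1]_s (f s)%:E = \int[L n]_t \int[leb]_x (f (cons_tuple x t))%:E)%E.
Proof.
move=> /integrableP[mf finf].
have mc := @measurable_cons_pair R n.
pose nu := measure_function_pushforward__canonical__measure_function_Measure
  (leb \x L n)%E mc.
have ip : (leb \x L n)%E.-integrable setT (EFin \o f \o (fun p => cons_tuple p.1 p.2)).
  apply/integrableP; split; first exact: measurableT_comp mf mc.
  rewrite ge0_integral_tupleS in finf.
  - rewrite fubini_tonelli1//.
    by apply: measurableT_comp => //; exact: measurableT_comp mf mc.
  - exact: measurableT_comp.
  - by move=> s.
transitivity (\int[nu]_s (f s)%:E)%E; first exact: eq_measure_integral.
rewrite (@integral_pushforward _ _ _ _ _ _ mc)//.
by rewrite preimage_setT -(integral21_prod_meas1 ip).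
Qed.

(** At least 1, above the absolute value of every entry, and a product over the entries, so that the
    Gaussian integrals of its powers factor. *)
Definition envelope n (s : n.-tuple R) : R := \prod_(i < n) (1 + tnth s i ^+ 2).

Lemma envelope_factor_ge1 n (s : n.-tuple R) i : 1 <= 1 + tnth s i ^+ 2.
Proof. by rewrite lerDl sqr_ge0. Qed.

Lemma envelope_ge1 n (s : n.-tuple R) : 1 <= envelope s.
Proof.
rewrite /envelope; elim/big_ind : _ => // [x y x1 y1|i _]; last exact: envelope_factor_ge1.
by rewrite mulr_ege1.
Qed.

Lemma envelope_ge0 n (s : n.-tuple R) : 0 <= envelope s.
Proof. exact: le_trans ler01 (envelope_ge1 s). Qed.

(** A class that contains not only polynomials but also their absolute values and the quotients
    [|f|^b / f] of the integration by parts, and whose members are integrable against the Gaussian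
    weight. *)
Definition poly_bounded n (h : n.-tuple R -> R) :=
  measurable_fun [set: n.-tuple R] h /\
  exists C : R, exists M : nat, 0 <= C /\ forall s, `|h s| <= C * envelope s ^+ M.

Lemma poly_bounded_cst n c : poly_bounded (fun _ : n.-tuple R => c).
Proof. by split => //; exists `|c|, 0%N; split => // s; rewrite expr0 mulr1. Qed.

Lemma poly_boundedM n (f g : n.-tuple R -> R) :
  poly_bounded f -> poly_bounded g -> poly_bounded (fun s => f s * g s).
Proof.
move=> [mf [C [M [C0 fC]]]] [mg [D [K [D0 gD]]]]; split; first exact: measurable_funM.
exists (C * D), (M + K)%N; split => [|s]; first exact: mulr_ge0.
by rewrite normrM exprD mulrACA ler_pM.
Qed.

Lemma poly_bounded_prod n (I : Type) (r : seq I) (P : pred I) (f : I -> n.-tuple R -> R) :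
  (forall i, P i -> poly_bounded (f i)) -> poly_bounded (fun s => \prod_(i <- r | P i) f i s).
Proof.
move=> H; elim: r => [|i r IH].
  rewrite (_ : (fun s => _) = (fun=> 1)); first exact: poly_bounded_cst.
  by apply/funext => s; rewrite big_nil.
have [Pi|Pi] := boolP (P i); last first.
  rewrite (_ : (fun s => _) = (fun s => \prod_(i <- r | P i) f i s))//.
  by apply/funext => s; rewrite big_cons (negbTE Pi).
rewrite (_ : (fun s => _) = (fun s => f i s * \prod_(i <- r | P i) f i s)).
  by apply: poly_boundedM => //; exact: H.
by apply/funext => s; rewrite big_cons Pi.
Qed.

Lemma poly_boundedX n (f : n.-tuple R -> R) k : poly_bounded f -> poly_bounded (fun s => f s ^+ k).
Proof.
move=> pf; rewrite (_ : (fun s => _) = (fun s => \prod_(i < k) f s)).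
  exact: poly_bounded_prod.
by apply/funext => s; rewrite prodr_const card_ord.
Qed.

Lemma poly_bounded_norm n (f : n.-tuple R -> R) : poly_bounded f -> poly_bounded (fun s => `|f s|).
Proof.
move=> [mf [C [M [C0 fC]]]]; split; first exact: measurableT_comp.
by exists C, M; split => // s; rewrite normr_id.
Qed.

Lemma poly_boundedD n (f g : n.-tuple R -> R) :
  poly_bounded f -> poly_bounded g -> poly_bounded (fun s => f s + g s).
Proof.
move=> [mf [C [M [C0 fC]]]] [mg [D [K [D0 gD]]]]; split; first exact: measurable_funD.
exists (C + D), (M + K)%N; split => [|s]; first exact: addr_ge0.
apply: le_trans (ler_normD _ _) _; rewrite mulrDl lerD//.
  by apply: le_trans (fC s) _; rewrite ler_wpM2l// ler_weXn2l ?envelope_ge1 ?leq_addr.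
by apply: le_trans (gD s) _; rewrite ler_wpM2l// ler_weXn2l ?envelope_ge1 ?leq_addl.
Qed.

Lemma poly_bounded_tnth n (i : 'I_n) : poly_bounded (fun s : n.-tuple R => tnth s i).
Proof.
split; first exact: measurable_tnth.
exists 1, 1%N; split => // s; rewrite mul1r expr1.
apply: (@le_trans _ _ (1 + tnth s i ^+ 2)).
  have [x1|x1] := leP `|tnth s i| 1; first by rewrite (le_trans x1)// lerDl sqr_ge0.
  by rewrite -real_normK ?num_real// ler_wpDl// expr2 ler_peMr// ltW.
rewrite /envelope (bigD1 i)//= ler_peMr//; first by rewrite addr_ge0 ?sqr_ge0.
elim/big_ind : _ => // [x y x1 y1|j _]; last exact: envelope_factor_ge1.
by rewrite mulr_ege1.
Qed.

Definition gauss_weight n (s : n.-tuple R) : R :=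
  (positive s)%:R * expR (- \sum_(i < n) tnth s i ^+ 2).

Lemma gauss_weight_ge0 n (s : n.-tuple R) : 0 <= gauss_weight s.
Proof. by rewrite mulr_ge0 ?expR_ge0. Qed.

Lemma measurable_gauss_weight n : measurable_fun [set: n.-tuple R] (@gauss_weight n).
Proof.
apply: measurable_funM; first exact: (@measurable_boolR R _ _ _ (@measurable_positive R n)).
apply: measurableT_comp => //; apply: measurableT_comp => //.
apply: measurable_sum => i; apply: measurable_funX; exact: measurable_tnth.
Qed.

Lemma gauss_weight_envelope n M (s : n.-tuple R) :
  gauss_weight s * envelope s ^+ M = \prod_(i < n) half_gauss M (tnth s i).
Proof.
rewrite /half_gauss /gauss_weight /envelope big_split big_split/= -prodrXl.
rewrite -sumrN expR_sum mulrAC; congr (_ * _ * _).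
- case: positiveP => [H|H]; first by rewrite big1// => i _; rewrite H.
  have [i Hi] : exists i, ~~ (0 < tnth s i).
    by apply: contra_notP H => H i; apply/negPn/negP => ?; apply: H; exists i.
  by rewrite (bigD1 i)//= (negbTE Hi) mul0r.
Qed.

Lemma integrable_gauss_weight n (h : n.-tuple R -> R) : poly_bounded h ->
  (L n).-integrable setT (EFin \o (fun s => gauss_weight s * h s)).
Proof.
move=> [mh [C [M [C0 hC]]]].
have [c cE] := integral_half_gauss (R := R) M.
have mw := @measurable_gauss_weight n.
have mp : measurable_fun [set: n.-tuple R] (fun s => gauss_weight s * envelope s ^+ M).
  apply: measurable_funM => //; apply: measurable_funX.
  apply: measurable_prod => i _; apply: measurable_funD => //.
  apply: measurable_funX; exact: measurable_tnth.
apply: (@le_integrable _ _ _ (L n) setT _ _ (fun s => (C%:E * (gauss_weight s * envelope s ^+ M)%:E)%E)) => //.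
- by apply/measurable_EFinP; exact: measurable_funM.
- move=> s _; rewrite -EFinM/= lee_fin.
  have e0 : 0 <= C * (gauss_weight s * envelope s ^+ M).
    by rewrite mulr_ge0// mulr_ge0 ?gauss_weight_ge0// exprn_ge0 ?envelope_ge0.
  rewrite (ger0_norm e0) normrM (ger0_norm (gauss_weight_ge0 s)).
  by rewrite mulrCA ler_wpM2l ?gauss_weight_ge0.
- apply: (integrableZl measurableT); apply/integrableP; split; first exact/measurable_EFinP.
  under eq_integral => s _.
    rewrite gee0_abs ?lee_fin ?mulr_ge0 ?gauss_weight_ge0 ?exprn_ge0 ?envelope_ge0//.
    rewrite gauss_weight_envelope.
    over.
  rewrite (ge0_integral_tuple_prod n (measurable_half_gauss M) _ cE) ?ltry//.
  exact: half_gauss_ge0.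
Qed.

End gaussian_tuples.

(** * Vandermonde products *)

Section vandermonde.
Context {R : realType}.

(** A product over [j < k] does not visibly survive a reindexing. Its square is the product over all
    ordered pairs of distinct indices, which does, and nonnegativity allows the square to be
    removed. *)
Lemma prod_lt_pairs_perm n (f : 'I_n -> 'I_n -> R) (sg : {perm 'I_n}) :
  (forall j k, f j k = f k j) -> (forall j k, 0 <= f j k) ->
  \prod_(j < n) \prod_(k < n | (j < k)%N) f (sg j) (sg k) =
  \prod_(j < n) \prod_(k < n | (j < k)%N) f j k.
Proof.
move=> fC f0.
have sqrE (g : 'I_n -> 'I_n -> R) : (forall j k, g j k = g k j) ->
    (\prod_(j < n) \prod_(k < n | (j < k)%N) g j k) ^+ 2 =
    \prod_(j < n) \prod_(k < n | k != j) g j k.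
  move=> gC; rewrite expr2.
  have E : \prod_(j < n) \prod_(k < n | (j < k)%N) g j k =
           \prod_(j < n) \prod_(k < n | (k < j)%N) g j k.
    rewrite (exchange_big_dep xpredT)//=; apply: eq_bigr => j _.
    by apply: eq_bigr => k _; rewrite gC.
  rewrite {2}E -big_split/=; apply: eq_bigr => j _.
  rewrite [RHS](bigID (fun k : 'I_n => (j < k)%N))/=; congr (_ * _).
    by apply: eq_bigl => k; case: ltngtP => [||/val_inj->] //=; rewrite ?eqxx//; case: eqP => // ->; rewrite ltnn.
  by apply: eq_bigl => k; rewrite -leqNgt ltn_neqAle.
apply/eqP; rewrite -(@eqrXn2 _ 2)//; last 2 first.
- by apply: prodr_ge0 => j _; apply: prodr_ge0.
- by apply: prodr_ge0 => j _; apply: prodr_ge0.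
rewrite (sqrE (fun j k => f (sg j) (sg k)))// sqrE//; apply/eqP.
rewrite [RHS](reindex_inj (@perm_inj _ sg)); apply: eq_bigr => j _.
rewrite [RHS](reindex_inj (@perm_inj _ sg)); apply: eq_bigl => k.
by rewrite (inj_eq perm_inj).
Qed.

Definition vandermonde_abs (b n : nat) (s : n.-tuple R) : R :=
  \prod_(j < n) \prod_(k < n | (j < k)%N) `|tnth s j ^+ 2 - tnth s k ^+ 2| ^+ b.

Lemma vandermonde_abs_ge0 b n (s : n.-tuple R) : 0 <= vandermonde_abs b s.
Proof. by apply: prodr_ge0 => j _; apply: prodr_ge0 => k _; rewrite exprn_ge0. Qed.

Lemma vandermonde_abs_perm b n (sg : {perm 'I_n}) (s : n.-tuple R) :
  vandermonde_abs b (perm_tuple sg s) = vandermonde_abs b s.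
Proof.
rewrite -[RHS](@prod_lt_pairs_perm _ (fun j k => `|tnth s j ^+ 2 - tnth s k ^+ 2| ^+ b) sg).
- by apply: eq_bigr => j _; apply: eq_bigr => k _; rewrite !tnth_mktuple.
- by move=> j k; rewrite distrC.
- by move=> j k; rewrite exprn_ge0.
Qed.

Lemma vandermonde_abs_cons b n (x : R) (t : n.-tuple R) :
  vandermonde_abs b (cons_tuple x t) =
  (\prod_(i < n) `|x ^+ 2 - tnth t i ^+ 2| ^+ b) * vandermonde_abs b t.
Proof.
rewrite /vandermonde_abs big_ord_recl; congr (_ * _).
  rewrite big_mkcond big_ord_recl/= mul1r.
  by apply: eq_bigr => i _; rewrite tnth_cons0 tnth_consS.
apply: eq_bigr => j _; rewrite [LHS]big_mkcond big_ord_recl/= mul1r [RHS]big_mkcond.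
by apply: eq_bigr => k _; rewrite !tnth_consS.
Qed.

Lemma poly_bounded_sqr_diff n (j k : 'I_n) :
  poly_bounded (fun s : n.-tuple R => tnth s j ^+ 2 - tnth s k ^+ 2).
Proof.
rewrite (_ : (fun s => _) = (fun s => tnth s j ^+ 2 + (-1) * tnth s k ^+ 2)).
  apply: poly_boundedD; first exact/poly_boundedX/poly_bounded_tnth.
  apply: poly_boundedM; first exact: poly_bounded_cst.
  exact/poly_boundedX/poly_bounded_tnth.
by apply/funext => s; rewrite mulN1r.
Qed.

Lemma poly_bounded_vandermonde_abs b n : poly_bounded (@vandermonde_abs b n).
Proof.
apply: poly_bounded_prod => j _; apply: poly_bounded_prod => k _.
exact/poly_boundedX/poly_bounded_norm/poly_bounded_sqr_diff.
Qed.

Lemma deriv_prod_horner n (q : 'I_n -> {poly R}) (x : R) :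
  (forall i, (q i).[x] != 0) ->
  (\prod_(i < n) q i)^`().[x] =
  (\prod_(i < n) q i).[x] * \sum_(i < n) (q i)^`().[x] / (q i).[x].
Proof.
elim: n q => [|n IH] q q0; first by rewrite !big_ord0 mulr0 derivC horner0.
rewrite !big_ord_recl derivM hornerD !hornerM IH => [|i]; last exact: q0.
by field.
Qed.

(** Logarithmic differentiation of [|p|], which equals [x ^+ k * P] at [x > 0]. Where [P = 0] both
    sides are 0, through the sign on the left and through a factor [P] in each term on the right. *)
Lemma sg_deriv_abs (b k n : nat) (x : R) (t : n.-tuple R) : (0 < b)%N -> 0 < x ->
  let p : {poly R} := 'X^k * \prod_(i < n) ('X^2 - (tnth t i ^+ 2)%:P) ^+ b in
  let P := \prod_(i < n) `|x ^+ 2 - tnth t i ^+ 2| ^+ b in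
  Num.sg p.[x] * (p^`().[x] - 2 * x * p.[x]) =
  k%:R * x ^+ k.-1 * P - 2 * (x ^+ k.+1 * P) +
  2 * b%:R * \sum_(i < n) x ^+ k.+1 * P / (x ^+ 2 - tnth t i ^+ 2).
Proof.
move=> b0 x0 p P.
have qE i : (('X^2 - (tnth t i ^+ 2)%:P) ^+ b).[x] = (x ^+ 2 - tnth t i ^+ 2) ^+ b.
  by rewrite horner_exp !hornerE.
have pE : p.[x] = x ^+ k * \prod_(i < n) (x ^+ 2 - tnth t i ^+ 2) ^+ b.
  rewrite hornerM hornerXn horner_prod; congr (_ * _).
  by apply: eq_bigr => i _; rewrite qE.
have pP : `|p.[x]| = x ^+ k * P.
  rewrite pE normrM normrX (gtr0_norm x0) normr_prod; congr (_ * _).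
  by apply: eq_bigr => i _; rewrite normrX.
have [P0|P0] := eqVneq P 0.
  have -> : p.[x] = 0 by apply/eqP; rewrite -normr_eq0 pP P0 mulr0.
  rewrite sgr0 mul0r P0 !mulr0 subrr add0r big1 ?mulr0// => i _.
  by rewrite mul0r.
have d0 i : x ^+ 2 - tnth t i ^+ 2 != 0.
  apply: contra_neq P0 => d0; rewrite /P (bigD1 i)//= d0 normr0 expr0n.
  by rewrite (gtn_eqF b0) mul0r.
have q0 i : (('X^2 - (tnth t i ^+ 2)%:P) ^+ b).[x] != 0 by rewrite qE expf_neq0.
have dq i : (('X^2 - (tnth t i ^+ 2)%:P) ^+ b)^`().[x] / (('X^2 - (tnth t i ^+ 2)%:P) ^+ b).[x]
    = 2 * b%:R * x / (x ^+ 2 - tnth t i ^+ 2).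
  rewrite deriv_exp derivB derivXn derivC subr0 hornerMn hornerM hornerMn hornerXn expr1.
  rewrite qE horner_exp hornerD hornerN hornerC hornerXn.
  have := d0 i; set d := x ^+ 2 - _ => dn0; have e0 := expf_neq0 b.-1 dn0.
  have -> : d ^+ b = d * d ^+ b.-1 by rewrite -exprS prednK.
  rewrite -[_ *+ b]mulr_natr -[x *+ 2]mulr_natr.
  have cancelE (B y d' E : R) : d' != 0 -> E != 0 ->
      y * 2 * E * B / (d' * E) = 2 * B * y / d'.
    by move=> ? ?; field; apply/andP.
  exact: cancelE.
have dp : p^`().[x] = p.[x] * (k%:R / x + \sum_(i < n) 2 * b%:R * x / (x ^+ 2 - tnth t i ^+ 2)).
  have := deriv_prod_horner q0; under [X in _ * X]eq_bigr do rewrite dq.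
  rewrite /p; move: (\prod_(i < n) _) => Q dQ.
  rewrite derivM hornerD !hornerM dQ mulrDr !mulrA; congr (_ + _).
  rewrite derivXn hornerMn !hornerXn; case: (k) => [|k']; first by rewrite !mulr0n mul0r mulr0 mul0r.
  by rewrite /= exprS -mulr_natr; field; rewrite gt_eqF.
have sgp : Num.sg p.[x] * p.[x] = x ^+ k * P by rewrite -pP normrEsg.
rewrite dp.
transitivity (Num.sg p.[x] * p.[x] *
    (k%:R / x + \sum_(i < n) 2 * b%:R * x / (x ^+ 2 - tnth t i ^+ 2) - 2 * x)).
  have E (a y A z : R) : a * (y * A - z * y) = a * y * (A - z) by ring.
  exact: E.
rewrite sgp mulrBr mulrDr mulr_sumr.
rewrite addrAC; congr (_ - _ + _).
- case: (k) => [|k']; first by rewrite !mul0r mulr0.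
  by rewrite /= exprS; field; rewrite gt_eqF.
- by rewrite (exprS x k); ring.
- have E (a y c z v : R) : a * y * (2 * c * z * v) = 2 * c * (z * a * y * v) by ring.
  by rewrite mulr_sumr; apply: eq_bigr => i _; rewrite (exprS x k); exact: E.
Qed.

End vandermonde.

(** * Aomoto's integration by parts *)

Section aomoto.
Context {R : realType}.
Local Notation L := (@lebesgue_tuple R).
Local Notation swap j := (perm_tuple (tperm ord0 j)).

Definition tail n (s : n.+1.-tuple R) : n.-tuple R := [tuple of behead s].

Lemma tail_cons n x (t : n.-tuple R) : tail (cons_tuple x t) = t.
Proof. exact: val_inj. Qed.

Lemma tnth_tail n (s : n.+1.-tuple R) i : tnth (tail s) i = tnth s (lift ord0 i).
Proof. by case/tupleP: s => x s; rewrite tail_cons tnth_consS. Qed.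

Lemma gauss_weight_cons n x (t : n.-tuple R) :
  gauss_weight (cons_tuple x t) = (0 < x)%R%:R * expR (- x ^+ 2) * gauss_weight t.
Proof.
rewrite /gauss_weight; have -> : \sum_(i < n.+1) tnth (cons_tuple x t) i ^+ 2 = x ^+ 2 + \sum_(i < n) tnth t i ^+ 2.
  by rewrite big_ord_recl; congr (_ + _); apply: eq_bigr => i _; rewrite tnth_consS.
rewrite opprD expRD /positive/= -[all _ _]/(positive t) -/(positive t).
by case: (0 < x); case: (positive t); rewrite /= ?mul1r ?mul0r ?mulr0.
Qed.

Lemma gauss_weight_perm n (sg : {perm 'I_n}) (s : n.-tuple R) :
  gauss_weight (perm_tuple sg s) = gauss_weight s.
Proof.
rewrite /gauss_weight positive_perm; last exact: perm_inj.
congr (_ * expR (- _)); rewrite [RHS](reindex_inj (@perm_inj _ sg)).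
by apply: eq_bigr => i _; rewrite tnth_mktuple.
Qed.

(** An unnormalised mean. It is real-valued so that linear identities can be manipulated;
    [poly_bounded] guarantees that the integral is finite. *)
Definition gauss_mean n (h : n.-tuple R -> R) : R :=
  \int[L n]_s (gauss_weight s * h s).

Lemma gauss_meanE n (h : n.-tuple R -> R) : poly_bounded h ->
  (\int[L n]_s (gauss_weight s * h s)%:E)%E = (gauss_mean h)%:E.
Proof.
move=> ph; rewrite /gauss_mean /Rintegral fineK//.
exact: integrable_fin_num (integrable_gauss_weight ph).
Qed.

Lemma gauss_meanD n (f g : n.-tuple R -> R) : poly_bounded f -> poly_bounded g ->
  gauss_mean (fun s => f s + g s) = gauss_mean f + gauss_mean g.
Proof.
move=> pf pg; rewrite /gauss_mean -RintegralD//; try exact: integrable_gauss_weight.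
by apply: eq_Rintegral => s _; rewrite mulrDr.
Qed.

Lemma gauss_meanZ n c (f : n.-tuple R -> R) : poly_bounded f ->
  gauss_mean (fun s => c * f s) = c * gauss_mean f.
Proof.
move=> pf; rewrite /gauss_mean -RintegralZl//; last exact: integrable_gauss_weight.
by apply: eq_Rintegral => s _; rewrite mulrCA.
Qed.

Lemma poly_boundedZ n c (f : n.-tuple R -> R) : poly_bounded f -> poly_bounded (fun s => c * f s).
Proof. by move=> pf; apply: poly_boundedM => //; exact: poly_bounded_cst. Qed.

Lemma poly_bounded_sum n (I : Type) (r : seq I) (f : I -> n.-tuple R -> R) :
  (forall i, poly_bounded (f i)) -> poly_bounded (fun s => \sum_(i <- r) f i s).
Proof.
move=> pf; elim: r => [|i r IH].
  rewrite (_ : (fun s => _) = (fun=> 0)); first exact: poly_bounded_cst.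
  by apply/funext => s; rewrite big_nil.
rewrite (_ : (fun s => _) = (fun s => f i s + \sum_(i <- r) f i s)).
  exact: poly_boundedD.
by apply/funext => s; rewrite big_cons.
Qed.

Lemma gauss_mean_sum n (I : Type) (r : seq I) (f : I -> n.-tuple R -> R) :
  (forall i, poly_bounded (f i)) ->
  gauss_mean (fun s => \sum_(i <- r) f i s) = \sum_(i <- r) gauss_mean (f i).
Proof.
move=> pf; elim: r => [|i r IH].
  rewrite big_nil; transitivity (0 * gauss_mean (fun _ : n.-tuple R => 0 : R)); last by rewrite mul0r.
  rewrite -gauss_meanZ; last exact: poly_bounded_cst.
  by congr gauss_mean; apply/funext => s; rewrite big_nil mul0r.
rewrite big_cons -IH -gauss_meanD//; last exact: poly_bounded_sum.
by congr gauss_mean; apply/funext => s; rewrite big_cons.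
Qed.

(** The invariance is available for nonnegative functions, hence the splitting into positive and
    negative parts. *)
Lemma gauss_mean_perm n (j : 'I_n.+1) (h : n.+1.-tuple R -> R) : poly_bounded h ->
  gauss_mean (fun s => h (swap j s)) = gauss_mean h.
Proof.
move=> [mh _]; rewrite /gauss_mean /Rintegral; congr fine.
have mg : measurable_fun [set: n.+1.-tuple R] (fun s => (gauss_weight s * h s)%:E).
  by apply/measurable_EFinP; apply: measurable_funM => //; exact: measurable_gauss_weight.
rewrite integralE [RHS]integralE.
rewrite -(ge0_integral_tperm j (measurable_funepos mg)) //.
rewrite -(ge0_integral_tperm j (measurable_funeneg mg)) //.
by congr (_ - _)%E; apply: eq_integral => s _; rewrite ?funeposE ?funenegE gauss_weight_perm.
Qed.

End aomoto.

Section aomoto_relation.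
Context {R : realType}.
Local Notation leb := (@lebesgue_measure R).
Local Notation swap j := (perm_tuple (tperm ord0 j)).

Lemma poly_bounded_le n (f g : n.-tuple R -> R) :
  measurable_fun [set: n.-tuple R] f -> (forall s, `|f s| <= `|g s|) ->
  poly_bounded g -> poly_bounded f.
Proof.
move=> mf fg [mg [C [M [C0 gC]]]]; split => //; exists C, M; split => // s.
exact: le_trans (fg s) (gC s).
Qed.

(** The quotient is bounded by [|f| ^+ b.-1]; at the zeros of [f] it is 0 by the convention on
    division. *)
Lemma poly_bounded_quotient n (f : n.-tuple R -> R) b : (0 < b)%N ->
  poly_bounded f -> poly_bounded (fun s => `|f s| ^+ b / f s).
Proof.
move=> b0 pf; have [mf _] := pf.
apply: (@poly_bounded_le _ _ (fun s => `|f s| ^+ b.-1)).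
- apply: measurable_funM; last exact: measurable_funV.
  by apply: measurable_funX; exact: measurableT_comp.
- move=> s; rewrite normrM normfV !normrX normr_id.
  have [->|f0] := eqVneq (f s) 0; first by rewrite normr0 invr0 mulr0 exprn_ge0.
  by rewrite -[in leLHS](prednK b0) exprSr mulfK ?normr_eq0.
- exact/poly_boundedX/poly_bounded_norm.
Qed.

Lemma measurable_tail n : measurable_fun [set: n.+1.-tuple R] (@tail R n).
Proof. exact: measurable_behead. Qed.

Lemma poly_bounded_tail n (f : n.-tuple R -> R) : poly_bounded f ->
  poly_bounded (fun s : n.+1.-tuple R => f (tail s)).
Proof.
move=> [mf [C [M [C0 fC]]]]; split; first exact: (measurableT_comp mf (@measurable_tail n)).
exists C, M; split => // s; apply: le_trans (fC _) _; rewrite ler_wpM2l//.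
apply: lerXn2r; rewrite ?nnegrE ?envelope_ge0// /envelope [leRHS]big_ord_recl.
under eq_bigr do rewrite tnth_tail.
rewrite ler_peMl ?envelope_factor_ge1//.
by apply: prodr_ge0 => i _; apply: le_trans ler01 (envelope_factor_ge1 _ _).
Qed.

(** The part of the Vandermonde product that involves the head; what remains is the Vandermonde
    product of the tail ([vandermonde_abs_head]). *)
Definition head_gaps b n (s : n.+1.-tuple R) : R :=
  \prod_(i < n) `|tnth s ord0 ^+ 2 - tnth s (lift ord0 i) ^+ 2| ^+ b.

Lemma poly_bounded_head_gaps b n : poly_bounded (@head_gaps b n).
Proof.
apply: poly_bounded_prod => i _.
exact/poly_boundedX/poly_bounded_norm/poly_bounded_sqr_diff.
Qed.

Lemma vandermonde_abs_head b n (s : n.+1.-tuple R) :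
  vandermonde_abs b s = head_gaps b s * vandermonde_abs b (tail s).
Proof.
case/tupleP: s => x t; rewrite vandermonde_abs_cons tail_cons; congr (_ * _).
by apply: eq_bigr => i _; rewrite tnth_cons0 tnth_consS.
Qed.

Lemma poly_bounded_gap_quotient b n (i : 'I_n) : (0 < b)%N ->
  poly_bounded (fun s : n.+1.-tuple R =>
    head_gaps b s / (tnth s ord0 ^+ 2 - tnth s (lift ord0 i) ^+ 2)).
Proof.
move=> b0; rewrite (_ : (fun s => _) = (fun s =>
   `|tnth s ord0 ^+ 2 - tnth s (lift ord0 i) ^+ 2| ^+ b /
     (tnth s ord0 ^+ 2 - tnth s (lift ord0 i) ^+ 2) *
   \prod_(j < n | j != i) `|tnth s ord0 ^+ 2 - tnth s (lift ord0 j) ^+ 2| ^+ b)).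
  apply: poly_boundedM; first exact/poly_bounded_quotient/poly_bounded_sqr_diff.
  apply: poly_bounded_prod => j _.
  exact/poly_boundedX/poly_bounded_norm/poly_bounded_sqr_diff.
by apply/funext => s; rewrite /head_gaps (bigD1 i)//= mulrAC.
Qed.

(* Integration by parts in the first variable [x], applied to [x ^+ k * expR (- x ^+ 2)]
   times the gaps; a boundary term at [x = 0] survives only for [k = 0]. *)
Lemma aomoto_relation b k n (w : n.-tuple R -> R) : (0 < b)%N -> poly_bounded w ->
  k%:R * gauss_mean (fun s : n.+1.-tuple R => tnth s ord0 ^+ k.-1 * w (tail s) * head_gaps b s)
  - 2 * gauss_mean (fun s : n.+1.-tuple R => tnth s ord0 ^+ k.+1 * w (tail s) * head_gaps b s)
  + 2 * b%:R * (\sum_(i < n) gauss_mean (fun s : n.+1.-tuple R =>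
      tnth s ord0 ^+ k.+1 * w (tail s) *
      (head_gaps b s / (tnth s ord0 ^+ 2 - tnth s (lift ord0 i) ^+ 2))))
  = - ((k == 0)%:R * gauss_mean (fun t : n.-tuple R => w t * \prod_(i < n) tnth t i ^+ (2 * b))).
Proof.
move=> b0 pw.
have pwt := poly_bounded_tail pw.
have p0 e : poly_bounded (fun s : n.+1.-tuple R => tnth s ord0 ^+ e * w (tail s)).
  by apply: poly_boundedM => //; exact/poly_boundedX/poly_bounded_tnth.
have pA e : poly_bounded (fun s : n.+1.-tuple R => tnth s ord0 ^+ e * w (tail s) * head_gaps b s).
  by apply: poly_boundedM => //; exact: poly_bounded_head_gaps.
have pC i : poly_bounded (fun s : n.+1.-tuple R => tnth s ord0 ^+ k.+1 * w (tail s) *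
      (head_gaps b s / (tnth s ord0 ^+ 2 - tnth s (lift ord0 i) ^+ 2))).
  by apply: poly_boundedM => //; exact: poly_bounded_gap_quotient.
have pS := poly_bounded_sum (index_enum 'I_n) pC.
rewrite -gauss_mean_sum// -(gauss_meanZ k%:R (pA _)) -[X in _ + X + _]mulNr.
rewrite -(gauss_meanZ (-2) (pA _)) -(gauss_meanZ (2 * b%:R) pS).
rewrite -gauss_meanD; [|exact: poly_boundedZ|exact: poly_boundedZ].
rewrite -gauss_meanD; last exact: poly_boundedZ; last first.
  by apply: poly_boundedD; exact: poly_boundedZ.
set Q := (fun s => _).
have pQ : poly_bounded Q.
  by apply: poly_boundedD; [apply: poly_boundedD|]; exact: poly_boundedZ.
have pw2 : poly_bounded (fun t : n.-tuple R => w t * \prod_(i < n) tnth t i ^+ (2 * b)).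
  by apply: poly_boundedM => //; apply: poly_bounded_prod => i _; exact/poly_boundedX/poly_bounded_tnth.
rewrite -mulNr -gauss_meanZ//.
apply/eqP; rewrite -eqe -gauss_meanE// -gauss_meanE; last exact: poly_boundedZ.
rewrite integral_tupleS_swap; last exact: integrable_gauss_weight.
apply/eqP; apply: eq_integral => t _.
(* For a fixed tail, [sg_deriv_abs] identifies the integrand in the head with that of
   [integral_sg_poly_gauss] for this polynomial. *)
pose p : {poly R} := 'X^k * \prod_(i < n) ('X^2 - (tnth t i ^+ 2)%:P) ^+ b.
have [ip iE] := integral_sg_poly_gauss p.
transitivity (\int[leb]_x ((gauss_weight t * w t)%:E *
  ((0 < x)%R%:R * (Num.sg p.[x] * (p^`().[x] - 2 * x * p.[x]) * expR (- x ^+ 2)))%:E))%E.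
  apply: eq_integral => x _; rewrite -EFinM gauss_weight_cons; congr EFin.
  have [x0|x0] := ltP 0 x; last by rewrite !mul0r mulr0.
  rewrite !mul1r (sg_deriv_abs k t b0 x0) /Q tail_cons tnth_cons0.
  have -> : head_gaps b (cons_tuple x t) = \prod_(i < n) `|x ^+ 2 - tnth t i ^+ 2| ^+ b.
    by apply: eq_bigr => i _; rewrite tnth_cons0 tnth_consS.
  set P := \prod_(i < n) _.
  set S := \sum_(i < n) x ^+ k.+1 * P / _.
  rewrite [\sum_(i < n) _ * (P / _)](_ : _ = w t * S); last first.
    rewrite mulr_sumr; apply: eq_bigr => i _; rewrite tnth_consS.
    by rewrite mulrA [_ * w t]mulrC -!mulrA.
  have E (g e w' kk xk xk1 P' S' bb : R) :
    e * g * (kk * (xk * w' * P') + -2 * (xk1 * w' * P') + 2 * bb * (w' * S')) =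
    g * w' * ((kk * xk * P' - 2 * (xk1 * P') + 2 * bb * S') * e) by ring.
  exact: E.
rewrite integralZl// iE -EFinM; congr EFin.
have -> : `|p.[0]| = (k == 0)%:R * \prod_(i < n) tnth t i ^+ (2 * b).
  rewrite hornerM hornerXn expr0n normrM normr_nat; congr (_ * _).
  rewrite horner_prod normr_prod; apply: eq_bigr => i _.
  rewrite horner_exp !hornerE expr0n sub0r normrX normrN ger0_norm ?sqr_ge0//.
  by rewrite exprM.
have E (g w' d q : R) : g * w' * - (d * q) = g * (- d * (w' * q)) by ring.
exact: E.
Qed.

Lemma gauss_mean_antisym n (j : 'I_n.+1) (h : n.+1.-tuple R -> R) : poly_bounded h ->
  (forall s, h (swap j s) = - h s) -> gauss_mean h = 0.
Proof.
move=> ph hN; have : gauss_mean h = - gauss_mean h; last by lra.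
rewrite -mulN1r -gauss_meanZ// -[LHS](gauss_mean_perm j)//.
by congr gauss_mean; apply/funext => s; rewrite hN mulN1r.
Qed.

Lemma poly_bounded_perm n (sg : {perm 'I_n}) (h : n.-tuple R -> R) :
  poly_bounded h -> poly_bounded (fun s => h (perm_tuple sg s)).
Proof.
move=> [mh [C [M [C0 hC]]]]; split; first exact: (measurableT_comp mh (measurable_perm_tuple _)).
exists C, M; split => // s; apply: le_trans (hC _) _.
rewrite /envelope [X in _ <= _ * X ^+ _](reindex_inj (@perm_inj _ sg)).
by rewrite (eq_bigr (fun i => 1 + tnth s (sg i) ^+ 2))// => i _; rewrite tnth_mktuple.
Qed.

(** In the squared variables these are the monomials that Aomoto's method inserts into the Selberg
    integral. *)
Definition sqr_prod n (A : pred 'I_n) (s : n.-tuple R) : R :=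
  \prod_(i < n | A i) tnth s i ^+ 2.

Lemma poly_bounded_sqr_prod n A : poly_bounded (@sqr_prod n A).
Proof. by apply: poly_bounded_prod => i _; exact/poly_boundedX/poly_bounded_tnth. Qed.

Lemma sqr_prod_perm n A (sg : {perm 'I_n}) (s : n.-tuple R) :
  sqr_prod A (perm_tuple sg s) = sqr_prod (fun i => A ((sg^-1)%g i)) s.
Proof.
rewrite /sqr_prod [RHS](reindex_inj (@perm_inj _ sg)).
apply: eq_big => i; first by rewrite permK.
by rewrite tnth_mktuple.
Qed.

(** In the variables [y_i = s_i^2], and up to the factor [2^(-n)], this is the Laguerre-Selberg
    weight with exponent [(e - 1) / 2] and interaction [|y_i - y_j|^b]. *)
Definition selberg_weight b e n (s : n.-tuple R) : R :=
  \prod_(i < n) tnth s i ^+ e * vandermonde_abs b s.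

Lemma poly_bounded_selberg_weight b e n : poly_bounded (@selberg_weight b e n).
Proof.
apply: poly_boundedM; last exact: poly_bounded_vandermonde_abs.
by apply: poly_bounded_prod => i _; exact/poly_boundedX/poly_bounded_tnth.
Qed.

Lemma selberg_weight_perm b e n (sg : {perm 'I_n}) (s : n.-tuple R) :
  selberg_weight b e (perm_tuple sg s) = selberg_weight b e s.
Proof.
rewrite /selberg_weight vandermonde_abs_perm; congr (_ * _).
rewrite [RHS](reindex_inj (@perm_inj _ sg)).
by apply: eq_bigr => i _; rewrite tnth_mktuple.
Qed.

Definition selberg b e n : R := gauss_mean (@selberg_weight b e n).

Lemma sum_geq (n p : nat) : \sum_(i < n) (p <= i)%:R = (n - p)%:R :> R.
Proof.
elim: n => [|n IH]; first by rewrite big_ord0 sub0n.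
rewrite big_ord_recr/= IH; have [pn|np] := leqP p n.
  by rewrite subSn// -[RHS]natr1.
have /eqP -> : (n - p)%N == 0%N by rewrite subn_eq0 ltnW.
by have /eqP -> : (n.+1 - p)%N == 0%N; rewrite ?subn_eq0// addr0.
Qed.

(* The interaction terms of [aomoto_relation] are antisymmetric under the exchange of the
   first variable with another one, so that they cancel or collapse in pairs. *)
Lemma aomoto_step b e n p : (0 < b)%N -> (p <= n)%N ->
  gauss_mean (fun s : n.+1.-tuple R =>
    sqr_prod (fun i => i < p.+1)%N s * selberg_weight b e s) =
  ((e.+1 + b * (n - p))%:R / 2) * gauss_mean (fun s : n.+1.-tuple R =>
    sqr_prod (fun i => i < p)%N s * selberg_weight b e s).
Proof.
move=> b0 pn.
pose w (t : n.-tuple R) := sqr_prod (fun i => i < p)%N t *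
  (\prod_(i < n) tnth t i ^+ e * vandermonde_abs b t).
have pw : poly_bounded w.
  by apply: poly_boundedM; [exact: poly_bounded_sqr_prod|exact: poly_bounded_selberg_weight].
have := aomoto_relation e.+1 b0 pw; rewrite mul0r oppr0.
pose c (s : n.+1.-tuple R) := sqr_prod (fun i => 0 < i <= p)%N s.
pose D (s : n.+1.-tuple R) := sqr_prod (fun i => i < p.+1)%N s.
have cE s : c s = sqr_prod (fun i => i < p)%N (tail s).
  rewrite /c /sqr_prod big_mkcond big_ord_recl/= mul1r [RHS]big_mkcond.
  by apply: eq_bigr => i _; rewrite tnth_tail.
have DE s : D s = tnth s ord0 ^+ 2 * c s.
  rewrite /c /D /sqr_prod big_mkcond big_ord_recl/=; congr (_ * _).
  by rewrite [RHS]big_mkcond big_ord_recl/= mul1r.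
have SE s : selberg_weight b e s = tnth s ord0 ^+ e *
    (\prod_(i < n) tnth (tail s) i ^+ e * vandermonde_abs b (tail s)) * head_gaps b s.
  rewrite /selberg_weight vandermonde_abs_head big_ord_recl.
  under eq_bigr do rewrite -tnth_tail.
  by rewrite -!mulrA; congr (_ * (_ * _)); rewrite mulrC.
have h1 s : tnth s ord0 ^+ e * w (tail s) * head_gaps b s = c s * selberg_weight b e s.
  by rewrite SE cE /w; ring.
have h2 s : tnth s ord0 ^+ e.+2 * w (tail s) * head_gaps b s = D s * selberg_weight b e s.
  by rewrite DE SE cE /w !exprS; ring.
rewrite /= (funext h1) (funext h2).
set d := fun (i : 'I_n) (s : n.+1.-tuple R) => tnth s ord0 ^+ 2 - tnth s (lift ord0 i) ^+ 2.
have h3 (i : 'I_n) s : tnth s ord0 ^+ e.+2 * w (tail s) * (head_gaps b s / d i s) =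
    D s * selberg_weight b e s / d i s.
  by rewrite mulrA h2.
under eq_bigr => i _ do rewrite (funext (h3 i)).
have pD : poly_bounded (fun s => D s * selberg_weight b e s).
  by apply: poly_boundedM; [exact: poly_bounded_sqr_prod|exact: poly_bounded_selberg_weight].
have pc : poly_bounded (fun s => c s * selberg_weight b e s).
  by apply: poly_boundedM; [exact: poly_bounded_sqr_prod|exact: poly_bounded_selberg_weight].
have pq i : poly_bounded (fun s => D s * selberg_weight b e s / d i s).
  rewrite -(funext (h3 i)); apply: poly_boundedM; last exact: poly_bounded_gap_quotient.
  apply: poly_boundedM; first exact/poly_boundedX/poly_bounded_tnth.
  exact: poly_bounded_tail.
have dN i s : d i (swap (lift ord0 i) s) = - d i s.
  by rewrite /d !tnth_mktuple tpermL tpermR opprB.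
(* For [i < p] both exchanged entries occur in [D], so the integrand is odd under the exchange and
   its mean vanishes. For [p <= i] only the head occurs in [D], and
   [D s - D (swap s) = d i s * c s]: the integrand and its exchanged version add up to
   [c s * selberg_weight b e s], and each of them has half of that mean. *)
have h4 (i : 'I_n) : gauss_mean (fun s => D s * selberg_weight b e s / d i s) =
    (p <= i)%:R * (gauss_mean (fun s => c s * selberg_weight b e s) / 2).
  have [pi|ip] := leqP p i; last first.
    rewrite mul0r; apply: (@gauss_mean_antisym _ (lift ord0 i)) => // s.
    rewrite dN selberg_weight_perm invrN mulrN; congr (- (_ * _ / _)).
    rewrite /D sqr_prod_perm; apply: eq_bigl => k; rewrite tpermV.
    by case: tpermP => [->|->|//]; rewrite /= /bump /= ?add1n ?ltnS ip.
  rewrite mul1r.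
  have cs s : c (swap (lift ord0 i) s) = c s.
    rewrite /c sqr_prod_perm; apply: eq_bigl => k; rewrite tpermV.
    case: tpermP => [->|->|//]; rewrite /= /bump /= ?add1n.
      by rewrite ltnNge pi.
    by rewrite ltnNge pi.
  (* On [d i s = 0] the quotients are 0 by the convention on division; this agrees with the sum
     because the weight vanishes there. *)
  have dS s : d i s = 0 -> selberg_weight b e s = 0.
    move=> d0; have d0' : tnth s ord0 ^+ 2 - tnth s (lift ord0 i) ^+ 2 = 0 := d0.
    have hg0 : head_gaps b s = 0.
      by rewrite /head_gaps (bigD1 i)//= d0' normr0 expr0n (gtn_eqF b0) mul0r.
    by rewrite SE hg0 mulr0.
  have : gauss_mean (fun s => D s * selberg_weight b e s / d i s) +
         gauss_mean (fun s => D (swap (lift ord0 i) s) * selberg_weight b e (swap (lift ord0 i) s)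
            / d i (swap (lift ord0 i) s)) =
         gauss_mean (fun s => c s * selberg_weight b e s).
    rewrite -gauss_meanD//; last exact: (poly_bounded_perm (tperm ord0 (lift ord0 i)) (pq i)).
    congr gauss_mean; apply/funext => s; rewrite dN selberg_weight_perm.
    rewrite !DE cs tnth_mktuple tpermL.
    have [d0|d0] := eqVneq (d i s) 0; first by rewrite dS// !mulr0 !mul0r addr0.
    move: d0 (d0); rewrite {1}/d => d1 d0.
    rewrite invrN /d; field.
    by rewrite d1.
  rewrite (gauss_mean_perm (lift ord0 i) (pq i)); lra.
under eq_bigr => i _ do rewrite h4.
rewrite -mulr_suml sum_geq.
(* [c] carries the entries 1 to [p], the statement the entries 0 to [p - 1]; exchanging 0 and [p]
   identifies the two means. *)
have <- : gauss_mean (fun s => c s * selberg_weight b e s) =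
  gauss_mean (fun s : n.+1.-tuple R => sqr_prod (fun i => i < p)%N s * selberg_weight b e s).
  pose P : 'I_n.+1 := Ordinal (pn : (p < n.+1)%N).
  rewrite -[RHS](gauss_mean_perm P).
    congr gauss_mean; apply/funext => s; rewrite selberg_weight_perm; congr (_ * _).
    rewrite sqr_prod_perm; apply: eq_bigl => k; rewrite tpermV.
    case: tpermP => [->|->|].
    - by rewrite /= ltnn.
    - by rewrite /= leqnn andbT.
    - move=> /eqP k0 /eqP kP; rewrite lt0n leq_eqVlt.
      by rewrite -[(k == 0 :> nat)]/(k == ord0) k0 -[(k == p :> nat)]/(k == P) (negbTE kP).
  by apply: poly_boundedM; [exact: poly_bounded_sqr_prod|exact: poly_bounded_selberg_weight].
set C := gauss_mean _; set E := gauss_mean _.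
rewrite natrD natrM.
lra.
Qed.

End aomoto_relation.

(** * Shifts of the exponent, and Gamma at half-integers *)

Section selberg.
Context {R : realType}.
Local Notation leb := (@lebesgue_measure R).
Local Notation L := (@lebesgue_tuple R).

(** [aomoto_step] inserts the squares one after the other; once every entry carries one, the
    exponent has become [e + 2]. *)
Lemma selberg_shift b e n : (0 < b)%N ->
  selberg b e.+2 n = \prod_(j < n) ((e.+1 + b * j)%:R / 2) * selberg b e n :> R.
Proof.
move=> b0; case: n => [|n].
  rewrite big_ord0 mul1r; congr gauss_mean; apply/funext => s.
  by rewrite /selberg_weight !big_ord0.
have H m : (m <= n.+1)%N ->
  gauss_mean (fun s : n.+1.-tuple R =>
    sqr_prod (fun i => i < m)%N s * selberg_weight b e s) =
  \prod_(p < m) ((e.+1 + b * (n - p))%:R / 2) * selberg b e n.+1.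
  elim: m => [|m IH] mn.
    rewrite big_ord0 mul1r; congr gauss_mean; apply/funext => s.
    by rewrite /sqr_prod big_pred0// mul1r.
  by rewrite aomoto_step// IH ?(ltnW mn)// big_ord_recr/= [RHS]mulrAC mulrC mulrA mulrC mulrA.
have := H n.+1 (leqnn _).
rewrite (reindex_inj rev_ord_inj)/=.
rewrite (eq_bigr (fun j : 'I_n.+1 => (e.+1 + b * j)%:R / 2)) => [|i _]; last first.
  by rewrite subSS subKn// -ltnS.
move=> <-; congr gauss_mean; apply/funext => s.
rewrite /selberg_weight mulrA /sqr_prod; congr (_ * _).
under [X in _ = X * _]eq_bigl => i do rewrite ltn_ord.
by rewrite -big_split/=; apply: eq_bigr => i _; rewrite -exprD.
Qed.

(** The case [k = 0] of [aomoto_relation]. The interaction terms are odd under an exchange and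
    vanish. In the boundary term at 0 the gaps to the head become the powers [t_i^(2 b)], so that
    one variable disappears and the exponent of the others rises from 1 to [2 b + 1]. *)
Lemma selberg_boundary b n : (0 < b)%N ->
  selberg b 1 n.+1 = 2^-1 * selberg b (2 * b).+1 n :> R.
Proof.
move=> b0.
pose w (t : n.-tuple R) := \prod_(i < n) tnth t i ^+ 1 * vandermonde_abs b t.
have pw : poly_bounded w by exact: poly_bounded_selberg_weight.
have := aomoto_relation 0 b0 pw; rewrite mul0r sub0r mul1r.
have SE (s : n.+1.-tuple R) : tnth s ord0 ^+ 1 * w (tail s) * head_gaps b s = selberg_weight b 1 s.
  rewrite /selberg_weight vandermonde_abs_head big_ord_recl /w.
  under [in RHS]eq_bigr do rewrite -tnth_tail.
  by rewrite -!mulrA; congr (_ * (_ * _)); rewrite mulrC.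
rewrite (funext SE) big1 => [|i _]; last first.
  apply: (@gauss_mean_antisym _ _ (lift ord0 i)).
    apply: poly_boundedM; last exact: poly_bounded_gap_quotient.
    apply: poly_boundedM; first exact/poly_boundedX/poly_bounded_tnth.
    exact: poly_bounded_tail.
  have SE' (s : n.+1.-tuple R) y : tnth s ord0 ^+ 1 * w (tail s) * (head_gaps b s / y) =
      selberg_weight b 1 s / y by rewrite mulrA SE.
  move=> s; rewrite !SE' selberg_weight_perm !tnth_mktuple tpermL tpermR.
  by rewrite -[X in _ = - (_ / X)]opprB invrN mulrN opprK.
rewrite mulr0 addr0 => /oppr_inj; rewrite -/(selberg b 1 n.+1) => E.
have -> : selberg b (2 * b).+1 n =
    gauss_mean (fun t : n.-tuple R => w t * \prod_(i < n) tnth t i ^+ (2 * b)).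
  congr gauss_mean; apply/funext => s; rewrite /selberg_weight /w mulrAC; congr (_ * _).
  by rewrite -big_split/=; apply: eq_bigr => i _; rewrite -exprD.
by rewrite -E mulKf.
Qed.

Lemma selberg0 b e : selberg b e 0 = 1 :> R.
Proof.
rewrite /selberg /gauss_mean /Rintegral.
rewrite (_ : \int[_]_s _ = 1)%E//.
transitivity (\int[L 0]_s 1%:E)%E.
  apply: eq_integral => s _; congr EFin.
  rewrite /gauss_weight /selberg_weight /vandermonde_abs !big_ord0 oppr0 expR0 !mulr1.
  by rewrite tuple0.
by rewrite integral_cst//= diracE mem_set// mul1e.
Qed.

Lemma measurable_gt0 : measurable_fun [set: R] (fun x : R => (0 < x)%R%:R : R).
Proof. by apply: measurable_boolR; exact: measurable_fun_ltr. Qed.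

Lemma ge0_integral_sqr (f : R -> R) :
  measurable_fun [set: R] f -> (forall x, 0 <= f x) ->
  (\int[leb]_x ((0 < x)%R%:R * (2 * x) * f (x ^+ 2))%:E =
   \int[leb]_x ((0 < x)%R%:R * f x)%:E)%E.
Proof.
move=> mf f0.
have mpos : measurable_fun [set: R] (fun x : R => 0 < x) by exact: measurable_fun_ltr.
(* As for the inversion, the identity with density 1 is used on [x <= 0]. *)
pose phi (x : R) := if 0 < x then x ^+ 2 else x.
pose g (x : R) := if 0 < x then 2 * x else 1.
have mphi : measurable_fun [set: R] phi by apply: measurable_fun_ifT.
have mg : measurable_fun [set: R] g.
  by apply: measurable_fun_ifT => //; exact: measurable_funM.
have g0 x : 0 <= g x by rewrite /g; case: ifP => // /ltW x0; rewrite mulr_ge0.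
have dsq (x : R) : is_derive x 1 (fun y : R => y ^+ 2) (2 * x).
  by apply: is_derive_eq; rewrite /GRing.scale/= !mulr1 -mulr2n mulr_natl.
have gP (a b : R) : 0 <= a -> a < b -> (\int[leb]_(x in `]a, b]) (g x)%:E = (b ^+ 2 - a ^+ 2)%:E)%E.
  move=> a0 ab.
  rewrite -(continuous_FTC2_everywhere ab dsq); last first.
    by move=> x; apply: cvgM; [exact: cvg_cst|exact: cvg_id].
  rewrite -integral_itv_obnd_cbnd; last first.
    by apply/measurable_EFinP; apply: measurable_funM.
  apply: eq_integral => x; rewrite inE/= in_itv/= => /andP[ax _].
  by rewrite /g (le_lt_trans a0 ax).
have gK (a b : R) : a <= b -> b <= 0 -> (\int[leb]_(x in `]a, b]) (g x)%:E = (b - a)%:E)%E.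
  move=> ab b0.
  transitivity (\int[leb]_(x in `]a, b]) (1%:E))%E.
    apply: eq_integral => x; rewrite inE/= in_itv/= => /andP[_ xb].
    by rewrite /g ltNge (le_trans xb b0).
  rewrite integral_cst//= lebesgue_measure_itv/= lte_fin mul1e.
  by move: ab; rewrite le_eqVlt => /predU1P[->|->]; rewrite ?ltxx ?subrr.
have key := @ge0_change_of_variables R phi g mphi mg g0 _ (fun x => (0 < x)%R%:R * f x).
transitivity (\int[leb]_x (g x * ((0 < phi x)%R%:R * f (phi x)))%:E)%E.
  apply: eq_integral => x _; congr EFin; rewrite /g /phi.
  case: ifPn => [x0|]; last by move/negbTE ->; rewrite !mul0r mulr0.
  by rewrite exprn_gt0// !mul1r.
apply: key => [a b ab||x]; last 2 first.
- by apply: measurable_funM => //; exact: measurable_boolR.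
- by rewrite mulr_ge0.
- 
  have sq (x y : R) : 0 <= x -> 0 <= y -> (x ^+ 2 <= y) = (x <= Num.sqrt y).
    by move=> x0 y0; rewrite -[in LHS](sqr_sqrtr y0) ler_sqr ?nnegrE ?sqrtr_ge0.
  have sq' (x y : R) : 0 <= x -> 0 <= y -> (y < x ^+ 2) = (Num.sqrt y < x).
    by move=> x0 y0; rewrite ltNge sq// -ltNge.
  have [b0|b0] := leP b 0.
    rewrite -(gK a b (ltW ab) b0); congr integral.
    apply/seteqP; split => x; rewrite /= !in_itv/= /phi; case: ifPn => x0 //.
      by move=> /andP[_]; rewrite leNgt (le_lt_trans b0)// exprn_gt0.
    by move=> /andP[_ xb]; move: x0; rewrite ltNge (le_trans xb b0).
  have [a0|a0] := leP 0 a.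
    transitivity (\int[leb]_(x in `](Num.sqrt a), (Num.sqrt b)]) (g x)%:E)%E; last first.
      by rewrite gP ?sqrtr_ge0 ?ltr_sqrt// !sqr_sqrtr// ltW.
    congr integral.
    apply/seteqP; split => x; rewrite /= !in_itv/= /phi; case: ifPn => x0.
    - by rewrite sq ?(ltW x0) ?(ltW b0)// sq' ?(ltW x0).
    - by move=> /andP[ax _]; rewrite (le_lt_trans a0 ax) in x0.
    - by rewrite sq ?(ltW x0) ?(ltW b0)// sq' ?(ltW x0).
    - by move=> /andP[h _]; rewrite (le_lt_trans _ h) ?sqrtr_ge0 in x0.
  rewrite (_ : _ @^-1` _ = `]a, 0%R] `|` `]0%R, Num.sqrt b]); last first.
    apply/seteqP; split => x; rewrite /= !in_itv/= /phi; case: ifPn => x0.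
    - by rewrite sq ?(ltW x0) ?(ltW b0)// => /andP[_ ->]; right.
    - by move=> /andP[-> _]; left; rewrite leNgt.
    - move=> [/andP[_]|/andP[_ h]]; first by rewrite leNgt x0.
      by rewrite sq ?(ltW x0) ?(ltW b0)// h (lt_trans a0)// exprn_gt0.
    - by move=> [/andP[-> x0']|//]; rewrite (le_trans x0')// ltW.
  rewrite ge0_integral_setU//=; last 3 first.
  - by apply/measurable_EFinP; apply: measurable_funTS.
  - by move=> x _; rewrite lee_fin.
  - apply/disj_setPS => x [] /=; rewrite !in_itv/= => /andP[_ xb] /andP[bx _].
    by move: bx; rewrite ltNge xb.
  rewrite (gK a 0 (ltW a0) (lexx 0)) (gP 0 _ (lexx 0)) ?sqrtr_gt0// -EFinD sqr_sqrtr ?(ltW b0)//.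
  by rewrite expr0n subr0 sub0r addrC.
Qed.

Lemma gauss_selberg_ge0 b e n (s : n.-tuple R) : 0 <= gauss_weight s * selberg_weight b e s.
Proof.
rewrite /gauss_weight; case: positiveP => [s0|_]; last by rewrite !mul0r.
rewrite !mulr_ge0 ?expR_ge0 ?vandermonde_abs_ge0//.
by apply: prodr_ge0 => i _; rewrite exprn_ge0 ?ltW.
Qed.

Lemma selberg1E b e :
  ((selberg b e 1 : R)%:E = \int[leb]_x ((0 < x)%R%:R * (x ^+ e * expR (- x ^+ 2)))%:E)%E.
Proof.
have mE : measurable_fun [set: 1.-tuple R] (fun s : 1.-tuple R => (gauss_weight s * selberg_weight b e s)%:E).
  apply/measurable_EFinP; apply: measurable_funM; first exact: measurable_gauss_weight.
  by have [] := @poly_bounded_selberg_weight R b e 1.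
have : (\int[L 1]_s (gauss_weight s * selberg_weight b e s)%:E =
   \int[leb]_x ((0 < x)%R%:R * (x ^+ e * expR (- x ^+ 2)))%:E)%E.
  rewrite (ge0_integral_tupleS mE).
    apply: eq_integral => x _.
    transitivity (\int[L 0]_t ((0 < x)%R%:R * (x ^+ e * expR (- x ^+ 2)))%:E)%E.
      apply: eq_integral => t _; congr EFin.
      rewrite gauss_weight_cons /selberg_weight vandermonde_abs_cons big_ord0 mul1r.
      rewrite big_ord_recl big_ord0 tnth_cons0 mulr1.
      rewrite /vandermonde_abs big_ord0 mulr1 /gauss_weight big_ord0 oppr0 expR0 mulr1.
      by rewrite tuple0/= mulr1 -mulrA [expR _ * _]mulrC.
    by rewrite integral_cst//= diracE mem_set// mule1.
  by move=> s; rewrite lee_fin; exact: gauss_selberg_ge0.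
by rewrite gauss_meanE; last exact: poly_bounded_selberg_weight.
Qed.

(* The substitution [x = s ^+ 2] turns [Gamma (k / 2)] into a Gaussian moment. *)
Lemma Gamma_half b k : (0 < k)%N -> Gamma (k%:R / 2) = 2 * selberg b k.-1 1 :> R.
Proof.
move=> k0.
rewrite /Gamma /selberg /gauss_mean.
pose f (x : R) : R := x `^ (k%:R / 2 - 1) * expR (- x).
have mf : measurable_fun [set: R] f.
  apply: measurable_funM; first exact: measurable_powR.
  by apply: measurableT_comp => //; exact: measurableT_comp.
have f0 x : 0 <= f x by rewrite mulr_ge0 ?powR_ge0 ?expR_ge0.
have := ge0_integral_sqr mf f0.
set I1 := (X in X = _ -> _); set I2 := (X in _ = X -> _).
have -> : \int[leb]_(x in `]0, +oo[) (x `^ (k%:R / 2 - 1) * expR (- x)) = fine I2.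
  rewrite /Rintegral integral_mkcond; congr fine; apply: eq_integral => x _.
  rewrite patchE mem_setE/= in_itv/= andbT.
  by case: ltP => _; rewrite ?mul1r ?mul0r.
move=> <-.
have E := selberg1E b k.-1.
transitivity (fine (2%:E * (selberg b k.-1 1 : R)%:E)%E); last by rewrite -EFinM.
congr fine; rewrite E -ge0_integralZl_EFin//.
- apply: eq_integral => x _; rewrite -EFinM; congr EFin.
  have [x0|x0] := ltP 0 x; last by rewrite !mul0r mulr0.
  rewrite !mul1r /f -mulrA; congr (2 * _); rewrite mulrA; congr (_ * _).
  have xk : x ^+ k = x ^+ k.-1 * x by rewrite -exprSr prednK.
  have x2 : x ^+ 2 != 0 by rewrite expf_neq0// gt_eqF.
  have p1 : (x ^+ 2) `^ 1 = x ^+ 2 := powRr1 (sqr_ge0 x).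
  rewrite powRB ?x2 ?implybT// p1.
  have -> : (x ^+ 2) `^ (k%:R / 2) = x ^+ k.
    rewrite -[x ^+ 2]powR_mulrn ?(ltW x0)// -powRrM mulrC divfK// powR_mulrn//.
    exact: ltW.
  rewrite xk expr2; have E2 (y z : R) : z != 0 -> z * (y * z / (z * z)) = y by move=> ?; field.
  by apply: E2; rewrite gt_eqF.
- move=> x _; rewrite lee_fin; case: (ltP 0 x) => x0; last by rewrite mul0r.
  by rewrite mul1r mulr_ge0 ?expR_ge0 ?exprn_ge0 ?(ltW x0).
- apply/measurable_EFinP; apply: measurable_funM; first exact: measurable_gt0.
  apply: measurable_funM => //.
  by apply: measurableT_comp => //; exact: measurableT_comp.
Qed.

Lemma Gamma_half_gt0 k : (0 < k)%N -> 0 < Gamma (k%:R / 2) :> R.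
Proof.
(* With a single variable there are no gaps, so that [b] is a dummy parameter. The shift reduces
   positivity to the exponents 0 and 1. *)
have rec b e : selberg b.+1 e.+2 1 = e.+1%:R / 2 * selberg b.+1 e 1 :> R.
  by rewrite selberg_shift// big_ord_recl big_ord0 mulr1 muln0 addn0.
have s0 : 0 < selberg 1 0 1 :> R.
  rewrite -lte_fin selberg1E.
  apply: (@lt_le_trans _ _ (\int[leb]_(x in `]0%R, 1%R]) (expR (-1))%:E)%E).
    by rewrite integral_cst//= lebesgue_measure_itv/= lte_fin ltr01 sube0 mule1 lte_fin expR_gt0.
  rewrite integral_mkcond; apply: ge0_le_integral => //.
  - by move=> x _; rewrite patchE; case: ifP => // _; rewrite lee_fin expR_ge0.
  - by apply/(measurable_restrictT _ _).1.
  - apply/measurable_EFinP; apply: measurable_funM; first exact: measurable_gt0.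
    apply: measurable_funM => //.
    by apply: measurableT_comp => //; exact: measurableT_comp.
  - move=> x _; rewrite patchE mem_setE/= in_itv/=.
    case: (ltP 0 x) => x0 /=; last by rewrite mul0r.
    case: ifP => x1; last by rewrite /point/= lee_fin !mulr_ge0 ?expR_ge0.
    by rewrite mul1r expr0 mul1r lee_fin ler_expR lerN2 expr_le1// ltW.
have s1 : 0 < selberg 1 1 1 :> R by rewrite selberg_boundary// selberg0 mulr1 invr_gt0.
move=> k0; rewrite (Gamma_half 1)// mulr_gt0//.
elim/ltn_ind: k.-1 => -[//|[//|e]] IH.
by rewrite rec mulr_gt0 ?divr_gt0 ?ltr0n// IH.
Qed.

(** The functional equation of Gamma is the shift of the exponent in one variable. *)
Lemma Gamma_halfSS k : (0 < k)%N -> Gamma (k.+2%:R / 2) = k%:R / 2 * Gamma (k%:R / 2) :> R.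
Proof.
move=> k0; rewrite !(Gamma_half 1)//= mulrCA; congr (_ * _).
case: k k0 => // k _.
by rewrite selberg_shift// big_ord_recl big_ord0 mulr1 muln0 addn0.
Qed.

Lemma Gamma_1 : Gamma (2%:R / 2) = 1 :> R.
Proof. by rewrite (Gamma_half 1)//= selberg_boundary// selberg0 mulr1 divff. Qed.

End selberg.

(** * The closed form of the Laguerre-Selberg integral *)

Section selberg_closed_form.
Context {R : realType}.
Local Notation G k := (Gamma (k%:R / 2) : R).

(** [i] shifts lead from the exponent 1 to [2 i + 1], and for each [j] their factors telescope to a
    quotient of two Gamma values. *)
Lemma selberg_iter b i n : (0 < b)%N ->
  selberg b (2 * i).+1 n =
  \prod_(j < n) (G (2 * i.+1 + b * j)%N / G (2 + b * j)%N) * selberg b 1 n :> R.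
Proof.
move=> b0; elim: i => [|i IH].
  rewrite big1 ?mul1r// => j _; rewrite divff// gt_eqF// Gamma_half_gt0//.
have -> : (2 * i.+1).+1 = (2 * i).+3 by rewrite mulnS.
rewrite (selberg_shift (2 * i).+1 n b0) IH mulrA; congr (_ * _).
rewrite -big_split; apply: eq_bigr => j _; rewrite [LHS]/=.
have -> : (2 * i.+2 + b * j = (2 * i.+1 + b * j).+2)%N by rewrite mulnS -addnA add2n.
rewrite Gamma_halfSS ?addn_gt0 ?mulnS//.
by rewrite mulrA; congr (_%:R / _ * _ / _); rewrite mulnS.
Qed.

Lemma prod_shift (f : nat -> R) n :
  (\prod_(j < n) f j.+2) * f 1%N = (\prod_(j < n) f j.+1) * f n.+1.
Proof. by rewrite -[RHS](big_ord_recr _ (fun j => f j.+1)) big_ord_recl mulrC. Qed.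

(** From [2 b - 1] down to 1 by [b - 1] shifts, then to [n] variables by [selberg_boundary], which
    yields the exponent [2 b + 1], and down once more to [2 b - 1]. *)
Lemma selberg_rec b n : (0 < b)%N ->
  selberg b (2 * b).-1 n.+1 =
  n.+1%:R / 2 * (G (b * n.+1)%N * G (b * n.+2)%N / G b) * selberg b (2 * b).-1 n :> R.
Proof.
move=> b0; have Gn0 k : (0 < k)%N -> G k != 0 by move=> k0; rewrite gt_eqF// Gamma_half_gt0.
have b1E : (2 * b).-1 = (2 * b.-1).+1 by case: b b0 => // b _; rewrite mulnS.
rewrite b1E (selberg_iter b.-1 n.+1 b0) prednK// selberg_boundary//.
have -> : selberg b (2 * b).+1 n = \prod_(j < n) ((b * j.+2)%:R / 2) * selberg b (2 * b.-1).+1 n :> R.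
  rewrite -b1E; have -> : (2 * b).+1 = (2 * b).-1.+2 by rewrite prednK ?muln_gt0 ?b0.
  rewrite selberg_shift//; congr (_ * _); apply: eq_bigr => j _; congr (_%:R / _).
  by rewrite prednK ?muln_gt0 ?b0// mulnC -mulnDr.
rewrite !mulrA; congr (_ * _).
pose c (j : nat) : R := (b * j)%:R / 2.
pose g (j : nat) : R := G (b * j)%N.
have c0 j : c j.+1 != 0.
  by rewrite /c mulf_neq0// pnatr_eq0 -lt0n muln_gt0 b0.
have g0 j : g j.+1 != 0 by apply: Gn0; rewrite muln_gt0 b0.
have -> : \prod_(j < n.+1) (G (2 * b + b * j)%N / G (2 + b * j)%N) =
    (\prod_(j < n) g j.+2) * g n.+2 / ((\prod_(j < n) c j.+1) * (\prod_(j < n) g j.+1)).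
  rewrite big_split/= prodfV; congr (_ / _).
    rewrite [LHS]big_ord_recr; congr (_ * _); last by rewrite /g mulnC -mulnDr.
    by apply: eq_bigr => j _; rewrite /g mulnC -mulnDr.
  (* The factor [j = 0] is [Gamma(1) = 1]; for [j > 0] the functional equation splits off the
     rational factor [c j]. *)
  rewrite big_ord_recl/= muln0 addn0 Gamma_1 mul1r -big_split/=.
  by apply: eq_bigr => j _; rewrite /bump add1n add2n Gamma_halfSS// muln_gt0 b0.
rewrite -/(c _).
have -> : \prod_(j < n) ((b * j.+2)%:R / 2) = \prod_(j < n) c j.+2 by [].
have hc := prod_shift c n; have hg := prod_shift g n.
have pc0 : \prod_(j < n) c j.+1 != 0 by apply/prodf_neq0 => j _.
have pg0 : \prod_(j < n) g j.+1 != 0 by apply/prodf_neq0 => j _.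
have -> : \prod_(j < n) c j.+2 = (\prod_(j < n) c j.+1) * c n.+1 / c 1%N.
  by rewrite -hc mulfK.
have -> : \prod_(j < n) g j.+2 = (\prod_(j < n) g j.+1) * g n.+1 / g 1%N.
  by rewrite -hg mulfK.
rewrite -[_ * c n.+1 / c 1%N]mulrA.
(* This telescoped quotient is the origin of the factorial in the closed form. *)
have -> : c n.+1 / c 1%N = n.+1%:R.
  rewrite /c muln1 natrM mulrC.
  have E (x y : R) : x != 0 -> (x / 2)^-1 * (x * y / 2) = y by move=> ?; field.
  by apply: E; rewrite pnatr_eq0 -lt0n.
move: pc0 pg0 (g0 0%N) (g0 n) (g0 n.+1); rewrite /g muln1.
move: (\prod_(j < n) c j.+1) (\prod_(j < n) G (b * j.+1)) => C P.
move: (G b) (G (b * n.+1)%N) (G (b * n.+2)%N) (n.+1%:R : R) => x y z m C0 P0 x0 y0 z0.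
by field; rewrite C0 P0 x0.
Qed.

(** With [n = N - 1] variables left after the elimination, the product up to [n + 1] is the one of
    [C_hat]. *)
Lemma selberg_closed b n : (0 < b)%N ->
  selberg b (2 * b).-1 n = n`!%:R / 2 ^+ n / G (b * n.+1)%N *
    \prod_(1 <= j < n.+2) (G (b * j)%N ^+ 2 / G b) :> R.
Proof.
move=> b0; have Gn0 k : (0 < k)%N -> G k != 0 by move=> k0; rewrite gt_eqF// Gamma_half_gt0.
elim: n => [|n IH].
  rewrite selberg0 fact0 expr0 big_nat1 muln1; move: (G b) (Gn0 b b0) => x x0.
  by field.
rewrite selberg_rec// IH [in RHS]big_nat_recr//= factS [(n.+1 * _)%:R]natrM exprS.
have := Gn0 b b0; have := Gn0 (b * n.+1)%N; have := Gn0 (b * n.+2)%N.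
rewrite !muln_gt0 b0/= => /(_ erefl) + /(_ erefl).
move: (G b) (G (b * n.+1)%N) (G (b * n.+2)%N) (n`!%:R : R) (n.+1%:R : R) => x y z f m.
move: (\prod_(1 <= j < n.+2) _) => P z0 y0 x0.
have : (2 : R) ^+ n != 0 by rewrite expf_neq0.
move: (2 ^+ n) => t t0.
by field; rewrite x0 y0 z0 t0.
Qed.

End selberg_closed_form.

(** * Eliminating the smallest singular value *)

Section symmetrization.
Context {R : realType}.
Local Notation L := (@lebesgue_tuple R).
Local Notation swap j := (perm_tuple (tperm ord0 j)).

Definition in_ball (r : R) n (c : n.-tuple R) : bool :=
  \sum_(i < n) tnth c i ^+ 2 <= r ^+ 2.

Lemma measurable_in_ball r n : measurable_fun [set: n.-tuple R] (@in_ball r n).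
Proof.
apply: measurable_fun_ler => //; apply: measurable_sum => i.
apply: measurable_funX; exact: measurable_tnth.
Qed.

Lemma in_ball_perm r n (sg : {perm 'I_n}) (c : n.-tuple R) :
  in_ball r (perm_tuple sg c) = in_ball r c.
Proof.
rewrite /in_ball [X in _ = (X <= _)](reindex_inj (@perm_inj _ sg)).
by congr (_ <= _); apply: eq_bigr => i _; rewrite tnth_mktuple.
Qed.

(** Encoded through [positive], from which it inherits measurability; the entry 1 takes the place of
    the comparison of [i] with itself. *)
Definition strict_min n (i : 'I_n) (c : n.-tuple R) : bool :=
  positive [tuple (if j == i then 1 else tnth c j - tnth c i) | j < n].

Lemma strict_minP n (i : 'I_n) (c : n.-tuple R) :
  reflect (forall j, j != i -> tnth c i < tnth c j) (strict_min i c).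
Proof.
apply: (iffP (positiveP _)) => H j.
  by move=> /negbTE ji; have := H j; rewrite tnth_mktuple ji subr_gt0.
by rewrite tnth_mktuple; have [//|ji] := eqVneq j i; rewrite subr_gt0 H.
Qed.

Lemma measurable_strict_min n (i : 'I_n) : measurable_fun [set: n.-tuple R] (strict_min i).
Proof.
apply: (measurableT_comp (@measurable_positive R n)).
apply/measurable_fun_tnthP => j.
rewrite (_ : _ \o _ = fun c => if j == i then 1 else tnth c j - tnth c i); last first.
  by apply/funext => c /=; rewrite tnth_mktuple.
have [_|_] := eqVneq j i; first exact: measurable_cst.
by apply: measurable_funB; exact: measurable_tnth.
Qed.

Lemma strict_min_perm n (sg : {perm 'I_n}) i (c : n.-tuple R) :
  strict_min i (perm_tuple sg c) = strict_min (sg i) c.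
Proof.
apply/strict_minP/strict_minP => H j ji; last first.
  by rewrite !tnth_mktuple H// (inj_eq perm_inj).
have := H ((sg^-1)%g j); rewrite !tnth_mktuple permKV; apply.
by apply: contraNneq ji => <-; rewrite permKV.
Qed.

Definition min_part b r n (i : 'I_n) (c : n.-tuple R) : R :=
  vandermonde_abs b c * (in_ball r c)%:R * (strict_min i c)%:R.

Lemma min_part_ge0 b r n (i : 'I_n) (c : n.-tuple R) : 0 <= min_part b r i c.
Proof. by rewrite !mulr_ge0 ?vandermonde_abs_ge0. Qed.

Lemma measurable_vandermonde_abs b n : measurable_fun [set: n.-tuple R] (@vandermonde_abs R b n).
Proof. by have [] := @poly_bounded_vandermonde_abs R b n. Qed.

Lemma measurable_min_part b r n (i : 'I_n) : measurable_fun [set: n.-tuple R] (min_part b r i).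
Proof.
apply: measurable_funM; first apply: measurable_funM.
- exact: measurable_vandermonde_abs.
- exact: (@measurable_boolR R _ _ _ (@measurable_in_ball r n)).
- exact: (@measurable_boolR R _ _ _ (@measurable_strict_min n i)).
Qed.

Lemma min_part_perm b r n (sg : {perm 'I_n}) i (c : n.-tuple R) :
  min_part b r i (perm_tuple sg c) = min_part b r (sg i) c.
Proof. by rewrite /min_part vandermonde_abs_perm in_ball_perm strict_min_perm. Qed.

(* Ties do not matter, because the Vandermonde factor vanishes there. *)
Lemma sum_min_part b r n (c : n.+1.-tuple R) : (0 < b)%N -> positive c ->
  \sum_(i < n.+1) min_part b r i c = vandermonde_abs b c * (in_ball r c)%:R.
Proof.
move=> b0 c0; rewrite /min_part -mulr_sumr.
have [V0|V0] := eqVneq (vandermonde_abs b c) 0; first by rewrite V0 !mul0r.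
have cI (j k : 'I_n.+1) : tnth c j = tnth c k -> j = k.
  move=> ejk; apply/eqP; apply: contra_neqT V0 => jk.
  wlog ltjk : j k ejk jk / (j < k)%N.
    move=> W; have := jk; rewrite -val_eqE neq_ltn => /orP[|] h; first exact: (W j k).
    by apply: (W k j) => //; rewrite eq_sym.
  rewrite /vandermonde_abs (bigD1 j)//= (bigD1 k)//= ejk subrr normr0 expr0n (gtn_eqF b0).
  by rewrite !mul0r.
rewrite [X in _ * X](_ : _ = 1) ?mulr1//.
have [i _ iP] := Order.TotalTheory.arg_minP (P := xpredT) (i0 := ord0) (fun j => tnth c j) isT.
have mi : strict_min i c.
  by apply/strict_minP => j ji; rewrite lt_neqAle iP// andbT; apply: contra_neq ji => /cI.
rewrite (bigD1 i)//= mi big1 ?addr0// => j ji.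
case: strict_minP => // H; have := H i; rewrite eq_sym => /(_ ji).
by rewrite ltNge iP.
Qed.

(* The entry determined by the constraint on the product comes first. *)
Definition full n (s : n.-tuple R) : n.+1.-tuple R := cons_tuple (\prod_(x <- s) x)^-1 s.

Lemma measurable_full n : measurable_fun [set: n.-tuple R] (@full n).
Proof.
apply: measurable_cons => //; apply: measurable_funV; exact: measurable_prod_tuple.
Qed.

Lemma prod_perm_tuple n (sg : {perm 'I_n}) (s : n.-tuple R) :
  \prod_(x <- perm_tuple sg s) x = \prod_(x <- s) x.
Proof.
rewrite !big_tuple [RHS](reindex_inj (@perm_inj _ sg)).
by apply: eq_bigr => i _; rewrite tnth_mktuple.
Qed.

Lemma positive_prod n (s : n.-tuple R) : positive s -> 0 < \prod_(x <- s) x.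
Proof. by move=> /positiveP H; rewrite big_tuple; apply: prodr_gt0 => i _. Qed.

Lemma positive_full n (s : n.-tuple R) : positive s -> positive (full s).
Proof. by move=> s0; rewrite /positive/= invr_gt0 positive_prod. Qed.

(** The product, and with it the dependent entry, is unchanged; the other indices move up by one in
    [full], hence the lifts. *)
Lemma full_swap n (k : 'I_n.+1) (s : n.+1.-tuple R) :
  full (swap k s) = perm_tuple (tperm (lift ord0 ord0) (lift ord0 k)) (full s).
Proof.
apply: eq_from_tnth => i; rewrite tnth_mktuple.
case: (unliftP ord0 i) => [j|] ->.
  rewrite /full tnth_consS tnth_mktuple.
  case: (tpermP ord0 k j) => [->|->|/eqP j0 /eqP jk].
  - by rewrite tpermL tnth_consS.
  - by rewrite tpermR tnth_consS.
  - by rewrite tpermD ?tnth_consS// ?(inj_eq lift_inj) eq_sym.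
by rewrite /full tpermD// !tnth_cons0 prod_perm_tuple.
Qed.

Lemma full_invert_head n (s : n.+1.-tuple R) : positive s ->
  full (invert_head s) = perm_tuple (tperm ord0 (lift ord0 ord0)) (full s).
Proof.
case/tupleP: s => x t pxt.
have := pxt; rewrite /positive/= -[all _ _]/(positive t) => /andP[x0 t0].
have p0 := positive_prod t0.
apply: eq_from_tnth => i; rewrite tnth_mktuple.
case: (unliftP ord0 i) => [j|] ->.
  case: (unliftP ord0 j) => [k|] ->.
    rewrite tpermD// /full /invert_head !tnth_consS.
    by congr tnth; exact: val_inj.
  by rewrite tpermR /full tnth_cons0 tnth_consS tnth_cons0.
rewrite tpermL /full tnth_cons0 tnth_consS tnth_cons0.
rewrite !big_cons/=.
have E (P y : R) : P != 0 -> y != 0 -> ((y * P)^-1 * P)^-1 = y.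
  by move=> ? ?; field; apply/andP.
by apply: E; rewrite gt_eqF.
Qed.

Definition sl_density b r n (s : n.-tuple R) : R :=
  (positive s)%:R * (\prod_(x <- s) x)^-1 * (vandermonde_abs b (full s) * (in_ball r (full s))%:R).

(** Index 0 stands for the dependent entry, so that [min_density b r ord0] is the part where the
    eliminated singular value is the smallest. *)
Definition min_density b r n (i : 'I_n.+1) (s : n.-tuple R) : R :=
  (positive s)%:R * (\prod_(x <- s) x)^-1 * min_part b r i (full s).

Lemma min_density_ge0 b r n i (s : n.-tuple R) : 0 <= min_density b r i s.
Proof.
rewrite /min_density; have [s0|] := boolP (positive s); last by rewrite !mul0r.
by rewrite mul1r mulr_ge0 ?min_part_ge0// invr_ge0 ltW// positive_prod.
Qed.

Lemma measurable_positive_prodV n :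
  measurable_fun [set: n.-tuple R] (fun s => (positive s)%:R * (\prod_(x <- s) x)^-1 : R).
Proof.
apply: measurable_funM; first exact: (@measurable_boolR R _ _ _ (@measurable_positive R n)).
apply: measurable_funV; exact: measurable_prod_tuple.
Qed.

Lemma measurable_min_density b r n i : measurable_fun [set: n.-tuple R] (@min_density b r n i).
Proof.
apply: measurable_funM; first exact: measurable_positive_prodV.
exact: measurableT_comp (@measurable_min_part b r n.+1 i) (@measurable_full n).
Qed.

(** An exchange of independent entries carries an index [i > 0] to 1, and the inversion of the head
    carries 1 to 0. *)
Lemma integral_min_density b r n (i : 'I_n.+2) :
  (\int[L n.+1]_s (min_density b r i s)%:E = \int[L n.+1]_s (min_density b r ord0 s)%:E)%E.
Proof.
case: (unliftP ord0 i) => [k|] -> //.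
pose one : 'I_n.+2 := lift ord0 ord0.
have mE j := (measurable_EFinP _ _).2 (@measurable_min_density b r n.+1 j).
have E0 j s : (0 <= (min_density b r (n:=n.+1) j s)%:E)%E by rewrite lee_fin min_density_ge0.
transitivity (\int[L n.+1]_s (min_density b r one s)%:E)%E.
  rewrite -[LHS](ge0_integral_tperm k (mE _) (E0 _)).
  apply: eq_integral => s _; congr EFin; rewrite /comp /min_density prod_perm_tuple.
  rewrite positive_perm; last exact: perm_inj.
  by rewrite full_swap min_part_perm tpermR.
(* Splitting off the product of the tail leaves the weight [1 / x] in the head, which the inversion
   preserves. The absolute value makes [F] nonnegative on all tuples, as [ge0_integral_invert_head]
   demands. *)
pose F j (s : n.+1.-tuple R) := `|\prod_(x <- tail s) x|^-1 * min_part b r j (full s).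
have FE j s : min_density b r j s = (positive s)%:R * (thead s)^-1 * F j s.
  rewrite /F /min_density; case/tupleP: s => x t; rewrite theadE tail_cons.
  have [|] := boolP (positive _); last by rewrite !mul0r.
  rewrite /positive/= -[all _ _]/(positive t) => /andP[x0 t0].
  by rewrite (gtr0_norm (positive_prod t0)) big_cons invfM !mulrA.
have mF j : measurable_fun [set: n.+1.-tuple R] (F j).
  apply: measurable_funM; last exact: measurableT_comp (@measurable_min_part b r n.+2 j) (@measurable_full n.+1).
  apply: measurable_funV; apply: measurableT_comp => //.
  exact: measurableT_comp (@measurable_prod_tuple R n) (@measurable_tail R n).
have F0 j s : 0 <= F j s by rewrite mulr_ge0 ?min_part_ge0// invr_ge0.
under eq_integral => s _ do rewrite FE.
rewrite -(ge0_integral_invert_head (mF _) (F0 _)).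
apply: eq_integral => s _; congr EFin; rewrite FE.
have [s0|] := boolP (positive s); last by rewrite !mul0r.
congr (_ * _); rewrite /F full_invert_head// min_part_perm tpermR.
by rewrite /invert_head tail_cons.
Qed.

Lemma integral_sl_density b r n : (0 < b)%N ->
  (\int[L n.+1]_s (sl_density b r s)%:E =
   n.+2%:R%:E * \int[L n.+1]_s (min_density b r ord0 s)%:E)%E.
Proof.
move=> b0.
transitivity (\int[L n.+1]_s \sum_(i < n.+2) (min_density b r i s)%:E)%E.
  apply: eq_integral => s _; rewrite sumEFin; congr EFin; rewrite -mulr_sumr.
  rewrite /sl_density; have [s0|] := boolP (positive s); last by rewrite !mul0r.
  by rewrite sum_min_part// positive_full.
rewrite ge0_integral_sum//; last 2 first.
- by move=> i; apply/measurable_EFinP; exact: measurable_min_density.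
- by move=> i s _; rewrite lee_fin min_density_ge0.
under eq_bigr do rewrite integral_min_density.
elim: n.+2 => [|k IH]; first by rewrite big_ord0 mul0e.
by rewrite big_ord_recr IH -natr1 EFinD ge0_muleDl ?lee_fin// mul1e.
Qed.

End symmetrization.

(** * Error bounds *)

Section slices.
Context {R : realType}.
Local Notation leb := (@lebesgue_measure R).
Local Notation L := (@lebesgue_tuple R).

Lemma in_ball_le r n (s : n.-tuple R) : 0 <= r -> positive s -> in_ball r s ->
  forall i, 0 < tnth s i <= r.
Proof.
move=> r0 /positiveP s0; rewrite /in_ball => sr i; rewrite s0/=.
have : tnth s i ^+ 2 <= r ^+ 2.
  apply: le_trans sr; rewrite (bigD1 i)//= lerDl.
  by apply: sumr_ge0 => j _; rewrite sqr_ge0.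
by rewrite ler_sqr ?nnegrE// ltW.
Qed.

(** The head is a separate argument of [phi] because it is the one variable over which the errors
    are integrated. *)
Definition ball_part r n (phi : R -> n.-tuple R -> R) (s : n.+1.-tuple R) : R :=
  (positive s)%:R * (in_ball r s)%:R * phi (thead s) (tail s).

Lemma measurable_ball_part r n (phi : R -> n.-tuple R -> R) :
  measurable_fun [set: n.+1.-tuple R] (fun s => phi (thead s) (tail s)) ->
  measurable_fun [set: n.+1.-tuple R] (ball_part r phi).
Proof.
move=> mphi; apply: measurable_funM => //; apply: measurable_funM.
- exact: (@measurable_boolR R _ _ _ (@measurable_positive R n.+1)).
- exact: (@measurable_boolR R _ _ _ (@measurable_in_ball R r n.+1)).
Qed.

Lemma positive_cons n x (t : n.-tuple R) :
  positive (cons_tuple x t) = (0 < x) && positive t.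
Proof. by []. Qed.

Lemma ball_part_ge0 r n (phi : R -> n.-tuple R -> R) s :
  (forall x t, 0 < x -> positive t -> 0 <= phi x t) -> 0 <= ball_part r phi s.
Proof.
move=> phi0; rewrite /ball_part; case/tupleP: s => x t; rewrite theadE tail_cons.
have [|] := boolP (positive (cons_tuple x t)); last by rewrite !mul0r.
by rewrite positive_cons => /andP[x0 t0]; rewrite mul1r mulr_ge0// phi0.
Qed.

Lemma integral_ball_part_le r n (phi : R -> n.-tuple R -> R) B :
  measurable_fun [set: n.+1.-tuple R] (fun s => phi (thead s) (tail s)) ->
  (forall x t, 0 < x -> positive t -> 0 <= phi x t) -> 0 <= B -> 0 <= r ->
  (forall t : n.-tuple R, (forall i, 0 < tnth t i <= r) ->
     (\int[leb]_x ((0 < x)%R%:R * phi x t)%:E <= B%:E)%E) ->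
  (\int[L n.+1]_s (ball_part r phi s)%:E <= (B * r ^+ n)%:E)%E.
Proof.
move=> mphi phi0 B0 r0 H.
have mx (t : n.-tuple R) (f : n.+1.-tuple R -> R) : measurable_fun [set: n.+1.-tuple R] f ->
    measurable_fun [set: R] (fun x => f (cons_tuple x t)).
  move=> mf.
  exact: (measurableT_comp mf (measurableT_comp (@measurable_cons_pair R n) (pair2_measurable t))).
apply: integral_slice_le => //.
- exact: measurable_ball_part.
- by move=> s; exact: ball_part_ge0.
- move=> s; rewrite /ball_part => s0; apply: in_ball_le => //.
    by apply: contraNT s0 => /negbTE ->; rewrite !mul0r.
  by apply: contraNT s0 => /negbTE ->; rewrite mulr0 mul0r.
- move=> t tr; apply: le_trans (H t tr).
  have t0 : positive t by apply/positiveP => i; have /andP[] := tr i.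
  apply: ge0_le_integral => //.
  + by move=> x _; rewrite lee_fin; exact: ball_part_ge0.
  + apply/measurable_EFinP; exact: (mx t _ (measurable_ball_part r mphi)).
  + apply/measurable_EFinP; apply: measurable_funM; first exact: measurable_gt0.
    have := mx t _ mphi; apply: eq_measurable_fun => x _.
    by rewrite theadE tail_cons.
  + move=> x _; rewrite lee_fin /ball_part theadE tail_cons positive_cons t0 andbT.
    have [x0|_] := ltP 0 x; last by rewrite !mul0r.
    by rewrite !mul1r ler_piMl ?phi0//; case: in_ball.
Qed.

Lemma integral_gt0_sqr_le (f : R -> R) B :
  measurable_fun [set: R] f -> (forall y, 0 <= f y) ->
  (\int[leb]_y ((0 < y)%R%:R * f y)%:E <= B%:E)%E ->
  (\int[leb]_x ((0 < x)%R%:R * (x * f (x ^+ 2)))%:E <= (B / 2)%:E)%E.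
Proof.
move=> mf f0; rewrite -ge0_integral_sqr// => H.
have E : (\int[leb]_x ((0 < x)%R%:R * (2 * x) * f (x ^+ 2))%:E =
   2%:E * \int[leb]_x ((0 < x)%R%:R * (x * f (x ^+ 2)))%:E)%E.
  rewrite -ge0_integralZl_EFin//.
  - by apply: eq_integral => x _; rewrite -EFinM; congr EFin; ring.
  - move=> x _; rewrite lee_fin; have [x0|_] := ltP 0 x; last by rewrite mul0r.
    by rewrite mul1r mulr_ge0// ltW.
  - apply/measurable_EFinP; apply: measurable_funM; first exact: measurable_gt0.
    apply: measurable_funM => //; apply: measurableT_comp => //.
rewrite E in H.
by rewrite EFinM lee_pdivlMr// muleC.
Qed.

(* Where the smallest entry is too small: [x ^+ 2 * w <= 1]. *)
Definition corner_phi b n (x : R) (t : n.-tuple R) : R :=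
  x ^+ (2 * b).-1 * (\prod_(y <- t) y) ^+ b * (x ^+ 2 * \prod_(y <- t) y <= 1)%R%:R.

(** With [y = x^2] this is half the integral of [y^(b - 1) w^b] over [0 < y <= 1 / w], where the
    integrand is at most [w]. *)
Lemma corner_slice b n r (t : n.-tuple R) : (0 < b)%N -> (forall i, 0 < tnth t i <= r) ->
  (\int[leb]_x ((0 < x)%R%:R * corner_phi b x t)%:E <= 1%:E)%E.
Proof.
move=> b0 tr; have t0 : positive t by apply/positiveP => i; have /andP[] := tr i.
have w0 := positive_prod t0; set w := \prod_(x <- t) x in w0.
pose f (y : R) := (0 < y)%R%:R * y ^+ b.-1 * w ^+ b * (y * w <= 1)%R%:R.
have mf : measurable_fun [set: R] f.
  apply: measurable_funM; first apply: measurable_funM => //; first apply: measurable_funM.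
  - exact: measurable_gt0.
  - exact: measurable_funX.
  - apply: measurable_boolR; apply: measurable_fun_ler => //; exact: measurable_funM.
have f0 y : 0 <= f y.
  rewrite /f; have [y0|_] := ltP 0 y; last by rewrite !mul0r.
  by rewrite !mulr_ge0// exprn_ge0// ltW.
have -> : (\int[leb]_x ((0 < x)%R%:R * corner_phi b x t)%:E =
    \int[leb]_x ((0 < x)%R%:R * (x * f (x ^+ 2)))%:E)%E.
  apply: eq_integral => x _; congr EFin; have [x0|_] := ltP 0 x; last by rewrite !mul0r.
  rewrite !mul1r /f /corner_phi exprn_gt0// mul1r -/w !mulrA; congr (_ * _ * _).
  by rewrite -exprM -exprS; congr (_ ^+ _); case: (b) b0 => // k _; rewrite !mulnS.
apply: (@le_trans _ _ (1 / 2)%:E); last by rewrite lee_fin; lra.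
apply: integral_gt0_sqr_le => //.
apply: (@le_trans _ _ (\int[leb]_(x in `]0%R, (w^-1)%R]) w%:E)%E).
  rewrite [X in (_ <= X)%E]integral_mkcond; apply: ge0_le_integral => //.
  - by move=> x _; rewrite lee_fin mulr_ge0.
  - by apply/measurable_EFinP; apply: measurable_funM => //; exact: measurable_gt0.
  - by apply/(measurable_restrictT _ _).1.
  - move=> x _; rewrite patchE mem_setE/= in_itv/=.
    have [x0|_] := ltP 0 x; last by rewrite mul0r.
    rewrite mul1r /f x0 mul1r -[w^-1]div1r ler_pdivlMr//=; case: ifPn => [xw|_]; last by rewrite mulr0.
    have wb : w ^+ b = w * w ^+ b.-1 by rewrite -exprS prednK.
    rewrite mulr1 lee_fin wb mulrCA -exprMn ler_piMr ?(ltW w0)//.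
    by rewrite exprn_ile1// mulr_ge0 ?ltW.
rewrite integral_cst//= lebesgue_measure_itv/= lte_fin invr_gt0 w0 sube0 -EFinM.
by rewrite divff ?gt_eqF.
Qed.

(* Where the constraint on the completed tuple cuts off a thin shell. *)
Definition shell_phi r n (x : R) (t : n.-tuple R) : R :=
  x * (\prod_(y <- t) y) ^+ 2 *
  ((x ^+ 2 <= r ^+ 2 - \sum_(i < n) tnth t i ^+ 2) &&
   (r ^+ 2 - \sum_(i < n) tnth t i ^+ 2 - n.+2%:R / (r ^+ 2 * (\prod_(y <- t) y) ^+ 2) < x ^+ 2))%R%:R.

(** With [y = x^2] the integrand is [w^2] on a window of length [(n + 2) / (r^2 w^2)], so that [w]
    cancels. *)
Lemma shell_slice n r (t : n.-tuple R) : 0 < r -> (forall i, 0 < tnth t i <= r) ->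
  (\int[leb]_x ((0 < x)%R%:R * shell_phi r x t)%:E <= (n.+2%:R / r ^+ 2)%:E)%E.
Proof.
move=> r0 tr; have t0 : positive t by apply/positiveP => i; have /andP[] := tr i.
have w0 := positive_prod t0; rewrite /shell_phi; set w := \prod_(x <- t) x in w0 *.
set A := r ^+ 2 - _; set D := n.+2%:R / _.
have D0 : 0 < D by rewrite divr_gt0 ?ltr0n// mulr_gt0 ?exprn_gt0.
pose f (y : R) := w ^+ 2 * ((y <= A) && (A - D < y))%R%:R.
have mf : measurable_fun [set: R] f.
  apply: measurable_funM => //; apply: measurable_boolR; apply: measurable_and.
    exact: measurable_fun_ler.
  exact: measurable_fun_ltr.
have f0 y : 0 <= f y by rewrite mulr_ge0// sqr_ge0.
under eq_integral => x _ do rewrite -mulrA.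
have le2 : n.+2%:R / r ^+ 2 / 2 <= n.+2%:R / r ^+ 2 :> R.
  have : 0 <= n.+2%:R / r ^+ 2 :> R by rewrite divr_ge0 ?sqr_ge0.
  by move: (_ / _) => q ?; lra.
apply: (@le_trans _ _ (n.+2%:R / r ^+ 2 / 2)%:E); last by rewrite lee_fin.
apply: (integral_gt0_sqr_le mf f0).
apply: (@le_trans _ _ (\int[leb]_(x in `](A - D)%R, A]) (w ^+ 2)%:E)%E).
  rewrite [X in (_ <= X)%E]integral_mkcond; apply: ge0_le_integral => //.
  - by move=> x _; rewrite lee_fin mulr_ge0.
  - by apply/measurable_EFinP; apply: measurable_funM => //; exact: measurable_gt0.
  - by apply/(measurable_restrictT _ _).1.
  - move=> x _; rewrite patchE mem_setE/= in_itv/= /f andbC.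
    case: ifPn => _; last by rewrite !mulr0.
    by rewrite mulr1 lee_fin ler_piMl ?sqr_ge0//; case: (0 < x).
rewrite integral_cst//= lebesgue_measure_itv/= lte_fin ltrBlDr ltrDl D0 -EFinB -EFinM lee_fin.
have -> : A - (A - D) = D by ring.
rewrite /D.
have E (m q v : R) : q != 0 -> v != 0 -> v ^+ 2 * (m / (q * v ^+ 2)) = m / q.
  by move=> ? ?; field; apply/andP.
by rewrite E// ?expf_neq0// gt_eqF.
Qed.

(* The three profiles of the relative error of [\prod_i (s_i ^+ 2 - p ^- 2) ^+ b]. *)
Definition tail1_phi n (x : R) (t : n.-tuple R) : R :=
  x ^- 3 * (\prod_(y <- t) y)^-1 * (1 < x ^+ 2 * \prod_(y <- t) y)%R%:R.

(** With [y = x^2] this is half the integral of [y^(-2) / w] over [y > 1 / w], which is 1. *)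
Lemma tail1_slice n r (t : n.-tuple R) : (forall i, 0 < tnth t i <= r) ->
  (\int[leb]_x ((0 < x)%R%:R * tail1_phi x t)%:E <= 1%:E)%E.
Proof.
move=> tr; have t0 : positive t by apply/positiveP => i; have /andP[] := tr i.
have w0 := positive_prod t0; rewrite /tail1_phi; set w := \prod_(x <- t) x in w0 *.
pose f (y : R) := (y ^+ 2)^-1 * w^-1 * (w^-1 < y)%R%:R.
have mf : measurable_fun [set: R] f.
  apply: measurable_funM; last by apply: measurable_boolR; exact: measurable_fun_ltr.
  by apply: measurable_funM => //; exact: measurable_funV.
have f0 y : 0 <= f y by rewrite !mulr_ge0// invr_ge0 ?sqr_ge0// ltW.
apply: (@le_trans _ _ (1 / 2)%:E); last by rewrite lee_fin; lra.
have -> : (\int[leb]_x ((0 < x)%R%:R * (x ^- 3 * w^-1 * (1 < x ^+ 2 * w)%R%:R))%:E =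
    \int[leb]_x ((0 < x)%R%:R * (x * f (x ^+ 2)))%:E)%E.
  apply: eq_integral => x _; congr EFin; have [x0|_] := ltP 0 x; last by rewrite !mul0r.
  rewrite !mul1r /f -[w^-1 < _]/(w^-1 < _) -ltr_pdivrMr// div1r !mulrA; congr (_ * _ * _).
  have E (z : R) : z != 0 -> z ^- 3 = z / (z ^+ 2) ^+ 2 by move=> ?; field.
  by apply: E; rewrite gt_eqF.
apply: integral_gt0_sqr_le => //.
have wV : 0 < w^-1 by rewrite invr_gt0.
apply: (@le_trans _ _ (\int[leb]_(x in `[(w^-1)%R, +oo[) ((w^-1)%:E * (x ^- 2)%:E))%E).
  rewrite [X in (_ <= X)%E]integral_mkcond; apply: ge0_le_integral => //.
  - by move=> x _; rewrite lee_fin mulr_ge0.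
  - by apply/measurable_EFinP; apply: measurable_funM => //; exact: measurable_gt0.
  - apply/(measurable_restrictT _ _).1 => //; apply: measurable_funTS.
    apply/measurable_EFinP; apply: measurable_funM => //.
    by apply: measurable_funV; exact: measurable_funX.
  - move=> x _; rewrite patchE mem_setE/= in_itv/= andbT /f.
    have [wx|xw] := ltP w^-1 x.
      by rewrite (ltW wx) mulr1 (lt_trans wV wx) mul1r -EFinM lee_fin mulrC.
    rewrite !mulr0; case: ifP => // _.
    by rewrite -EFinM lee_fin mulr_ge0 ?invr_ge0 ?sqr_ge0// ltW.
rewrite ge0_integralZl_EFin//.
- by rewrite integral_inv_sqr_y// invrK -EFinM mulVf ?gt_eqF.
- by move=> x _; rewrite lee_fin invr_ge0 sqr_ge0.
- apply: measurable_funTS; apply/measurable_EFinP.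
  by apply: measurable_funV; exact: measurable_funX.
- exact: ltW.
Qed.

Definition tail2_phi r n (x : R) (t : n.-tuple R) : R :=
  x^-1 * ((1 < x ^+ 2 * \prod_(y <- t) y) && (x <= r))%R%:R.

(** With [y = x^2] this is half the integral of [1 / y] from [1 / w] to [r^2], that is, half of
    [2 ln r + ln w]; and [w <= r^n]. *)
Lemma tail2_slice n r (t : n.-tuple R) : 1 <= r -> (forall i, 0 < tnth t i <= r) ->
  (\int[leb]_x ((0 < x)%R%:R * tail2_phi r x t)%:E <= (n.+2%:R * ln r)%:E)%E.
Proof.
move=> r1 tr; have t0 : positive t by apply/positiveP => i; have /andP[] := tr i.
have r0 : 0 < r by exact: lt_le_trans r1.
have w0 := positive_prod t0; rewrite /tail2_phi.
have wr : \prod_(x <- t) x <= r ^+ n.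
  rewrite big_tuple -[n in r ^+ n]card_ord -prodr_const; apply: ler_prod => i _.
  by have /andP[/ltW -> ->] := tr i.
set w := \prod_(x <- t) x in w0 wr *.
pose f (y : R) := y^-1 * ((0 < y) && (w^-1 < y) && (y <= r ^+ 2))%R%:R.
have mf : measurable_fun [set: R] f.
  apply: measurable_funM; first exact: measurable_funV.
  apply: measurable_boolR; apply: measurable_and; last exact: measurable_fun_ler.
  by apply: measurable_and; exact: measurable_fun_ltr.
have f0 y : 0 <= f y.
  rewrite /f; have [y0|_] := ltP 0 y; last by rewrite mulr0.
  by rewrite mulr_ge0// invr_ge0 ltW.
have lnr : 0 <= ln r by exact: ln_ge0.
apply: (@le_trans _ _ (n.+2%:R * ln r / 2)%:E); last first.
  rewrite lee_fin; have : 0 <= n.+2%:R * ln r by rewrite mulr_ge0.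
  by move: (_ * ln r) => q ?; lra.
have -> : (\int[leb]_x ((0 < x)%R%:R * (x^-1 * ((1 < x ^+ 2 * w) && (x <= r))%R%:R))%:E =
    \int[leb]_x ((0 < x)%R%:R * (x * f (x ^+ 2)))%:E)%E.
  apply: eq_integral => x _; congr EFin; have [x0|_] := ltP 0 x; last by rewrite !mul0r.
  rewrite !mul1r /f exprn_gt0//= -ltr_pdivrMr// div1r ler_sqr ?nnegrE ?(ltW x0) ?(ltW r0)//.
  rewrite mulrA; congr (_ * _).
  have E (z : R) : z != 0 -> z^-1 = z / z ^+ 2 by move=> ?; field.
  by apply: E; rewrite gt_eqF.
apply: integral_gt0_sqr_le => //.
(* In this case no [y] qualifies; the fundamental theorem below needs a proper interval. *)
have [rw|rw] := leP (r ^+ 2) w^-1.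
  rewrite integral0_eq ?lee_fin ?mulr_ge0// => y _; congr EFin.
  rewrite /f; case: (ltP w^-1 y) => wy; last by rewrite andbF !mulr0.
  by rewrite [y <= _]leNgt (le_lt_trans rw wy) andbF !mulr0.
have wV : 0 < w^-1 by rewrite invr_gt0.
have cinv : {in `[w^-1, (r ^+ 2)], forall x : R, {for x, continuous (@GRing.inv R)}}.
  move=> x; rewrite in_itv/= => /andP[wx _]; apply: inv_continuous.
  by rewrite gt_eqF// (lt_le_trans wV).
apply: (@le_trans _ _ (\int[leb]_(x in `[(w^-1)%R, (r ^+ 2)%R]) (x^-1)%:E)%E).
  rewrite [X in (_ <= X)%E]integral_mkcond; apply: ge0_le_integral => //.
  - by move=> x _; rewrite lee_fin mulr_ge0.
  - by apply/measurable_EFinP; apply: measurable_funM => //; exact: measurable_gt0.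
  - apply/(measurable_restrictT _ _).1 => //; apply: measurable_funTS.
    by apply/measurable_EFinP; exact: measurable_funV.
  - move=> x _; rewrite patchE mem_setE/= in_itv/= /f.
    have [wx|xw] := ltP w^-1 x.
      rewrite (ltW wx) (lt_trans wV wx)/= mul1r; case: ifP => _; last by rewrite mulr0.
      by rewrite mulr1.
    rewrite andbF !mulr0; case: ifP => // /andP[wx _].
    by rewrite lee_fin invr_ge0 (le_trans (ltW wV)).
rewrite (@continuous_FTC2 _ (@GRing.inv R) (@ln R) _ _ rw).
- rewrite -EFinB lee_fin lnV ?posrE// opprK lnXn// -natr1 -natr1 !mulrDl mul1r.
  have lw : ln w <= n%:R * ln r.
    by rewrite mulr_natl -lnXn// ler_ln ?posrE// exprn_gt0.
  have -> : ln r *+ 2 = ln r + ln r by rewrite mulr2n.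
  by lra.
- by apply: continuous_in_subspaceT => x; rewrite inE/=; exact: cinv.
- have dl (x : R) : 0 < x -> is_derive x 1 (@ln R) x^-1 by exact: is_derive1_ln.
  split.
  + by move=> x; rewrite in_itv/= => /andP[wx _]; have [] := dl x (lt_trans wV wx).
  + by apply: cvg_at_right_filter; apply: continuous_ln.
  + by apply: cvg_at_left_filter; apply: continuous_ln; exact: lt_trans rw.
- move=> x; rewrite in_itv/= => /andP[wx _].
  by rewrite derive1E; apply: derive_val; apply: is_derive1_ln; exact: lt_trans wx.
Qed.

Definition tail4_phi n (r x : R) (t : n.-tuple R) : R := (x <= r)%R%:R.

Lemma tail4_slice n r (t : n.-tuple R) : 0 <= r ->
  (\int[leb]_x ((0 < x)%R%:R * tail4_phi r x t)%:E <= r%:E)%E.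
Proof.
move=> r0; rewrite (_ : (\int[leb]_x _)%E = \int[leb]_x (\1_(`]0%R, r]%classic) x)%:E)%E; last first.
  apply: eq_integral => x _; rewrite indicE mem_setE/= in_itv/= /tail4_phi.
  by case: (0 < x); rewrite ?mul0r ?mul1r.
rewrite integral_indic// setIT/= lebesgue_measure_itv/= lte_fin.
by case: ifP => // _; rewrite sube0.
Qed.

End slices.

(** * Pointwise comparison of the two densities *)

Section pointwise.
Context {R : realType}.
Local Notation swap j := (perm_tuple (tperm ord0 j)).

Lemma norm_sqr_diff_le (x y r : R) : 0 <= x <= r -> 0 <= y <= r ->
  `|x ^+ 2 - y ^+ 2| <= r ^+ 2.
Proof.
move=> /andP[x0 xr] /andP[y0 yr].
have x2 : x ^+ 2 <= r ^+ 2 by rewrite ler_sqr ?nnegrE// (le_trans x0).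
have y2 : y ^+ 2 <= r ^+ 2 by rewrite ler_sqr ?nnegrE// (le_trans y0).
have := sqr_ge0 x; have := sqr_ge0 y.
rewrite ler_norml; move: (x ^+ 2) (y ^+ 2) (r ^+ 2) x2 y2 => a c d *.
by apply/andP; split; lra.
Qed.

Lemma vandermonde_abs_le b n r (t : n.-tuple R) : (forall i, 0 <= tnth t i <= r) ->
  vandermonde_abs b t <= r ^+ (b * (n * n.-1)).
Proof.
elim: n t => [|n IH] t; first by rewrite /vandermonde_abs big_ord0 muln0 expr0.
case/tupleP: t => x t H; rewrite vandermonde_abs_cons.
have x0r := H ord0; rewrite tnth_cons0 in x0r.
have t0r i : 0 <= tnth t i <= r by have := H (lift ord0 i); rewrite tnth_consS.
apply: (@le_trans _ _ (r ^+ (2 * b * n) * r ^+ (b * (n * n.-1)))).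
  apply: ler_pM; rewrite ?vandermonde_abs_ge0//; last exact: IH.
    by apply: prodr_ge0 => i _; rewrite exprn_ge0.
  rewrite -[n in leRHS]card_ord exprM -prodr_const; apply: ler_prod => i _.
  rewrite exprn_ge0//= exprM; apply: lerXn2r; rewrite ?nnegrE ?sqr_ge0//.
  exact: norm_sqr_diff_le.
rewrite -exprD; case: (n) => [|m]; first by rewrite !muln0.
by rewrite (_ : (2 * b * m.+1 + b * (m.+1 * m) = b * (m.+2 * m.+1))%N)//; nia.
Qed.

Lemma prod_le_pow n r (t : n.-tuple R) : (forall i, 0 < tnth t i <= r) ->
  \prod_(x <- t) x <= r ^+ n.
Proof.
move=> tr; rewrite big_tuple -[n in r ^+ n]card_ord -prodr_const.
by apply: ler_prod => i _; have /andP[/ltW -> ->] := tr i.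
Qed.

(** The gap between the smallest entry and [t_i] is at most [t_i^2]; keeping this in place of [r^2]
    retains the powers of the product that the slice integrals need. *)
Lemma vandermonde_abs_head_min b n r (x : R) (t : n.-tuple R) : 0 < x ->
  (forall i, x <= tnth t i <= r) ->
  vandermonde_abs b (cons_tuple x t) <= r ^+ (b * (n * n.-1)) * (\prod_(y <- t) y) ^+ (2 * b).
Proof.
move=> x0 H; rewrite vandermonde_abs_cons mulrC.
have t0 i : 0 <= tnth t i by have /andP[+ _] := H i; apply: le_trans; exact: ltW.
apply: ler_pM; rewrite ?vandermonde_abs_ge0//.
- by apply: prodr_ge0 => i _; rewrite exprn_ge0.
- by apply: vandermonde_abs_le => i; have /andP[_ ->] := H i; rewrite t0.
rewrite big_tuple -prodrXl; apply: ler_prod => i _; rewrite exprn_ge0//= exprM.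
apply: lerXn2r; rewrite ?nnegrE ?sqr_ge0//.
by have /andP[xt _] := H i; apply: norm_sqr_diff_le; rewrite ?(ltW x0) ?t0 ?lexx.
Qed.

Lemma bernoulli (x : R) k : 0 <= x <= 1 -> 1 - k%:R * x <= (1 - x) ^+ k.
Proof.
move=> /andP[x0 x1]; elim: k => [|k IH]; first by rewrite mul0r subr0 expr0.
have [h|h] := leP 0 (1 - k%:R * x).
  rewrite exprS -natr1; apply: le_trans (ler_wpM2l _ IH); last by lra.
  have : 0 <= k%:R * x ^+ 2 by rewrite mulr_ge0// sqr_ge0.
  by rewrite expr2; move: (k%:R : R) => a; nra.
apply: (@le_trans _ _ 0); last by rewrite exprn_ge0// subr_ge0.
by rewrite -natr1 mulrDl mul1r; move: (k%:R * x) h => a h; lra.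
Qed.

(** Let [x] be the smallest entry and [y = (x p)^(-2) <= 1]. Then [p^(-2) = x^2 y <= s_i^2 y], so
    that each factor is at least [(s_i^2 (1 - y))^b], and Bernoulli's inequality is applied to the
    power [b (n + 1)] of [1 - y]. *)
Lemma completion_loss b n (s : n.+1.-tuple R) (p := \prod_(y <- s) y) : positive s ->
  (forall i, tnth s ord0 <= tnth s i) -> 1 <= tnth s ord0 * p ->
  p ^+ (2 * b) * (1 - (b * n.+1)%:R * (tnth s ord0 * p) ^- 2) <=
  \prod_(i < n.+1) `|(p^-1) ^+ 2 - tnth s i ^+ 2| ^+ b.
Proof.
move=> s0 smin xp; set x := tnth s ord0 in smin xp *.
have p0 : 0 < p by exact: positive_prod.
have x0 : 0 < x by move/positiveP: s0; exact.
set y := (x * p) ^- 2.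
have y01 : 0 <= y <= 1.
  rewrite invr_ge0 sqr_ge0/= invf_le1 ?exprn_gt0 ?mulr_gt0//.
  by rewrite exprn_ege1.
apply: (@le_trans _ _ (p ^+ (2 * b) * (1 - y) ^+ (b * n.+1))).
  by rewrite ler_wpM2l ?bernoulli// exprn_ge0// ltW.
have -> : p ^+ (2 * b) * (1 - y) ^+ (b * n.+1) = \prod_(i < n.+1) (tnth s i ^+ 2 * (1 - y)) ^+ b.
  rewrite prodrXl big_split/= prodrXl prodr_const card_ord -/p.
  by rewrite [\prod_(i < n.+1) _](_ : _ = p) ?/p ?big_tuple// exprMn -!exprM [(n.+1 * b)%N]mulnC.
have /andP[y0 y1] := y01; have yS : 0 <= 1 - y by rewrite subr_ge0.
apply: ler_prod => i _; have si0 : 0 < tnth s i by move/positiveP: s0; exact.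
have l0 : 0 <= tnth s i ^+ 2 * (1 - y) by rewrite (mulr_ge0 (sqr_ge0 _)).
rewrite exprn_ge0//=; apply: lerXn2r; rewrite ?nnegrE//.
have pE : (p^-1) ^+ 2 = x ^+ 2 * y.
  rewrite /y; have E (u v : R) : u != 0 -> v != 0 -> (v^-1) ^+ 2 = u ^+ 2 * (u * v) ^- 2.
    by move=> ? ?; field; apply/andP.
  by apply: E; rewrite gt_eqF.
have le2 : x ^+ 2 * y <= tnth s i ^+ 2 * y.
  by rewrite ler_wpM2r// ler_sqr ?nnegrE ?(ltW x0) ?(ltW si0)// smin.
rewrite pE distrC; apply: le_trans (ler_norm _).
by move: le2; move: (x ^+ 2 * y) (tnth s i ^+ 2) => a c; lra.
Qed.

(* [min_density] with each factor [`|s_i ^+ 2 - p ^- 2| ^+ b] replaced by [s_i ^+ (2 * b)],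
   where [p] is the product of the entries. *)
Definition main_density b r n (s : n.-tuple R) : R :=
  (positive s)%:R * (in_ball r s)%:R * ((\prod_(x <- s) x) ^+ (2 * b).-1 * vandermonde_abs b s).

Lemma main_density_ge0 b r n (s : n.-tuple R) : 0 <= main_density b r s.
Proof.
rewrite /main_density; have [s0|] := boolP (positive s); last by rewrite !mul0r.
by rewrite mul1r !mulr_ge0 ?vandermonde_abs_ge0// exprn_ge0// ltW// positive_prod.
Qed.

Lemma measurable_main_density b r n : measurable_fun [set: n.-tuple R] (@main_density b r n).
Proof.
apply: measurable_funM; apply: measurable_funM.
- exact: (@measurable_boolR R _ _ _ (@measurable_positive R n)).
- exact: (@measurable_boolR R _ _ _ (@measurable_in_ball R r n)).
- by apply: measurable_funX; exact: measurable_prod_tuple.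
- exact: measurable_vandermonde_abs.
Qed.

Lemma main_density_perm b r n (sg : {perm 'I_n}) (s : n.-tuple R) :
  main_density b r (perm_tuple sg s) = main_density b r s.
Proof.
rewrite /main_density positive_perm; last exact: perm_inj.
by rewrite in_ball_perm prod_perm_tuple vandermonde_abs_perm.
Qed.

Lemma min_density_swap b r n k (s : n.+1.-tuple R) :
  min_density b r ord0 (swap k s) = min_density b r ord0 s.
Proof.
rewrite /min_density positive_perm; last exact: perm_inj.
by rewrite prod_perm_tuple full_swap min_part_perm tpermD.
Qed.

Lemma vandermonde_abs_full b n (s : n.-tuple R) :
  vandermonde_abs b (full s) =
  (\prod_(i < n) `|(\prod_(x <- s) x)^-1 ^+ 2 - tnth s i ^+ 2| ^+ b) * vandermonde_abs b s.
Proof. exact: vandermonde_abs_cons. Qed.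

Lemma in_ball_full r n (s : n.-tuple R) :
  in_ball r (full s) = ((\prod_(x <- s) x)^-1 ^+ 2 + \sum_(i < n) tnth s i ^+ 2 <= r ^+ 2).
Proof.
rewrite /in_ball big_ord_recl tnth_cons0; congr (_ + _ <= _).
by apply: eq_bigr => i _; rewrite tnth_consS.
Qed.

(** [p^(-1)] is below every entry, hence [|p^(-2) - s_i^2| <= s_i^2], and the ball condition on the
    full tuple is the stronger one. *)
Lemma min_density_le_main b r n (s : n.-tuple R) : (0 < b)%N ->
  min_density b r ord0 s <= main_density b r s.
Proof.
move=> b0; rewrite /min_density /main_density.
have [s0|_] := boolP (positive s); last by rewrite !mul0r.
have p0 := positive_prod s0; set p := \prod_(x <- s) x in p0 *.
rewrite !mul1r /min_part.
have [sm|_] := boolP (strict_min _ _); last first.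
  by rewrite !mulr0 !mulr_ge0 ?vandermonde_abs_ge0// exprn_ge0// ltW.
have [fb|_] := boolP (in_ball r (full s)); last first.
  by rewrite mulr0 mul0r mulr0 !mulr_ge0 ?vandermonde_abs_ge0// exprn_ge0// ltW.
have -> : in_ball r s.
  by move: fb; rewrite in_ball_full; apply: le_trans; rewrite lerDr sqr_ge0.
rewrite !mulr1 mul1r vandermonde_abs_full mulrA ler_wpM2r ?vandermonde_abs_ge0//.
rewrite ler_pdivrMl// -exprS prednK ?muln_gt0 ?b0//.
rewrite -/p; have -> : p ^+ (2 * b) = \prod_(i < n) tnth s i ^+ (2 * b) by rewrite prodrXl /p big_tuple.
apply: ler_prod => i _.
rewrite exprn_ge0//= exprM; apply: lerXn2r; rewrite ?nnegrE ?sqr_ge0//.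
move/strict_minP: sm => /(_ (lift ord0 i) isT); rewrite tnth_cons0 tnth_consS -/p => pi.
have pV : 0 < p^-1 by rewrite invr_gt0.
have : (p^-1) ^+ 2 <= tnth s i ^+ 2.
  by rewrite ler_sqr ?nnegrE ?(ltW pV)// ltW// (lt_trans pV).
have := sqr_ge0 p^-1; rewrite ler_norml; move: ((p^-1) ^+ 2) (tnth s i ^+ 2) => a c ? ?.
by apply/andP; split; lra.
Qed.

End pointwise.

(** * The three errors, pointwise *)

Section error.
Context {R : realType}.
Implicit Types (r : R).

(** After the Vandermonde bound the power of [w] is [4 b - 1]. The part [w^b] stays in [corner_phi],
    where [x^2 w <= 1] controls it, and the other [3 b - 1] factors are bounded by [r^n]. *)
Lemma corner_bound b n r (x : R) (t : n.-tuple R) : (0 < b)%N -> 0 < r ->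
  positive (cons_tuple x t) -> in_ball r (cons_tuple x t) ->
  (forall i, x <= tnth t i) -> x ^+ 2 * \prod_(y <- t) y <= 1 ->
  main_density b r (cons_tuple x t) <=
  r ^+ (b * (n * n.-1) + n * (3 * b).-1) * ball_part r (corner_phi b (n := n)) (cons_tuple x t).
Proof.
have b23 : (0 < b -> (2 * b).-1 + 2 * b = (3 * b).-1 + b)%N by lia.
move=> b0 r0 xt0 br xmin xw; have H := in_ball_le (ltW r0) xt0 br.
have tr i : 0 < tnth t i <= r by have := H (lift ord0 i); rewrite tnth_consS.
rewrite /main_density /ball_part xt0 br !mul1r theadE tail_cons /corner_phi xw mulr1 big_cons.
have := xt0; rewrite positive_cons => /andP[x0 t0].
have w0 := positive_prod t0; have wr := prod_le_pow tr.
have V := @vandermonde_abs_head_min R b n r x t x0.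
move: V wr w0; set w := \prod_(y <- t) y => V wr w0.
apply: (@le_trans _ _ ((x * w) ^+ (2 * b).-1 * (r ^+ (b * (n * n.-1)) * w ^+ (2 * b)))).
  rewrite ler_wpM2l ?exprn_ge0 ?mulr_ge0 ?(ltW x0) ?(ltW w0)//; apply: V => i.
  by have /andP[_ ->] := tr i; rewrite xmin.
rewrite exprMn exprD (exprM r n).
have -> : x ^+ (2 * b).-1 * w ^+ (2 * b).-1 * (r ^+ (b * (n * n.-1)) * w ^+ (2 * b)) =
  r ^+ (b * (n * n.-1)) * (w ^+ (3 * b).-1 * (x ^+ (2 * b).-1 * w ^+ b)).
  have E (p q s v u z : R) : q * v = u * z -> p * q * (s * v) = s * (u * (p * z)).
    by move=> h; transitivity (s * p * (q * v)); [ring|rewrite h; ring].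
  by apply: E; rewrite -!exprD b23.
rewrite -[leRHS]mulrA ler_wpM2l ?exprn_ge0 ?(ltW r0)// ler_wpM2r//.
  by rewrite mulr_ge0 ?exprn_ge0 ?(ltW x0) ?(ltW w0).
by apply: lerXn2r; rewrite ?nnegrE ?exprn_ge0 ?(ltW r0) ?(ltW w0).
Qed.

(** [1 < x^2 w = x p] makes [p^(-1)] the strict minimum of the full tuple and lets [completion_loss]
    apply. The profile [phi] and the constant [CT] are left open, as they depend on [beta]. *)
Lemma tail_bound b n r CT (phi : R -> n.-tuple R -> R) (x : R) (t : n.-tuple R) :
  (0 < b)%N -> 0 < r ->
  (x ^+ (2 * b).-1 * (\prod_(y <- t) y) ^+ (4 * b).-1 * (x ^+ 2 * \prod_(y <- t) y) ^- 2
    <= CT * phi x t) ->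
  positive (cons_tuple x t) -> in_ball r (full (cons_tuple x t)) ->
  (forall i, x <= tnth t i) -> 1 < x ^+ 2 * \prod_(y <- t) y ->
  main_density b r (cons_tuple x t) <=
  min_density b r ord0 (cons_tuple x t) +
  (b * n.+1)%:R * r ^+ (b * (n * n.-1)) * CT * ball_part r phi (cons_tuple x t).
Proof.
have b24 : (0 < b -> (2 * b).-1 + 2 * b = (4 * b).-1)%N by lia.
move=> b0 r0 HT xt0 bf xmin xw.
have br : in_ball r (cons_tuple x t).
  by move: bf; rewrite in_ball_full; apply: le_trans; rewrite lerDr sqr_ge0.
have H := in_ball_le (ltW r0) xt0 br.
have tr i : 0 < tnth t i <= r by have := H (lift ord0 i); rewrite tnth_consS.
have := xt0; rewrite positive_cons => /andP[x0 t0].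
have w0 := positive_prod t0.
have pE : \prod_(y <- cons_tuple x t) y = x * \prod_(y <- t) y by rewrite big_cons.
have xp : x * \prod_(y <- cons_tuple x t) y = x ^+ 2 * \prod_(y <- t) y by rewrite pE mulrA.
have p0 : 0 < \prod_(y <- cons_tuple x t) y by exact: positive_prod.
have sm : strict_min ord0 (full (cons_tuple x t)).
  apply/strict_minP => j; case: (unliftP ord0 j) => [k|] ->; last by rewrite eqxx.
  move=> _; rewrite /full tnth_cons0 tnth_consS.
  apply: (@lt_le_trans _ _ x); first by rewrite -div1r ltr_pdivrMr// xp.
  by case: (unliftP ord0 k) => [i|] ->; rewrite ?tnth_consS ?tnth_cons0.
have xmin' i : tnth (cons_tuple x t) ord0 <= tnth (cons_tuple x t) i.
  by case: (unliftP ord0 i) => [k|] ->; rewrite ?tnth_consS !tnth_cons0.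
have CL := @completion_loss R b n (cons_tuple x t) xt0 xmin'.
rewrite tnth_cons0 xp in CL; have {}CL := CL (ltW xw).
rewrite /main_density /min_density /ball_part /min_part xt0 br bf sm !mul1r !mulr1 theadE tail_cons.
rewrite vandermonde_abs_full.
have V0 := vandermonde_abs_ge0 b (cons_tuple x t).
have VB : vandermonde_abs b (cons_tuple x t) <= r ^+ (b * (n * n.-1)) * (\prod_(y <- t) y) ^+ (2 * b).
  by apply: vandermonde_abs_head_min => // i; have /andP[_ ->] := tr i; rewrite xmin.
move: V0 VB CL p0 pE HT xw w0.
set p := \prod_(y <- cons_tuple x t) y; set w := \prod_(y <- t) y.
set V := vandermonde_abs _ _; set P := \prod_(i < n.+1) _; set rr := r ^+ _.
set e := (x ^+ 2 * w) ^- 2 => V0 VB CL p0 pE HT xw w0.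
have e0 : 0 <= e by rewrite invr_ge0 sqr_ge0.
have pS : p^-1 * p ^+ (2 * b) = p ^+ (2 * b).-1.
  by rewrite -[in LHS](@prednK (2 * b)) ?muln_gt0// exprS mulKf ?gt_eqF.
(* The main density is split in the proportions [1 - q e] and [q e], with [q = b (n + 1)]: the first
   part is below [min_density], the second is the loss. *)
apply: (@le_trans _ _ (p^-1 * (p ^+ (2 * b) * (1 - (b * n.+1)%:R * e) * V) +
                       (b * n.+1)%:R * (p ^+ (2 * b).-1 * e * V))).
  rewrite -pS; move: (p^-1) (p ^+ (2 * b)) ((b * n.+1)%:R : R) => p1 p2 q.
  have -> // : p1 * p2 * V = p1 * (p2 * (1 - q * e) * V) + q * (p1 * p2 * e * V) by ring.
apply: lerD; first by rewrite ler_wpM2l ?invr_ge0 ?(ltW p0)// ler_wpM2r.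
rewrite -!mulrA ler_wpM2l//.
apply: (@le_trans _ _ (p ^+ (2 * b).-1 * (e * (rr * w ^+ (2 * b))))).
  by rewrite ler_wpM2l ?exprn_ge0 ?(ltW p0)// ler_wpM2l.
have -> : p ^+ (2 * b).-1 * (e * (rr * w ^+ (2 * b))) = rr * (x ^+ (2 * b).-1 * w ^+ (4 * b).-1 * e).
  have <- : w ^+ (2 * b).-1 * w ^+ (2 * b) = w ^+ (4 * b).-1.
    by rewrite -exprD b24.
  rewrite pE exprMn; move: (x ^+ _) (w ^+ _) (w ^+ _) (rr) (e) => a c g f d.
  by ring.
by rewrite ler_wpM2l// exprn_ge0// ltW.
Qed.

(** Here [x] is the largest entry. As [p^(-1) < x], the violated ball condition gives
    [r^2 < p^(-2) + x^2 + S <= (n + 2) x^2], where [S] is the sum of the other squares. Hence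
    [p^(-2) = x^(-2) w^(-2)] is less than [(n + 2) / (r^2 w^2)], which is the thickness of the shell
    in [x^2]. *)
Lemma shell_bound b n r CS (x : R) (t : n.-tuple R) : 0 < r ->
  ((x * \prod_(y <- t) y) ^+ (2 * b).-1 <= CS * (x * (\prod_(y <- t) y) ^+ 2)) ->
  positive (cons_tuple x t) -> in_ball r (cons_tuple x t) ->
  ~~ in_ball r (full (cons_tuple x t)) ->
  (forall i, tnth t i <= x) -> 1 < x ^+ 2 * \prod_(y <- t) y ->
  main_density b r (cons_tuple x t) <=
  r ^+ (b * (n.+1 * n)) * CS * ball_part r (shell_phi r (n := n)) (cons_tuple x t).
Proof.
move=> r0 HS xt0 br bf xmax xw; have H := in_ball_le (ltW r0) xt0 br.
have := xt0; rewrite positive_cons => /andP[x0 t0].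
have w0 := positive_prod t0.
have pE : \prod_(y <- cons_tuple x t) y = x * \prod_(y <- t) y by rewrite big_cons.
have V : vandermonde_abs b (cons_tuple x t) <= r ^+ (b * (n.+1 * n)).
  by apply: vandermonde_abs_le => i; have /andP[/ltW -> ->] := H i.
have sE : \sum_(i < n.+1) tnth (cons_tuple x t) i ^+ 2 = x ^+ 2 + \sum_(i < n) tnth t i ^+ 2.
  by rewrite big_ord_recl tnth_cons0; congr (_ + _); apply: eq_bigr => i _; rewrite tnth_consS.
have SB : \sum_(i < n) tnth t i ^+ 2 <= n%:R * x ^+ 2.
  rewrite mulr_natl -[n in _ *+ n]card_ord -sumr_const; apply: ler_sum => i _.
  rewrite ler_sqr ?nnegrE ?(ltW x0)//; apply: ltW; exact: (elimT (positiveP _) t0).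
have := bf; rewrite in_ball_full pE sE -ltNge => bf'.
have := br; rewrite /in_ball sE => br'.
rewrite /main_density /ball_part xt0 br !mul1r theadE tail_cons /shell_phi pE.
move: HS bf' br' SB xw w0; set w := \prod_(y <- t) y; set S := \sum_(i < n) _.
move=> HS bf' br' SB xw w0.
have xS : x ^+ 2 <= r ^+ 2 - S by rewrite lerBrDr.
have pV : (x * w)^-1 ^+ 2 <= x ^+ 2.
  rewrite ler_sqr ?nnegrE ?invr_ge0 ?mulr_ge0 ?(ltW x0) ?(ltW w0)//.
  by rewrite -div1r ler_pdivrMr ?mulr_gt0// mulrA -expr2 ltW.
have Nx : r ^+ 2 < n.+2%:R * x ^+ 2.
  apply: lt_le_trans bf' _; rewrite -!natr1.
  by move: SB pV; move: (x ^+ 2) ((x * w)^-1 ^+ 2) (S) (n%:R : R) => a c d e; lra.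
have xr : (x * w)^-1 ^+ 2 < n.+2%:R / (r ^+ 2 * w ^+ 2).
  have -> : (x * w)^-1 ^+ 2 = x ^- 2 * w ^- 2 by rewrite exprVn exprMn invfM.
  have -> : n.+2%:R / (r ^+ 2 * w ^+ 2) = n.+2%:R / r ^+ 2 * w ^- 2 by rewrite invfM mulrA.
  rewrite ltr_pM2r ?invr_gt0 ?exprn_gt0// ltr_pdivlMr ?exprn_gt0// mulrC.
  by rewrite ltr_pdivrMr ?exprn_gt0.
have -> : (x ^+ 2 <= r ^+ 2 - S) && (r ^+ 2 - S - n.+2%:R / (r ^+ 2 * w ^+ 2) < x ^+ 2).
  rewrite xS/=; move: xr bf'; move: ((x * w)^-1 ^+ 2) (n.+2%:R / (r ^+ 2 * w ^+ 2)) (x ^+ 2) (r ^+ 2) (S).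
  by move=> a c d e f; lra.
rewrite mulr1 mulrC -mulrA; apply: ler_pM => //; first exact: vandermonde_abs_ge0.
by rewrite exprn_ge0// mulr_ge0 ?(ltW x0) ?(ltW w0).
Qed.

End error.

Section total_error.
Context {R : realType}.
Local Notation swap j := (perm_tuple (tperm ord0 j)).
Implicit Types (r : R).

Lemma corner_phi_ge0 b n (x : R) (t : n.-tuple R) : 0 < x -> positive t -> 0 <= corner_phi b x t.
Proof.
move=> x0 t0; rewrite /corner_phi !mulr_ge0// exprn_ge0 ?(ltW x0)//.
by rewrite ltW// positive_prod.
Qed.

Lemma shell_phi_ge0 r n (x : R) (t : n.-tuple R) : 0 < x -> positive t -> 0 <= shell_phi r x t.
Proof. by move=> x0 t0; rewrite /shell_phi (mulr_ge0 (mulr_ge0 (ltW x0) (sqr_ge0 _))). Qed.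

Definition loss b r n (C1 C2 C3 : R) (phi : R -> n.-tuple R -> R) (s : n.+1.-tuple R) : R :=
  C1 * ball_part r (corner_phi b (n := n)) s + C2 * ball_part r phi s +
  C3 * ball_part r (shell_phi r (n := n)) s.

(** The bounds above require the smallest, or for the shell the largest, entry at the head. The two
    densities are symmetric, and summing [loss] over all exchanges with the head covers every
    position of that entry. *)
Lemma main_density_le b r n C2 C3 (phi : R -> n.-tuple R -> R) (s : n.+1.-tuple R) :
  (0 < b)%N -> 0 < r -> 0 <= C2 -> 0 <= C3 ->
  (forall x t, 0 < x -> positive t -> 0 <= phi x t) ->
  (forall x (t : n.-tuple R), (forall i, 0 < tnth (cons_tuple x t) i <= r) ->
    1 < x ^+ 2 * \prod_(y <- t) y ->
    x ^+ (2 * b).-1 * (\prod_(y <- t) y) ^+ (4 * b).-1 * (x ^+ 2 * \prod_(y <- t) y) ^- 2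
    <= C2 * phi x t) ->
  (forall x (t : n.-tuple R), (forall i, 0 < tnth (cons_tuple x t) i <= r) ->
    1 < x ^+ 2 * \prod_(y <- t) y ->
    (x * \prod_(y <- t) y) ^+ (2 * b).-1 <= C3 * (x * (\prod_(y <- t) y) ^+ 2)) ->
  main_density b r s <= min_density b r ord0 s +
    \sum_u loss b r (r ^+ (b * (n * n.-1) + n * (3 * b).-1))
      ((b * n.+1)%:R * r ^+ (b * (n * n.-1)) * C2) (r ^+ (b * (n.+1 * n)) * C3) phi (swap u s).
Proof.
move=> b0 r0 C20 C30 phi0 H2 H3.
set D1 := r ^+ _; set D2 := _ * C2; set D3 := _ * C3.
have rk k : 0 <= r ^+ k by rewrite exprn_ge0// ltW.
have D10 : 0 <= D1 by exact: rk.
have D20 : 0 <= D2 by rewrite !mulr_ge0.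
have D30 : 0 <= D3 by rewrite mulr_ge0.
have b1 s' : 0 <= D1 * ball_part r (corner_phi b (n := n)) s'.
  by rewrite mulr_ge0// ball_part_ge0// => x t; exact: corner_phi_ge0.
have b2 s' : 0 <= D2 * ball_part r phi s' by rewrite mulr_ge0// ball_part_ge0.
have b3 s' : 0 <= D3 * ball_part r (shell_phi r (n := n)) s'.
  by rewrite mulr_ge0// ball_part_ge0// => x t; exact: shell_phi_ge0.
have l0 s' : 0 <= loss b r D1 D2 D3 phi s' by rewrite !addr_ge0.
have m0 s' : 0 <= min_density b r ord0 s' by exact: min_density_ge0.
have le_sum k : loss b r D1 D2 D3 phi (swap k s) <= \sum_u loss b r D1 D2 D3 phi (swap u s).
  by rewrite (bigD1 k)//= lerDl sumr_ge0.
have sum0 : 0 <= \sum_u loss b r D1 D2 D3 phi (swap u s) by rewrite sumr_ge0.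
have [s0|] := boolP (positive s); last first.
  by move=> /negbTE h; rewrite {1}/main_density h !mul0r addr_ge0.
have [br|] := boolP (in_ball r s); last first.
  by move=> /negbTE h; rewrite {1}/main_density h mulr0 mul0r addr_ge0.
have swapE k : [/\ positive (swap k s), in_ball r (swap k s),
    in_ball r (full (swap k s)) = in_ball r (full s),
    main_density b r (swap k s) = main_density b r s &
    \prod_(y <- swap k s) y = \prod_(y <- s) y].
  split; rewrite ?in_ball_perm ?full_swap ?main_density_perm ?min_density_swap ?prod_perm_tuple ?in_ball_perm//.
  by rewrite positive_perm//; exact: perm_inj.
have [u _ uP] := Order.TotalTheory.arg_minP (P := xpredT) (i0 := ord0) (fun j => tnth s j) isT.
have [k _ kP] := Order.TotalTheory.arg_maxP (P := xpredT) (i0 := ord0) (fun j => tnth s j) isT.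
have hd j : tnth (swap j s) ord0 = tnth s j by rewrite tnth_mktuple tpermL.
have := swapE u; have := min_density_swap b r u s; have := hd u.
have: forall i, tnth s u <= tnth (swap u s) i by move=> i; rewrite tnth_mktuple uP.
have := le_sum u.
have sE : main_density b r (swap u s) = main_density b r s by exact: main_density_perm.
move: sE; case/tupleP: (swap u s) => x t sE lsu xmin xE <- [xt0 xtr xfr <- pu].
rewrite tnth_cons0 in xE; have {}xmin i : x <= tnth t i.
  by have := xmin (lift ord0 i); rewrite tnth_consS -xE.
rewrite big_cons in pu.
have H := in_ball_le (ltW r0) xt0 xtr.
have [xw|xw] := leP (x ^+ 2 * \prod_(y <- t) y) 1.
  apply: le_trans (corner_bound b0 r0 xt0 xtr xmin xw) _.
  apply: ler_wpDl; first exact: m0.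
  by apply: le_trans lsu; rewrite /loss -addrA lerDl addr_ge0.
have [fr|fr] := boolP (in_ball r (full s)).
  rewrite fr in xfr.
  apply: le_trans (tail_bound b0 r0 (H2 _ _ H xw) xt0 xfr xmin xw) _.
  rewrite lerD2l; apply: le_trans lsu.
  by rewrite /loss addrAC lerDr addr_ge0.
apply: ler_wpDl; first exact: m0.
rewrite (_ : main_density _ _ _ = main_density b r (swap k s)); last first.
  by have [_ _ _ -> _] := swapE k; exact: sE.
have := swapE k; have := hd k.
have: forall i, tnth (swap k s) i <= tnth s k by move=> i; rewrite tnth_mktuple; exact: kP.
have := le_sum k.
case/tupleP: (swap k s) => z v lsk zmax zE [zv0 zvr zfr _ pk].
rewrite tnth_cons0 in zE; have {}zmax i : tnth v i <= z.
  by have := zmax (lift ord0 i); rewrite tnth_consS -zE.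
rewrite big_cons in pk.
(* Both sides are an entry times the common product [p]: [x^2 w = x p] for the smallest entry and
   [z p] for the largest. *)
have zw : 1 < z ^+ 2 * \prod_(y <- v) y.
  apply: (lt_le_trans xw); rewrite !expr2 -!mulrA pk pu ler_pM ?(ltW (positive_prod s0)) ?xE ?zE ?uP//.
  by apply: ltW; exact: (elimT (positiveP _) s0).
rewrite -zfr in fr.
apply: le_trans (shell_bound r0 (H3 _ _ (in_ball_le (ltW r0) zv0 zvr) zw) zv0 zvr fr zmax zw) _.
by apply: le_trans lsk; rewrite /loss lerDr addr_ge0.
Qed.

End total_error.

Section total_error_integral.
Context {R : realType}.
Local Notation leb := (@lebesgue_measure R).
Local Notation L := (@lebesgue_tuple R).
Local Notation swap j := (perm_tuple (tperm ord0 j)).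
Implicit Types (r : R).

Lemma measurable_thead n : measurable_fun [set: n.+1.-tuple R] (fun s : n.+1.-tuple R => thead s : R).
Proof. exact: measurable_tnth. Qed.

Lemma measurable_prod_tail n :
  measurable_fun [set: n.+1.-tuple R] (fun s : n.+1.-tuple R => \prod_(y <- tail s) y : R).
Proof. exact: measurableT_comp (@measurable_prod_tuple R n) (@measurable_tail R n). Qed.

Lemma measurable_corner_phi b n :
  measurable_fun [set: n.+1.-tuple R] (fun s => corner_phi b (thead s) (tail s)).
Proof.
apply: measurable_funM; first apply: measurable_funM.
- by apply: measurable_funX; exact: measurable_thead.
- by apply: measurable_funX; exact: measurable_prod_tail.
- apply: measurable_boolR; apply: measurable_fun_ler => //.
  apply: measurable_funM; last exact: measurable_prod_tail.
  by apply: measurable_funX; exact: measurable_thead.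
Qed.

Lemma measurable_tail1_phi n :
  measurable_fun [set: n.+1.-tuple R] (fun s => tail1_phi (thead s) (tail s)).
Proof.
apply: measurable_funM; first apply: measurable_funM.
- by apply: measurable_funV; apply: measurable_funX; exact: measurable_thead.
- by apply: measurable_funV; exact: measurable_prod_tail.
- apply: measurable_boolR; apply: measurable_fun_ltr => //.
  apply: measurable_funM; last exact: measurable_prod_tail.
  by apply: measurable_funX; exact: measurable_thead.
Qed.

Lemma measurable_tail2_phi r n :
  measurable_fun [set: n.+1.-tuple R] (fun s => tail2_phi r (thead s) (tail s)).
Proof.
apply: measurable_funM; first by apply: measurable_funV; exact: measurable_thead.
apply: measurable_boolR; apply: measurable_and.
  apply: measurable_fun_ltr => //.
  apply: measurable_funM; last exact: measurable_prod_tail.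
  by apply: measurable_funX; exact: measurable_thead.
by apply: measurable_fun_ler => //; exact: measurable_thead.
Qed.

Lemma measurable_tail4_phi r n :
  measurable_fun [set: n.+1.-tuple R] (fun s => tail4_phi r (thead s) (tail s)).
Proof. by apply: measurable_boolR; apply: measurable_fun_ler => //; exact: measurable_thead. Qed.

Lemma measurable_shell_phi r n :
  measurable_fun [set: n.+1.-tuple R] (fun s => shell_phi r (thead s) (tail s)).
Proof.
have mw2 : measurable_fun [set: n.+1.-tuple R] (fun s : n.+1.-tuple R => (\prod_(y <- tail s) y) ^+ 2 : R).
  by apply: measurable_funX; exact: measurable_prod_tail.
have mx2 : measurable_fun [set: n.+1.-tuple R] (fun s : n.+1.-tuple R => (thead s) ^+ 2 : R).
  by apply: measurable_funX; exact: measurable_thead.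
have mS : measurable_fun [set: n.+1.-tuple R]
    (fun s : n.+1.-tuple R => r ^+ 2 - \sum_(i < n) tnth (tail s) i ^+ 2 : R).
  apply: measurable_funB => //; apply: measurable_sum => i; apply: measurable_funX.
  exact: measurableT_comp (@measurable_tnth _ R n i) (@measurable_tail R n).
apply: measurable_funM; first apply: measurable_funM => //; first exact: measurable_thead.
apply: measurable_boolR; apply: measurable_and; first exact: measurable_fun_ler.
apply: measurable_fun_ltr => //; apply: measurable_funB => //.
by apply: measurable_funM => //; apply: measurable_funV; exact: measurable_funM.
Qed.

Lemma integral_loss_le b r n C1 C2 C3 (phi : R -> n.-tuple R -> R) B :
  (0 < b)%N -> 0 < r -> 0 <= C1 -> 0 <= C2 -> 0 <= C3 -> 0 <= B ->
  measurable_fun [set: n.+1.-tuple R] (fun s => phi (thead s) (tail s)) ->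
  (forall x t, 0 < x -> positive t -> 0 <= phi x t) ->
  (forall t : n.-tuple R, (forall i, 0 < tnth t i <= r) ->
     (\int[leb]_x ((0 < x)%R%:R * phi x t)%:E <= B%:E)%E) ->
  (\int[L n.+1]_s (loss b r C1 C2 C3 phi s)%:E <=
    ((C1 + C2 * B + C3 * (n.+2%:R / r ^+ 2)) * r ^+ n)%:E)%E.
Proof.
move=> b0 r0 C10 C20 C30 B0 mphi phi0 H.
have m1 := measurable_ball_part r (@measurable_corner_phi b n).
have m2 := measurable_ball_part r mphi.
have m3 := measurable_ball_part r (@measurable_shell_phi r n).
have p1 := fun s => ball_part_ge0 r s (@corner_phi_ge0 R b n).
have p2 := fun s => ball_part_ge0 r s phi0.
have p3 := fun s => ball_part_ge0 r s (@shell_phi_ge0 R r n).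
have q0 : 0 <= n.+2%:R / r ^+ 2 by rewrite divr_ge0 ?sqr_ge0.
have i1 := integral_ball_part_le (@measurable_corner_phi b n) (@corner_phi_ge0 R b n) ler01 (ltW r0)
  (fun t => @corner_slice R b n r t b0).
have i2 := integral_ball_part_le mphi phi0 B0 (ltW r0) H.
have i3 := integral_ball_part_le (@measurable_shell_phi r n) (@shell_phi_ge0 R r n) q0 (ltW r0)
  (fun t => @shell_slice R n r t r0).
have scale C (f : n.+1.-tuple R -> R) B' : 0 <= C -> measurable_fun setT f -> (forall s, 0 <= f s) ->
    (\int[L n.+1]_s (f s)%:E <= B'%:E)%E -> (\int[L n.+1]_s (C * f s)%:E <= (C * B')%:E)%E.
  move=> C0 mf f0 fB; under eq_integral do rewrite EFinM.
  rewrite ge0_integralZl_EFin//; last 2 first.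
  - by move=> s _; rewrite lee_fin.
  - exact/measurable_EFinP.
  by rewrite EFinM lee_wpmul2l// lee_fin.
have E : (\int[L n.+1]_s (loss b r C1 C2 C3 phi s)%:E =
  \int[L n.+1]_s (C1 * ball_part r (corner_phi b (n := n)) s)%:E +
  \int[L n.+1]_s (C2 * ball_part r phi s)%:E +
  \int[L n.+1]_s (C3 * ball_part r (shell_phi r (n := n)) s)%:E)%E.
  have mE C (f : n.+1.-tuple R -> R) : measurable_fun setT f ->
      measurable_fun setT (fun s => (C * f s)%:E).
    by move=> mf; apply/measurable_EFinP; exact: measurable_funM.
  have pE C (f : n.+1.-tuple R -> R) : 0 <= C -> (forall s, 0 <= f s) ->
      forall s, setT s -> (0 <= (C * f s)%:E)%E.
    by move=> C0 f0 s _; rewrite lee_fin mulr_ge0.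
  rewrite -[in RHS](ge0_integralD (L n.+1) measurableT (pE _ _ C10 p1) (mE C1 _ m1) (pE _ _ C20 p2) (mE C2 _ m2)).
  rewrite -ge0_integralD//.
  - by move=> s _; rewrite adde_ge0// ?pE.
  - by apply: emeasurable_funD; exact: mE.
  - exact: pE.
  - exact: mE.
rewrite E (_ : (_ * r ^+ n) = C1 * (1 * r ^+ n) + C2 * (B * r ^+ n) + C3 * (n.+2%:R / r ^+ 2 * r ^+ n)); last first.
  by move: (n.+2%:R / r ^+ 2) (r ^+ n) => u v; ring.
rewrite !EFinD; apply: leeD; first apply: leeD; apply: scale => //.
Qed.

Lemma measurable_loss b r n C1 C2 C3 (phi : R -> n.-tuple R -> R) :
  measurable_fun [set: n.+1.-tuple R] (fun s => phi (thead s) (tail s)) ->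
  measurable_fun [set: n.+1.-tuple R] (loss b r C1 C2 C3 phi).
Proof.
move=> mphi; apply: measurable_funD; first apply: measurable_funD;
  apply: measurable_funM => //; apply: measurable_ball_part => //.
- exact: measurable_corner_phi.
- exact: measurable_shell_phi.
Qed.

Lemma integral_main_density_le b r n C2 C3 (phi : R -> n.-tuple R -> R) B :
  (0 < b)%N -> 0 < r -> 0 <= C2 -> 0 <= C3 -> 0 <= B ->
  measurable_fun [set: n.+1.-tuple R] (fun s => phi (thead s) (tail s)) ->
  (forall x t, 0 < x -> positive t -> 0 <= phi x t) ->
  (forall t : n.-tuple R, (forall i, 0 < tnth t i <= r) ->
     (\int[leb]_x ((0 < x)%R%:R * phi x t)%:E <= B%:E)%E) ->
  (forall x (t : n.-tuple R), (forall i, 0 < tnth (cons_tuple x t) i <= r) ->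
    1 < x ^+ 2 * \prod_(y <- t) y ->
    x ^+ (2 * b).-1 * (\prod_(y <- t) y) ^+ (4 * b).-1 * (x ^+ 2 * \prod_(y <- t) y) ^- 2
    <= C2 * phi x t) ->
  (forall x (t : n.-tuple R), (forall i, 0 < tnth (cons_tuple x t) i <= r) ->
    1 < x ^+ 2 * \prod_(y <- t) y ->
    (x * \prod_(y <- t) y) ^+ (2 * b).-1 <= C3 * (x * (\prod_(y <- t) y) ^+ 2)) ->
  (\int[L n.+1]_s (main_density b r s)%:E <=
   \int[L n.+1]_s (min_density b r ord0 s)%:E +
   (n.+1%:R * ((r ^+ (b * (n * n.-1) + n * (3 * b).-1) +
      (b * n.+1)%:R * r ^+ (b * (n * n.-1)) * C2 * B +
      r ^+ (b * (n.+1 * n)) * C3 * (n.+2%:R / r ^+ 2)) * r ^+ n))%:E)%E.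
Proof.
move=> b0 r0 C20 C30 B0 mphi phi0 H H2 H3.
set D1 := r ^+ (_ + _); set D2 := _ * C2; set D3 := _ * C3.
have rk k : 0 <= r ^+ k by rewrite exprn_ge0// ltW.
have D10 : 0 <= D1 by exact: rk.
have D20 : 0 <= D2 by rewrite !mulr_ge0.
have D30 : 0 <= D3 by rewrite mulr_ge0.
have ml : measurable_fun setT (loss b r D1 D2 D3 phi) by exact: measurable_loss.
have l0 s : 0 <= loss b r D1 D2 D3 phi s.
  by rewrite !addr_ge0// mulr_ge0// ball_part_ge0// => x t; [exact: corner_phi_ge0|exact: shell_phi_ge0].
have msw k : measurable_fun setT (fun s => loss b r D1 D2 D3 phi (swap k s)).
  exact: measurableT_comp ml (measurable_perm_tuple _).
have mm : measurable_fun setT (@min_density R b r n.+1 ord0) by exact: measurable_min_density.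
have LB := integral_loss_le b0 r0 D10 D20 D30 B0 mphi phi0 H.
apply: (@le_trans _ _ (\int[L n.+1]_s ((min_density b r ord0 s)%:E +
    \sum_u (loss b r D1 D2 D3 phi (swap u s))%:E))%E).
  apply: ge0_le_integral => //.
  - by move=> s _; rewrite lee_fin main_density_ge0.
  - by apply/measurable_EFinP; exact: measurable_main_density.
  - apply: emeasurable_funD; first exact/measurable_EFinP.
    by apply: emeasurable_sum => u; apply/measurable_EFinP; exact: msw.
  - move=> s _; rewrite sumEFin -EFinD lee_fin.
    exact: (main_density_le s b0 r0 C20 C30 phi0 H2 H3).
rewrite ge0_integralD//; last 4 first.
- by move=> s _; rewrite lee_fin min_density_ge0.
- exact/measurable_EFinP.
- by move=> s _; rewrite sume_ge0// => u _; rewrite lee_fin.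
- by apply: emeasurable_sum => u; apply/measurable_EFinP; exact: msw.
rewrite leeD2l// ge0_integral_sum//; last 2 first.
- by move=> u; apply/measurable_EFinP; exact: msw.
- by move=> u s _; rewrite lee_fin.
rewrite (eq_bigr (fun=> \int[L n.+1]_s (loss b r D1 D2 D3 phi s)%:E)%E); last first.
  move=> u _; apply: (ge0_integral_tperm u (f := fun s => (loss b r D1 D2 D3 phi s)%:E)) => //.
  exact/measurable_EFinP.
apply: (@le_trans _ _ (\sum_(u < n.+1) (((D1 + D2 * B + D3 * (n.+2%:R / r ^+ 2)) * r ^+ n)%R)%:E)%E).
  by apply: lee_sum => u _.
rewrite sumEFin sumr_const card_ord lee_fin; set X := _ * r ^+ n.
by rewrite mulr_natl.
Qed.

End total_error_integral.

(** * The orders of the errors for the three division algebras *)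

Section error_orders.
Context {R : realType}.
Local Notation L := (@lebesgue_tuple R).
Implicit Types (r : R).

(** The factor [n.+2] in the second hypothesis is that of [tail2_slice]; admitting it in all three
    cases gives one common constant. *)
Lemma total_error_le b r n (T1 T2 C2 B T3 C3 E : R) :
  T1 * r ^+ n <= E -> T2 * C2 * B * r ^+ n <= n.+2%:R * E ->
  T3 * C3 * r ^- 2 * r ^+ n <= E ->
  n.+1%:R * ((T1 + (b * n.+1)%:R * T2 * C2 * B + T3 * C3 * (n.+2%:R / r ^+ 2)) * r ^+ n) <=
  n.+1%:R * (1 + (b * n.+1)%:R * n.+2%:R + n.+2%:R) * E.
Proof.
move=> h1 h2 h3; rewrite -[leRHS]mulrA ler_wpM2l//.
have /(ler_wpM2l (ler0n R (b * n.+1))) := h2.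
have /(ler_wpM2l (ler0n R n.+2)) := h3.
move: h1; move: ((b * n.+1)%:R : R) (n.+2%:R : R) (r ^- 2) (r ^+ n) => q N u v h1 h3' h2'.
rewrite (_ : _ * v = T1 * v + q * (T2 * C2 * B * v) + N * (T3 * C3 * u * v)); last by ring.
by rewrite (_ : _ * E = E + q * (N * E) + N * E); [rewrite !lerD|ring].
Qed.

Lemma tail1_phi_ge0 n (x : R) (t : n.-tuple R) : 0 < x -> positive t -> 0 <= tail1_phi x t.
Proof.
move=> x0 /positive_prod w0; rewrite /tail1_phi !mulr_ge0// invr_ge0 ?exprn_ge0 ?ltW//.
Qed.

Lemma tail2_phi_ge0 r n (x : R) (t : n.-tuple R) : 0 < x -> positive t -> 0 <= tail2_phi r x t.
Proof. by move=> x0 _; rewrite /tail2_phi mulr_ge0// invr_ge0 ltW. Qed.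

(** With [N = n + 2], the three errors have the same power of [r] if [beta] is 1 or 2, while for
    [beta = 4] the corner is of lower order ([e41]). The assumption on [r] gives [ln r >= 1], which
    for [beta = 2] absorbs the errors without a logarithm. *)
Lemma integral_main_density_error (F : division_algebra) n r : expR 1 <= r ->
  (\int[L n.+1]_s (main_density (beta F) r s)%:E <=
   \int[L n.+1]_s (min_density (beta F) r ord0 s)%:E +
   (n.+1%:R * (1 + (beta F * n.+1)%:R * n.+2%:R + n.+2%:R) * error_term F n.+2 r)%:E)%E.
Proof.
have e11 : (1 * (n * n.-1) + n * (3 * 1).-1 + n = n.+2 * (n.+2 - 2))%N by case: (n) => // k; rewrite -pred_Sn; lia.
have e12 : (1 * (n * n.-1) + 2 * n + n = n.+2 * (n.+2 - 2))%N by case: (n) => // k; rewrite -pred_Sn; lia.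
have e13 : (1 * (n.+1 * n) + n = n.+2 * (n.+2 - 2))%N by lia.
have e21 : (2 * (n * n.-1) + n * (3 * 2).-1 + n = 2 * n.+2 * (n.+2 - 2))%N by case: (n) => // k; rewrite -pred_Sn; lia.
have e22 : (2 * (n * n.-1) + 5 * n + n = 2 * n.+2 * (n.+2 - 2))%N by case: (n) => // k; rewrite -pred_Sn; lia.
have e23 : (2 * (n.+1 * n) + n + n = 2 * n.+2 * (n.+2 - 2))%N by lia.
have e4 : (4 * n.+2 * (n.+2 - 1) - 2 * n.+2 = 4 * (n * n) + 10 * n + 4)%N.
  rewrite subn1 (_ : (4 * n.+2 * n.+2.-1 = 4 * (n * n) + 10 * n + 4 + 2 * n.+2)%N) ?addnK//=; lia.
have e41 : (4 * (n * n.-1) + n * (3 * 4).-1 + n <= 4 * (n * n) + 10 * n + 4)%N by case: (n) => // k; rewrite -pred_Sn; lia.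
have e42 : (4 * (n * n.-1) + (13 * n + 3) + 1 + n = 4 * (n * n) + 10 * n + 4)%N by case: (n) => // k; rewrite -pred_Sn; lia.
have e43 : (4 * (n.+1 * n) + (5 * n + 4) + n = 4 * (n * n) + 10 * n + 4)%N by lia.
move=> er; have r1 : 1 <= r by apply: le_trans er; rewrite -expR0 ler_expR.
have r0 : 0 < r by exact: lt_le_trans r1.
have rk k : 0 <= r ^+ k by rewrite exprn_ge0// ltW.
have lnr : 1 <= ln r by rewrite -[1]expRK ler_ln ?posrE// expR_gt0.
have rV k : r ^+ k.+2 * r ^- 2 = r ^+ k.
  by rewrite -addn2 exprD mulfK// expf_neq0// gt_eqF.
have bd (x : R) (t : n.-tuple R) : (forall i, 0 < tnth (cons_tuple x t) i <= r) ->
    [/\ 0 < x, x <= r, 0 < \prod_(y <- t) y & \prod_(y <- t) y <= r ^+ n].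
  move=> H; have tr i : 0 < tnth t i <= r by have := H (lift ord0 i); rewrite tnth_consS.
  have /andP[x0 xr] := H ord0; rewrite tnth_cons0 in x0 xr; split=> //.
    by apply: positive_prod; apply/positiveP => i; have /andP[] := tr i.
  exact: prod_le_pow.
case: F => /=.
(* The relative error is [w x^(-3)], which is [w^2] times the profile, and [w <= r^n]. For the
   shell, [x w <= x^2 (x w^2)] because [x^2 w > 1]. *)
- apply: (le_trans (@integral_main_density_le R 1 r n (r ^+ (2 * n)) (r ^+ 2) (@tail1_phi R n) 1
    isT r0 (rk _) (rk _) ler01 (@measurable_tail1_phi R n) (@tail1_phi_ge0 n)
    (@tail1_slice R n r) _ _)).
  + move=> x t /bd[]; rewrite /tail1_phi; move: (\prod_(y <- t) y) => w x0 xr w0 wr xw.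
    rewrite xw mulr1 expr1.
    have E (a c : R) : a != 0 -> c != 0 -> a * c ^+ 3 * (a ^+ 2 * c) ^- 2 = c ^+ 2 * (a ^- 3 * c^-1).
      by move=> ? ?; field; apply/andP.
    rewrite E ?gt_eqF// mulnC exprM ler_wpM2r//.
      by rewrite mulr_ge0 ?invr_ge0 ?exprn_ge0 ?(ltW x0) ?(ltW w0).
    by rewrite ler_sqr ?nnegrE ?rk ?(ltW w0).
  + move=> x t /bd[]; move: (\prod_(y <- t) y) => w x0 xr w0 wr xw; rewrite expr1.
    have xr2 : x ^+ 2 <= r ^+ 2 by rewrite ler_sqr ?nnegrE ?(ltW x0) ?(ltW r0).
    apply: (@le_trans _ _ (x ^+ 2 * (x * w ^+ 2))).
      rewrite (_ : x ^+ 2 * (x * w ^+ 2) = (x * w) * (x ^+ 2 * w)); last by ring.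
      by rewrite ler_peMr ?mulr_ge0 ?(ltW x0) ?(ltW w0) ?(ltW xw).
    by rewrite ler_wpM2r// (mulr_ge0 (ltW x0) (sqr_ge0 _)).
  + rewrite leeD2l// lee_fin; apply: total_error_le.
    * by rewrite -exprD e11.
    * by rewrite mulr1 -!exprD e12 ler_peMl ?rk// ler1n.
    * by rewrite mulfK ?expf_neq0 ?gt_eqF// -exprD e13.
(* The relative error is [w^5 / x], and for the shell [(x w)^3 = (x^2 w)(x w^2)]. *)
- apply: (le_trans (@integral_main_density_le R 2 r n (r ^+ (5 * n)) (r ^+ n.+2) (@tail2_phi R r n)
    (n.+2%:R * ln r) isT r0 (rk _) (rk _) (mulr_ge0 (ler0n _ _) (le_trans ler01 lnr))
    (@measurable_tail2_phi R r n) (@tail2_phi_ge0 r n) (fun t => @tail2_slice R n r t r1) _ _)).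
  + move=> x t /bd[]; rewrite /tail2_phi; move: (\prod_(y <- t) y) => w x0 xr w0 wr xw.
    rewrite xw xr mulr1.
    have E (a c : R) : a != 0 -> c != 0 -> a ^+ 3 * c ^+ 7 * (a ^+ 2 * c) ^- 2 = c ^+ 5 * a^-1.
      by move=> ? ?; field; apply/andP.
    rewrite [X in X <= _](E x w) ?gt_eqF// mulnC exprM ler_wpM2r ?invr_ge0 ?(ltW x0)//.
    by apply: lerXn2r; rewrite ?nnegrE ?rk ?(ltW w0).
  + move=> x t /bd[]; move: (\prod_(y <- t) y) => w x0 xr w0 wr xw.
    rewrite (_ : (x * w) ^+ (2 * 2).-1 = x ^+ 2 * w * (x * w ^+ 2)); last by rewrite /=; ring.
    rewrite ler_wpM2r ?(mulr_ge0 (ltW x0) (sqr_ge0 _))// (_ : r ^+ n.+2 = r ^+ 2 * r ^+ n); last by rewrite -exprD.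
    by apply: ler_pM; rewrite ?sqr_ge0 ?(ltW w0)// ler_sqr ?nnegrE ?(ltW x0) ?(ltW r0).
  + rewrite leeD2l// lee_fin; apply: total_error_le.
    * by rewrite -exprD e21 ler_peMr.
    * by rewrite -exprD mulrAC mulrCA -exprD e22.
    * by rewrite -(mulrA _ (r ^+ _.+2)) rV -!exprD e23 ler_peMr.
(* The relative error is [w^13 x^3], bounded by its value at [x = r], [w = r^n]; for the shell
   [(x w)^7 = (w^5 x^6)(x w^2)]. *)
- apply: (le_trans (@integral_main_density_le R 4 r n (r ^+ (13 * n + 3)) (r ^+ (5 * n + 4).+2)
    (@tail4_phi R n r) r isT r0 (rk _) (rk _) (ltW r0)
    (@measurable_tail4_phi R r n) (fun x t _ _ => ler0n R _) (fun t _ => @tail4_slice R n r t (ltW r0)) _ _)).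
  + move=> x t /bd[]; rewrite /tail4_phi; move: (\prod_(y <- t) y) => w x0 xr w0 wr xw.
    rewrite xr mulr1.
    have E (a c : R) : a != 0 -> c != 0 -> a ^+ 7 * c ^+ 15 * (a ^+ 2 * c) ^- 2 = c ^+ 13 * a ^+ 3.
      by move=> ? ?; field; apply/andP.
    rewrite [X in X <= _](E x w) ?gt_eqF// mulnC exprD exprM.
    by apply: ler_pM; rewrite ?exprn_ge0 ?(ltW x0) ?(ltW w0)//; apply: lerXn2r; rewrite ?nnegrE ?rk ?(ltW w0) ?(ltW x0) ?(ltW r0).
  + move=> x t /bd[]; move: (\prod_(y <- t) y) => w x0 xr w0 wr xw.
    rewrite (_ : (x * w) ^+ (2 * 4).-1 = w ^+ 5 * x ^+ 6 * (x * w ^+ 2)); last by rewrite /=; ring.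
    rewrite ler_wpM2r ?(mulr_ge0 (ltW x0) (sqr_ge0 _))//.
    have -> : r ^+ (5 * n + 4).+2 = (r ^+ n) ^+ 5 * r ^+ 6 by rewrite -exprM -exprD mulnC -!addnS.
    by apply: ler_pM; rewrite ?exprn_ge0 ?(ltW x0) ?(ltW w0)//; apply: lerXn2r; rewrite ?nnegrE ?rk ?(ltW w0) ?(ltW x0) ?(ltW r0).
  + rewrite leeD2l// lee_fin e4; apply: total_error_le.
    * by rewrite -exprD ler_weXn2l.
    * have -> : r ^+ (4 * (n * n.-1)) * r ^+ (13 * n + 3) * r * r ^+ n = r ^+ (4 * (n * n) + 10 * n + 4).
        by rewrite -exprD -[X in _ * X * _]expr1 -!exprD e42.
      by rewrite ler_peMl ?rk// ler1n.
    * by rewrite -(mulrA _ (r ^+ _.+2)) rV -!exprD e43.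
Qed.

End error_orders.

(** * The leading constant and the asymptotics *)

Section layer_cake.
Context {R : realType}.
Local Notation leb := (@lebesgue_measure R).
Local Notation L := (@lebesgue_tuple R).
Implicit Types (r : R).

Lemma vandermonde_abs_homo b n (c : R) (s : n.-tuple R) : 0 < c ->
  vandermonde_abs b (map_tuple ( *%R c) s) = c ^+ (b * (n * n.-1)) * vandermonde_abs b s.
Proof.
move=> c0; elim: n s => [|n IH] s.
  by rewrite muln0 expr0 mul1r /vandermonde_abs !big_ord0.
case/tupleP: s => x t.
rewrite (_ : map_tuple _ _ = cons_tuple (c * x) (map_tuple ( *%R c) t)); last exact: val_inj.
rewrite !vandermonde_abs_cons IH.
rewrite (_ : \prod_(i < n) _ = c ^+ (2 * b * n) * \prod_(i < n) `|x ^+ 2 - tnth t i ^+ 2| ^+ b); last first.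
  rewrite (eq_bigr (fun i => c ^+ (2 * b) * `|x ^+ 2 - tnth t i ^+ 2| ^+ b)).
    by rewrite big_split/= prodr_const card_ord -exprM.
  by move=> i _; rewrite tnth_map !exprMn -mulrBr normrM exprMn ger0_norm ?sqr_ge0// exprM.
rewrite mulrACA -exprD; congr (c ^+ _ * _).
by case: (n) => [|k] /=; [rewrite !muln0|nia].
Qed.

Lemma main_density_homo b n r (s : n.-tuple R) : 0 < r ->
  main_density b r (map_tuple ( *%R r) s) =
  r ^+ (n * (2 * b).-1 + b * (n * n.-1)) * main_density b 1 s.
Proof.
move=> r0; rewrite /main_density.
have -> : positive (map_tuple ( *%R r) s) = positive s.
  apply/positiveP/positiveP => H i; have := H i; rewrite tnth_map.
    by rewrite pmulr_rgt0.
  by move=> h; rewrite mulr_gt0.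
have -> : in_ball r (map_tuple ( *%R r) s) = in_ball 1 s.
  rewrite /in_ball expr1n; under eq_bigr do rewrite tnth_map exprMn.
  by rewrite -mulr_sumr -ler_pdivlMl ?exprn_gt0// mulVf// expf_neq0// gt_eqF.
have -> : \prod_(x <- map_tuple ( *%R r) s) x = r ^+ n * \prod_(x <- s) x.
  rewrite !big_tuple (eq_bigr (fun i => r * tnth s i)); last by move=> i _; rewrite tnth_map.
  by rewrite big_split/= prodr_const card_ord.
rewrite vandermonde_abs_homo// exprMn exprD (exprM r n).
by move: (_ ^+ (2 * b).-1) (_ ^+ (2 * b).-1) (r ^+ (b * _)) => x y z; ring.
Qed.

Lemma integral_main_density_homo b n r : (0 < b)%N -> 0 < r ->
  (\int[L n]_s (main_density b r s)%:E =
   (r ^+ (b * n * n.+1))%:E * \int[L n]_s (main_density b 1 s)%:E)%E.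
Proof.
move=> b0 r0.
have nE : (n + (n * (2 * b).-1 + b * (n * n.-1)) = b * n * n.+1)%N.
  by case: b b0 => // b _; case: n => [|n]; rewrite ?muln0 // mulnS /=; nia.
rewrite -(ge0_integral_tuple_scale r0 (@measurable_main_density R b r n) (@main_density_ge0 R b r n)).
rewrite -ge0_integralZl_EFin ?exprn_ge0 ?(ltW r0)//.
- by apply: eq_integral => s _; rewrite main_density_homo// mulrA -exprD nE EFinM.
- by move=> s _; rewrite lee_fin main_density_ge0.
- by apply/measurable_EFinP; exact: measurable_main_density.
Qed.

Lemma integral_expRN_y (a : R) : (\int[leb]_(x in `[a, +oo[) (expR (- x))%:E = (expR (- a))%:E)%E.
Proof.
have dF (x : R) : is_derive x 1 (fun y : R => - expR (- y)) (expR (- x)).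
  by apply: is_derive_eq; rewrite mulrN1 opprK.
rewrite (@ge0_continuous_FTC2y _ (fun x => expR (- x)) (fun x => - expR (- x)) a 0).
- by rewrite -EFinB sub0r opprK.
- by move=> x ax; rewrite expR_ge0.
- apply: continuous_subspaceT => x.
  by apply: continuous_comp; [exact: oppr_continuous|exact: continuous_expR].
- rewrite -oppr0; apply: cvgN; exact: cvgr_expR.
- by move=> x ax; have [] := dF x.
- apply: cvg_at_right_filter; apply: cvgN.
  by apply: continuous_comp; [exact: oppr_continuous|exact: continuous_expR].
- by move=> x _; rewrite derive1E; have [_ ->] := dF x.
Qed.

(** With [y = r^2] this is the integral of [exp(- y)] over [y >= q]: the Gaussian weight is a
    mixture of indicators of balls. *)
Lemma integral_gauss_layers (q : R) : 0 < q ->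
  (\int[leb]_r ((0 < r)%R%:R * (2 * r) * (expR (- r ^+ 2) * (q <= r ^+ 2)%R%:R))%:E =
   (expR (- q))%:E)%E.
Proof.
move=> q0; pose f (y : R) := expR (- y) * (q <= y)%R%:R.
have mf : measurable_fun [set: R] f.
  apply: measurable_funM; first by apply: measurableT_comp => //.
  by apply: measurable_boolR; exact: measurable_fun_ler.
rewrite (ge0_integral_sqr mf); last by move=> x; rewrite /f mulr_ge0 ?expR_ge0.
rewrite -integral_expRN_y [RHS]integral_mkcond; apply: eq_integral => x _.
rewrite patchE mem_setE/= in_itv/= andbT /f; case: ifPn => qx; last by rewrite !mulr0.
by rewrite (lt_le_trans q0 qx) mul1r mulr1.
Qed.

Lemma gauss_selberg_layers b n (s : n.+1.-tuple R) :
  ((gauss_weight s * selberg_weight b (2 * b).-1 s)%:E =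
   \int[leb]_r ((0 < r)%R%:R * (2 * r) * expR (- r ^+ 2) * main_density b r s)%:E)%E.
Proof.
have q0 : positive s -> 0 < \sum_(i < n.+1) tnth s i ^+ 2.
  move=> /positiveP s0; rewrite big_ord_recl ltr_pwDl ?exprn_gt0// sumr_ge0// => i _.
  exact: sqr_ge0.
rewrite /gauss_weight /main_density /in_ball; have [s0|_] := boolP (positive s); last first.
  rewrite !mul0r; under eq_integral do rewrite !mul0r mulr0.
  by rewrite integral0.
set q := \sum_(i < n.+1) _ in q0 *; have {}q0 := q0 s0; rewrite mul1r /selberg_weight.
rewrite prodrXl (_ : \prod_(i < n.+1) tnth s i = \prod_(x <- s) x); last by rewrite big_tuple.
set c := _ * vandermonde_abs _ _.
have c0 : 0 <= c by rewrite mulr_ge0 ?vandermonde_abs_ge0// exprn_ge0// ltW// positive_prod.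
rewrite mulrC EFinM -integral_gauss_layers//.
rewrite -ge0_integralZl_EFin//.
- apply: eq_integral => r _; rewrite -EFinM; congr EFin.
  have F (x y u w : R) : x * (y * (u * w)) = y * u * (true%:R * w * x) by rewrite mul1r; ring.
  exact: F.
- move=> r _; rewrite lee_fin; have [r0|_] := ltP 0 r; last by rewrite !mul0r.
  by rewrite mul1r !mulr_ge0 ?expR_ge0// ltW.
- apply/measurable_EFinP; apply: measurable_funM.
    apply: measurable_funM; first exact: measurable_gt0.
    exact: measurable_funM.
  apply: measurable_funM; first by do 2!apply: measurableT_comp => //; exact: measurable_funX.
  by apply: measurable_boolR; apply: measurable_fun_ler => //; exact: measurable_funX.
Qed.

(** By homogeneity of degree [d = b (n + 1)(n + 2)], integrating over [r] against [2 r exp(- r^2)]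
    multiplies the value at [r = 1] by [Gamma(d / 2 + 1)]; by [gauss_selberg_layers] the outcome is
    the Selberg integral. *)
Lemma integral_main_density1 b n : (0 < b)%N ->
  (\int[L n.+1]_s (main_density b 1 s)%:E =
   (selberg b (2 * b).-1 n.+1 / Gamma ((b * n.+1 * n.+2).+2%:R / 2))%:E)%E.
Proof.
move=> b0; set d := (b * n.+1 * n.+2)%N; set M := (\int[_]_s _)%E.
have M0 : (0 <= M)%E by apply: integral_ge0 => s _; rewrite lee_fin main_density_ge0.
have G0 : 0 < Gamma (d.+2%:R / 2) :> R by exact: Gamma_half_gt0.
have k0 r : 0 <= (0 < r)%R%:R * (2 * r) * expR (- r ^+ 2) :> R.
  have [r0|_] := ltP 0 r; last by rewrite !mul0r.
  by rewrite mul1r !mulr_ge0 ?expR_ge0// ltW.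
have mk : measurable_fun [set: R] (fun r : R => (0 < r)%R%:R * (2 * r) * expR (- r ^+ 2)).
  apply: measurable_funM; last by do 2!apply: measurableT_comp => //; exact: measurable_funX.
  by apply: measurable_funM; [exact: measurable_gt0|exact: measurable_funM].
(* Stated in the extended reals: that [M] is finite comes out only on division by the Gamma
   value. *)
have E : ((selberg b (2 * b).-1 n.+1)%:E = (Gamma (d.+2%:R / 2))%:E * M)%E.
  rewrite /selberg -gauss_meanE; last exact: poly_bounded_selberg_weight.
  under eq_integral do rewrite gauss_selberg_layers.
  rewrite (@fubini_tonelli _ _ _ _ R (L n.+1) leb (fun p => ((0 < p.2)%R%:R * (2 * p.2) * expR (- p.2 ^+ 2) * main_density b p.2 p.1)%:E)); last 2 first.
  - apply/measurable_EFinP; apply: measurable_funM.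
      exact: measurableT_comp mk measurable_snd.
    apply: measurable_funM; apply: measurable_funM.
    + by apply: measurable_boolR; apply: measurableT_comp => //; exact: measurable_positive.
    + apply: measurable_boolR; apply: measurable_fun_ler.
        apply: measurable_sum => i; apply: measurable_funX.
        exact: measurableT_comp (@measurable_tnth _ R n.+1 i) measurable_fst.
      by apply: measurable_funX; exact: measurable_snd.
    + by apply: measurable_funX; exact: measurableT_comp (@measurable_prod_tuple R n.+1) measurable_fst.
    + exact: measurableT_comp (@measurable_vandermonde_abs R b n.+1) measurable_fst.
  - by move=> p; rewrite lee_fin mulr_ge0// main_density_ge0.
  have step r : (\int[L n.+1]_s ((0 < r)%R%:R * (2 * r) * expR (- r ^+ 2) * main_density b r s)%:E =
      (2 * ((0 < r)%R%:R * (r ^+ d.+1 * expR (- r ^+ 2))))%:E * M)%E.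
    under eq_integral do rewrite EFinM.
    rewrite ge0_integralZl_EFin//; last 2 first.
    - by move=> s _; rewrite lee_fin main_density_ge0.
    - by apply/measurable_EFinP; exact: measurable_main_density.
    have [r0|_] := ltP 0 r; last by rewrite !mul0r mulr0 !mul0e.
    rewrite integral_main_density_homo// -/d -/M muleA -EFinM; congr (_%:E * M)%E.
    by rewrite !mul1r (exprS r d); move: (r ^+ d) (expR _) => u v; ring.
  under eq_integral => r _ do rewrite step.
  rewrite ge0_integralZr//; last 2 first.
  - apply/measurable_EFinP; apply: measurable_funM => //; apply: measurable_funM.
      exact: measurable_gt0.
    by apply: measurable_funM => //; do 2!apply: measurableT_comp => //; exact: measurable_funX.
  - move=> r _; rewrite lee_fin mulr_ge0//; have [r0|_] := ltP 0 r; last by rewrite !mul0r.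
    by rewrite mul1r !mulr_ge0 ?expR_ge0 ?exprn_ge0 ?ltW.
  congr (_ * M)%E; rewrite (Gamma_half 1)// EFinM selberg1E -ge0_integralZl_EFin//.
  - move=> r _; rewrite lee_fin; have [r0|_] := ltP 0 r; last by rewrite !mul0r.
    by rewrite mul1r !mulr_ge0 ?expR_ge0 ?exprn_ge0 ?ltW.
  - apply/measurable_EFinP; apply: measurable_funM; first exact: measurable_gt0.
    by apply: measurable_funM => //; do 2!apply: measurableT_comp => //; exact: measurable_funX.
have : ((Gamma (d.+2%:R / 2))^-1%:E * (selberg b (2 * b).-1 n.+1)%:E = M)%E.
  by rewrite E muleA -EFinM mulVf ?mul1e// gt_eqF.
by move=> <-; rewrite -EFinM mulrC.
Qed.

End layer_cake.

(** * Constants and asymptotics *)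

Section asymptotics.
Context {R : realType}.
Local Notation L := (@lebesgue_tuple R).
Implicit Types (r : R) (F : division_algebra).

(* Cyclic shift, as [full] puts the dependent entry first and [complete_sigma] last. *)
Lemma complete_sigma_full n (s : n.+1.-tuple R) (j : 'I_n.+2) :
  @complete_sigma R n.+2 s j = tnth (full s) (ordS j).
Proof.
rewrite /complete_sigma (tnth_nth (\prod_(x <- s) x)^-1)/=.
have [jn|] := ltnP j n.+1; first by rewrite modn_small.
move=> nj; have -> : j = n.+1 :> nat by apply/eqP; rewrite eqn_leq nj -ltnS ltn_ord.
by rewrite modnn/= nth_default// size_tuple.
Qed.

(** The Vandermonde product and the ball are unaffected by the cyclic shift between [complete_sigma]
    and [full]; symmetry then contributes the factor [N = n.+2]. *)
Lemma I_hat_min_density F n r :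
  I_hat F n.+2 r =
  n.+2`!%:R^-1 * fine (n.+2%:R%:E * \int[L n.+1]_s (min_density (beta F) r ord0 s)%:E)%E.
Proof.
rewrite /I_hat -integral_sl_density; last by case: F.
congr (_ * fine _); rewrite integral_mkcond; apply: eq_integral => s _.
pose sg := perm (@ordS_inj n.+2).
have cE (j : 'I_n.+2) : @complete_sigma R n.+2 s j = tnth (perm_tuple sg (full s)) j.
  by rewrite complete_sigma_full tnth_mktuple permE.
have VE : \prod_(j < n.+2) \prod_(k < n.+2 | (j < k)%N)
    `|@complete_sigma R n.+2 s j ^+ 2 - @complete_sigma R n.+2 s k ^+ 2| ^+ beta F = vandermonde_abs (beta F) (full s).
  rewrite -(vandermonde_abs_perm _ sg) /vandermonde_abs.
  by apply: eq_bigr => j _; apply: eq_bigr => k _; rewrite !cE.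
have BE : \sum_(j < n.+2) @complete_sigma R n.+2 s j ^+ 2 <= r ^+ 2 = in_ball r (full s).
  by rewrite -(in_ball_perm r sg) /in_ball; congr (_ <= _); apply: eq_bigr => j _; rewrite cE.
rewrite patchE; case: ifPn => [|/negP] sr.
  move: sr; rewrite inE => -[/positiveP s0 br].
  by rewrite /sl_density s0 -BE br mulr1 mul1r -VE.
congr EFin; rewrite /sl_density; have [s0|] := boolP (positive s); last by rewrite !mul0r.
case: (boolP (in_ball r (full s))) => br; last by rewrite !mulr0.
by exfalso; apply: sr; rewrite inE; split; [exact/positiveP|rewrite BE].
Qed.

Lemma half_add1 k : k%:R / 2 + 1 = k.+2%:R / 2 :> R.
Proof. by rewrite -(addn2 k) natrD mulrDl divff. Qed.

Lemma C_hatE F n : C_hat R F n.+2 =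
  n.+2`!%:R^-1 * (n.+2%:R * (selberg (beta F) (2 * beta F).-1 n.+1 /
     Gamma ((beta F * n.+1 * n.+2).+2%:R / 2))).
Proof.
have b0 : (0 < beta F)%N by case: F.
rewrite /C_hat selberg_closed// subn1 [n.+2.-1]/=.
rewrite (_ : (beta F * n.+2 * n.+1)%:R / 2 + 1 = (beta F * n.+1 * n.+2).+2%:R / 2 :> R); last first.
  by rewrite half_add1 mulnAC.
rewrite (factS n.+1) (natrM _ n.+2) (exprS 2 n.+1).
have f0 : n.+1`!%:R != 0 :> R by rewrite pnatr_eq0 -lt0n fact_gt0.
have t0 : 2 ^+ n.+1 != 0 :> R by rewrite expf_neq0.
have G1 : Gamma ((beta F * n.+1 * n.+2).+2%:R / 2) != 0 :> R by rewrite gt_eqF// Gamma_half_gt0.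
have G2 : Gamma ((beta F * n.+2)%:R / 2) != 0 :> R by rewrite gt_eqF// Gamma_half_gt0// muln_gt0 b0.
have n0 : n.+2%:R != 0 :> R by rewrite pnatr_eq0.
have E (f t a c m p : R) : f != 0 -> t != 0 -> a != 0 -> c != 0 -> m != 0 ->
    2 / (2 * t * a) * c^-1 * p = (m * f)^-1 * (m * (f / t / c * p / a)).
  by move=> *; field; rewrite ?mulf_neq0//; do ?[apply/andP; split].
exact: E.
Qed.

(** By [C_hatE] and homogeneity the leading term is exactly [N / N!] times the integral of
    [main_density], so the difference is nonpositive and [integral_main_density_error] bounds it. *)
Lemma I_hat_error F n r : expR 1 <= r ->
  `|I_hat F n.+2 r - C_hat R F n.+2 * r ^+ (beta F * n.+2 * (n.+2 - 1))| <=
  n.+2`!%:R^-1 * n.+2%:R *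
    (n.+1%:R * (1 + (beta F * n.+1)%:R * n.+2%:R + n.+2%:R)) * `|error_term F n.+2 r|.
Proof.
move=> er; have r0 : 0 < r by apply: lt_le_trans er; exact: expR_gt0.
have b0 : (0 < beta F)%N by case: F.
have LE := integral_main_density_error F n er.
have min0 : (0 <= \int[L n.+1]_s (min_density (beta F) r ord0 s)%:E)%E.
  by apply: integral_ge0 => s _; rewrite lee_fin min_density_ge0.
have min_main : (\int[L n.+1]_s (min_density (beta F) r ord0 s)%:E <=
    \int[L n.+1]_s (main_density (beta F) r s)%:E)%E.
  apply: ge0_le_integral => //.
  - by move=> s _; rewrite lee_fin min_density_ge0.
  - by apply/measurable_EFinP; exact: measurable_min_density.
  - by apply/measurable_EFinP; exact: measurable_main_density.
  - by move=> s _; rewrite lee_fin min_density_le_main.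
rewrite I_hat_min_density C_hatE subn1 [n.+2.-1]/= [(beta F * n.+2 * n.+1)%N]mulnAC.
move: LE min_main min0; rewrite integral_main_density_homo// integral_main_density1//.
set m := selberg _ _ _ / _; set D := r ^+ _; set K := n.+1%:R * _.
set I := (\int[_]_s (min_density _ _ _ s)%:E)%E; rewrite -EFinM => LE min_main min0.
have fI : I \is a fin_num by rewrite ge0_fin_numE//; apply: le_lt_trans min_main (ltry _).
move: LE min_main min0; rewrite -(fineK fI); move: (fine I) => i.
rewrite -EFinD !lee_fin -EFinM/= => LE min_main min0.
have F0 : 0 <= n.+2`!%:R^-1 * n.+2%:R :> R by rewrite mulr_ge0.
rewrite (_ : _ - _ = n.+2`!%:R^-1 * n.+2%:R * (i - D * m)); last by ring.
rewrite normrM ger0_norm// -[leRHS]mulrA ler_wpM2l// ler0_norm ?subr_le0// opprB.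
rewrite lerBlDl; apply: (le_trans LE); rewrite lerD2l ler_wpM2l ?ler_norm//.
by rewrite mulr_ge0// !addr_ge0// mulr_ge0.
Qed.

Lemma pi_powR_half k : pi `^ (k%:R / 2) = (pi `^ 2^-1) ^+ k :> R.
Proof. by rewrite mulrC powRrM powR_mulrn// powR_ge0. Qed.

(** Applied with [g k = Gamma(k / 2)] and [y] the square root of pi: the Gamma factors in the square
    of [vol_U] cancel the squares in [C_hat]. *)
Lemma prod_sqr_cancel (g : nat -> R) (y : R) b N : (forall k, (0 < k)%N -> g k != 0) -> (0 < b)%N ->
  (\prod_(1 <= k < N.+1) (y ^+ (b * k) / g (b * k)%N)) ^+ 2 *
    \prod_(1 <= k < N.+1) (g (b * k)%N ^+ 2 / g b) = y ^+ (b * (N * N.+1)) / g b ^+ N.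
Proof.
move=> g0 b0; elim: N => [|N IH]; first by rewrite !big_nil muln0 !expr0 expr1n mulr1 divr1.
rewrite big_nat_recr//= [X in _ * X = _]big_nat_recr//= exprMn mulrACA IH.
have gb := g0 _ b0; have gN : g (b * N.+1)%N != 0 by apply: g0; rewrite muln_gt0 b0.
have -> : y ^+ (b * (N.+1 * N.+2)) = y ^+ (b * (N * N.+1)) * (y ^+ (b * N.+1)) ^+ 2.
  by rewrite -exprM -exprD; congr (y ^+ _); lia.
rewrite (exprS (g b)); move: (y ^+ _) (y ^+ _) (g b ^+ N) (expf_neq0 N gb) => u v w w0.
by field; rewrite w0 gN gb.
Qed.

Lemma vol_constantE F n :
  (2 * pi `^ ((beta F)%:R / 2) / Gamma ((beta F)%:R / 2)) ^- n.+3 *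
     vol_U R F n.+2 ^+ 2 * C_hat R F n.+2 = vol_constant R F n.+2.
Proof.
have b0 : (0 < beta F)%N by case: F.
have G0 k : (0 < k)%N -> Gamma (k%:R / 2) != 0 :> R by move=> k0; rewrite gt_eqF// Gamma_half_gt0.
rewrite /vol_U /C_hat /vol_constant.
have := @prod_sqr_cancel (fun k => Gamma (k%:R / 2)) (pi `^ 2^-1) (beta F) n.+2 G0 b0.
under eq_bigr do rewrite -pi_powR_half.
rewrite !pi_powR_half; set y := pi `^ _.
have y0 : y != 0 by rewrite gt_eqF// powR_gt0// pi_gt0.
(* [N (N + 1) = (N^2 - 1) + (N + 1)]: the second summand cancels against the normalising factor of
   exponent [N + 1]. *)
rewrite (_ : y ^+ (beta F * (n.+2 * n.+3)) = y ^+ (beta F * (n.+2 ^ 2 - 1)) * (y ^+ beta F) ^+ n.+3); last first.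
  rewrite -exprM -exprD -mulnDr; congr (y ^+ (_ * _)).
  by rewrite -mulnn; lia.
set P := \prod_(_ <= _ < _) _; set Q := \prod_(_ <= _ < _) _ => PQ; clearbody P Q.
have GD : Gamma ((beta F * n.+2 * (n.+2 - 1))%:R / 2 + 1) != 0 :> R.
  by rewrite half_add1 G0.
have GN : Gamma ((beta F * n.+2)%:R / 2) != 0 :> R by rewrite G0// muln_gt0 b0.
have Gb := G0 _ b0; move: Gb GN GD PQ.
move: (Gamma _) (Gamma _) (Gamma _) => GD GN G Gb GN0 GD0 PQ.
have Yb : y ^+ beta F != 0 by rewrite expf_neq0.
have E (a g Y T : R) : a != 0 -> g != 0 -> Y != 0 -> P ^+ 2 * Q = T * Y / g ->
    (2 * a * Y / (G * g))^-1 * (a * P) ^+ 2 * (2 / (a * GD) * GN^-1 * Q) = T * G / (GN * GD).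
  move=> a0 g0 Y0 PQ'.
  have A (u v w : R) : u * (a * P) ^+ 2 * (v * w * Q) = P ^+ 2 * Q * (u * a ^+ 2 * (v * w)).
    by ring.
  by rewrite A PQ'; field; rewrite a0 g0 Y0 Gb GN0 GD0.
have YN : (y ^+ beta F) ^+ n.+3 != 0 by rewrite expf_neq0.
have t0 : 2 ^+ n.+2 != 0 :> R by rewrite expf_neq0.
rewrite -(E _ _ _ _ t0 (expf_neq0 n.+2 Gb) YN PQ).
by rewrite exprMn exprVn exprMn (exprS 2) (exprS G).
Qed.

End asymptotics.

Lemma eqaddO_pinfty (R : realType) (f g e : R -> R) (a K : R) : 0 <= K ->
  (forall r, a <= r -> `|f r - g r| <= K * `|e r|) ->
  f = g +O_ (pinfty_filter_on R) e.
Proof.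
move=> K0 fg; apply/eqaddOP/bigO_exP; exists (K + 1); first by rewrite ltr_wpDl.
near=> r; apply: (le_trans (fg r _)).
  by near: r; apply: nbhs_pinfty_ge; rewrite num_real.
by rewrite ler_wpM2r// lerDl.
Unshelve. all: by end_near. Qed.

Theorem corollary6 (R : realType) (F : division_algebra) (N : nat)
    (N_ge2 : (2 <= N)%N) :
  (@I_hat R F N : R -> R) =
    (fun r => C_hat R F N * r ^+ (beta F * N * (N - 1)))
    +O_ (pinfty_filter_on R) (@error_term R F N)
  /\
  forall mu : {measure set (borel_mx R (rep_dim F N)) -> \bar R},
    is_haar (@SL R F N) mu -> svd_normalised mu ->
    (fun r : R => fine (mu (@D_ball R F N r))) =
      (fun r => vol_constant R F N * r ^+ (beta F * N * (N - 1)))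
      +O_ (pinfty_filter_on R) (@error_term R F N).
Proof.
case: N N_ge2 => [|[|n]] // _.
set K := n.+2`!%:R^-1 * n.+2%:R * (n.+1%:R * (1 + (beta F * n.+1)%:R * n.+2%:R + n.+2%:R)) : R.
have K0 : 0 <= K by rewrite !mulr_ge0// !addr_ge0// mulr_ge0.
have IK := @I_hat_error R F n.
split; first exact: eqaddO_pinfty K0 IK.
move=> mu _ svd; set c : R := (2 * pi `^ ((beta F)%:R / 2) / Gamma ((beta F)%:R / 2)) ^- n.+3 *
  vol_U R F n.+2 ^+ 2.
have cK0 : 0 <= `|c| * K by rewrite mulr_ge0.
apply: (eqaddO_pinfty (a := expR 1) cK0) => r er.
have r0 : 0 < r by apply: lt_le_trans er; exact: expR_gt0.
(* The normalisation makes the volume equal to [c] times [I_hat], so that the leading coefficient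
   and the error constant are multiplied by [c] and its absolute value. *)
rewrite svd// -vol_constantE -/c [fine _]/= -(mulrA c) -mulrBr normrM -[leRHS]mulrA.
by rewrite ler_wpM2l// IK.
Qed.
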